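(* Let $o=o(R_0,V,k;\cdot):V\to\mathbb{Z}$ be the function defined by $$o(v):=|\{\alpha\in R_0\mid \alpha(v)=k_\alpha\}|-|\{\alpha\in R_0\mid \alpha(v)=0\}|-\dim(V).$$ Then $o(v)\leq 0$ for all $v\in V$, and $o(v)=0$ for at most finitely many $v\in V$.
   Context: $V$ is a (finite-dimensional real) Euclidean vector space and $R_0\subset V^*$ is a reduced, integral (crystallographic) root system with Weyl group $W_0=W(R_0)$. It is not assumed that $R_0$ spans $V^*$. The Weyl group acts on $V$ and $V^*$ by orthogonal transformations. $k:R_0\to\mathbb{R}$, $\alpha\mapsto k_\alpha$, is an arbitrary $W_0$-invariant real-valued function. *)

(* Defs.v *)
From HB Require Import structures.
From mathcomp Require Import all_boot all_order all_algebra finmap.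
From mathcomp Require Import sesquilinear classical_sets cardinality reals.

Set Implicit Arguments.
Unset Strict Implicit.
Unset Printing Implicit Defensive.

Import Order.TTheory GRing.Theory Num.Theory.

Local Open Scope ring_scope.

(* A Euclidean space is a [vectType R] together with a positive definite
   symmetric bilinear form [dp : {dot V for idfun}]; its dual is
   ['Hom(V, R^o)], where [R^o] is [R] seen as a vector space over itself.
   The dual carries the inner product transported along the isomorphism
   [flat : V -> V^*] given by [dp] (see [flatE], [sharpE]). *)

Section Dual.
Variables (R : realType) (V : vectType R) (dp : {dot V for idfun}).

Definition flat : 'Hom(V, 'Hom(V, R^o)) :=
  linfun (fun u : V => linfun (dp u : V -> R^o)).

Definition sharp (a : 'Hom(V, R^o)) : V := (flat^-1)%VF a.

Definition dual_dp (a b : 'Hom(V, R^o)) : R := dp (sharp a) (sharp b).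

Definition reflection (a b : 'Hom(V, R^o)) : 'Hom(V, R^o) :=
  b - (2 * dual_dp b a / dual_dp a a) *: a.

Lemma flatE (u v : V) : flat u v = dp u v.
Proof.
pose g (u : V) : V -> R^o := dp u.
have glin w : linear (g w).
  by move=> c x y; rewrite /g linearPr.
have gE w x : linfun (g w) x = dp w x.
  pose h := HB.pack_for {linear V -> R^o} (g w)
    (GRing.isLinear.Build R V R^o *:%R (g w) (glin w)).
  exact: (lfunE h x).
have flin : linear (fun w => linfun (g w)).
  move=> c x y; apply/lfunP => z.
  by rewrite add_lfunE scale_lfunE !gE linearPl.
pose h := HB.pack_for {linear V -> 'Hom(V, R^o)} (fun w => linfun (g w))
    (GRing.isLinear.Build R V 'Hom(V, R^o) *:%R _ flin).
by rewrite /flat (lfunE h u) gE.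
Qed.

Lemma sharpE (a : 'Hom(V, R^o)) (v : V) : dp (sharp a) v = a v.
Proof.
have inj : lker flat == 0%VS.
  apply/lker0P => x y exy; apply/eqP; rewrite -subr_eq0.
  apply: contraT => /(neq0_dnorm_gt0 (s := dp)).
  have e : flat (x - y) = 0 by rewrite raddfB /= exy subrr.
  by rewrite -flatE e zero_lfunE ltxx.
have full : limg flat = fullv.
  apply/eqP; rewrite eqEdim subvf /= limg_dim_eq ?(eqP inj) ?capv0 //.
  by rewrite !dimvf /dim /= muln1.
by rewrite -flatE limg_lfunVK // full memvf.
Qed.

End Dual.

(* The roots are not required to span the dual. *)
Record root_system (R : realType) (V : vectType R) (dp : {dot V for idfun})
    (R0 : {fset 'Hom(V, R^o)}) : Prop := RootSystem {
  root_neq0 : forall a, a \in R0 -> a != 0;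
  root_refl : forall a b, a \in R0 -> b \in R0 -> reflection dp a b \in R0 }.

Definition integral_roots (R : realType) (V : vectType R)
    (dp : {dot V for idfun}) (R0 : {fset 'Hom(V, R^o)}) : Prop :=
  forall a b, a \in R0 -> b \in R0 ->
    2 * dual_dp dp b a / dual_dp dp a a \is a Num.int.

Definition reduced_roots (R : realType) (V : vectType R)
    (R0 : {fset 'Hom(V, R^o)}) : Prop :=
  forall a (c : R), a \in R0 -> c *: a \in R0 -> c = 1 \/ c = -1.

(* Reflections in roots are involutions, so the monoid of their products is the
   group they generate. *)
Inductive weyl_group (R : realType) (V : vectType R) (dp : {dot V for idfun})
    (R0 : {fset 'Hom(V, R^o)}) : ('Hom(V, R^o) -> 'Hom(V, R^o)) -> Prop :=
| weyl_id : weyl_group dp R0 idfun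
| weyl_refl a w : a \in R0 -> weyl_group dp R0 w ->
    weyl_group dp R0 (reflection dp a \o w).

Definition weyl_invariant (R : realType) (V : vectType R)
    (dp : {dot V for idfun}) (R0 : {fset 'Hom(V, R^o)}) (k : R0 -> R) : Prop :=
  forall w, weyl_group dp R0 w ->
  forall a b : R0, val b = w (val a) -> k b = k a.

Definition pole_order (R : realType) (V : vectType R)
    (R0 : {fset 'Hom(V, R^o)}) (k : R0 -> R) (v : V) : int :=
  #|[pred a : R0 | val a v == k a]|%:Z - #|[pred a : R0 | val a v == 0]|%:Z
    - (\dim {:V})%:Z.

(* Main.v *)
(* The inequality is proved for the subsystem of roots in the span of those with
   [a v = k a] or [a v = 0]. This improves [dim V] to the dimension of that span;
   so [o(v) = 0] forces the span to be everything, and then [v] is determined by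
   the two sets of roots, which leaves finitely many possibilities. It remains to
   bound, for an irreducible system, #[a v = k a] by #[a v = 0] plus the rank.

   One root length: [k] is constant and may be taken to be [1]. The vector [v],
   seen in the Cartan subalgebra of the Lie algebra [g] of the system, grades [g],
   and the inequality is [dim g_1 <= dim g_0]. It holds because some [e] in [g_1]
   has [[g_0, e] = g_1], as the Jacobson-Morozov theorem shows.

   Two root lengths, with ratio 2, and any two short roots equal, opposite or
   orthogonal (type B): the values of the short roots at [v] form a symmetric
   multiset of reals, the long roots are sums of two short ones, and the claim
   becomes an inequality between numbers of pairs with sum [a] and with sum [0].
   The same holds for the long roots (type C) by passing to coroots.

   What remains is F4 and G2. Choosing a base that is nonnegative on [v], the
   roots of given length and nonzero value at [v] form an antichain, and a finite
   computation bounds the antichains. *)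

Require Import Defs.
From HB Require Import structures.
From mathcomp Require Import finmap classical_sets cardinality.
From mathcomp Require Import all_boot all_order all_algebra.
From mathcomp Require Import sesquilinear reals boolp.
From mathcomp Require Import ring lra zify.

Set Implicit Arguments.
Unset Strict Implicit.
Unset Printing Implicit Defensive.

Import Order.TTheory GRing.Theory Num.Theory.

Local Open Scope ring_scope.

(** The Lie algebra argument needs [k] to be constant: after division by its value both counts
    become dimensions of graded pieces, and the rank enters because the Cartan subalgebra lies in
    degree 0. With two root lengths [k] has two independent values and one grading cannot see both,
    which is why those systems are treated by direct counting. No classification is invoked. With
    square lengths in ratio 2, a system that is of neither type B nor type C contains two short
    roots at 60 degrees and two long ones at 60 degrees, and these suffice to build the coordinate
    frame of F4. The Lie algebra is built from all roots at once, so no base has to be chosen; the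
    price is that the sign form must respect every integral relation between the roots. Bases occur
    only for F4 and G2, where one adapted to [v] is written down from a short root with maximal
    value at [v]. *)

(** * Linear algebra: nilpotent matrices and matrices of maximal rank *)

(** An invertible nilpotent matrix has size 0. A singular [M] factors through its rank as [Y *m X],
    and its trace is that of [X *m Y], a smaller nilpotent matrix. *)
Lemma mxtrace_nilpotent (F : fieldType) n (M : 'M[F]_n) k :
  M ^+ k = 0 -> \tr M = 0.
Proof.
elim/ltn_ind: n M k => n IH M k Mk0.
case: (ltnP (\rank M) n) => [lt_rn|le_nr].
  move: (mulmx_base M) lt_rn; move: (col_base M) (row_base M).
  move: (\rank M) => r Y X defM lt_rn; rewrite -defM mxtrace_mulC.
  apply: (IH _ lt_rn _ k.+1).
  have shift j : (X *m Y) ^+ j.+1 = X *m M ^+ j *m Y.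
    elim: j => [|j IHj]; first by rewrite expr1 expr0 mulmx1.
    by rewrite exprS IHj exprS -!mulmxE !mulmxA -(mulmxA X Y X) defM.
  by rewrite shift Mk0 mulmx0 mul0mx.
have uM : M \in unitmx by rewrite -row_full_unit /row_full eqn_leq rank_leq_row.
have : M ^+ k \in unitmx.
  elim: (k) => [|j IHj]; first by rewrite expr0 unitmx1.
  by rewrite exprS -mulmxE unitmx_mul uM.
rewrite Mk0; case: n {IH Mk0 le_nr uM} M => [|n] M; first by rewrite /mxtrace big_ord0.
by rewrite unitmxE det0 unitr0.
Qed.

(* Jacobson's lemma: if [E^j C^a = 0] then
   [C^a (E^j U - U E^j) C^a = j E^(j-1) C^(2a+1)] vanishes too. *)
Lemma commutator_nilpotent (F : numFieldType) n (E U C : 'M[F]_n) s :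
  C = E * U - U * E -> GRing.comm E C -> E ^+ s = 0 -> exists a, C ^+ a = 0.
Proof.
move=> CE comEC Es0.
have comX j a : E ^+ j * C ^+ a = C ^+ a * E ^+ j.
  by apply/commrX/commr_sym/commrX/commr_sym.
have brX j : E ^+ j.+1 * U - U * E ^+ j.+1 = (E ^+ j * C) *+ j.+1.
  elim: j => [|j IHj]; first by rewrite expr1 expr0 mul1r CE.
  have -> : E ^+ j.+2 * U - U * E ^+ j.+2 =
     E * (E ^+ j.+1 * U - U * E ^+ j.+1) + (E * U - U * E) * E ^+ j.+1.
    by rewrite mulrBr mulrBl [E ^+ j.+2]exprS !mulrA addrA subrK.
  rewrite IHj -CE -mulrnAr mulrA -exprS mulrnAr.
  have := comX j.+1 1%N; rewrite expr1 => <-.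
  by rewrite -mulrSr.
have key j : (exists a, E ^+ j * C ^+ a = 0) -> exists a, C ^+ a = 0.
  elim: j => [|j IHj] [a Ha]; first by exists a; rewrite -Ha mul1r.
  apply: IHj; exists (a + a.+1)%N.
  have : C ^+ a * (E ^+ j.+1 * U - U * E ^+ j.+1) * C ^+ a = 0.
    by rewrite mulrBr mulrBl mulrA -comX Ha -!mulrA Ha !mulr0 !mul0r subr0.
  rewrite brX mulrnAr mulrnAl => /eqP; rewrite -scaler_nat scaler_eq0 pnatr_eq0 /=.
  move=> /eqP H; rewrite exprD mulrA comX exprS -[RHS]H !mulrA.
  by rewrite -!mulrA.
by apply: (key s); exists 0%N; rewrite Es0 mul0r.
Qed.

(** First-order condition at a matrix of maximal rank: since [u *m A = 0], the row [u *m B] lies in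
    the row space of [A + t *: B] for every [t != 0]; outside the row space of [A] it would raise
    the rank for some such [t]. *)
Lemma rank_perturb (F : numFieldType) m n (A B : 'M[F]_(m, n)) (u : 'rV_m) :
  (forall t, (\rank (A + t *: B)%R <= \rank A)%N) -> u *m A = 0 ->
  (u *m B <= A)%MS.
Proof.
move=> rk uA0; apply/negPn/negP => nuB.
pose r := \rank A.
have [X XA] : exists X : 'M_(r, m), X *m A = row_base A.
  by have /submxP[X ->] : (row_base A <= A)%MS; [rewrite eq_row_base | exists X].
pose Q t := col_mx (X *m (A + t *: B)) (u *m B).
have r0 : row_free (col_mx (X *m A) (u *m B)).
  rewrite /row_free -addsmxE XA.
  have /eqP := mxrank_sum_cap (row_base A) (u *m B).
  have -> : (row_base A :&: u *m B)%MS = 0.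
    apply/eqP; rewrite -mxrank_eq0 -leqn0 -ltnS.
    have : (\rank (row_base A :&: u *m B)%MS < \rank (u *m B))%N.
      rewrite ltn_neqAle mxrankS ?capmxSr // andbT.
      apply/negP => /eqP e.
      have : (u *m B <= row_base A :&: u *m B)%MS.
        have [_ <-] := mxrank_leqif_sup (capmxSr (row_base A) (u *m B)).
        by rewrite e.
      by rewrite sub_capmx eq_row_base (negPf nuB).
    by move/leq_trans => /(_ 1%N); apply; apply: rank_leq_row.
  have -> : \rank (u *m B) = 1%N.
    apply/eqP; rewrite eqn_leq rank_leq_row lt0n mxrank_eq0.
    by apply: contra nuB => /eqP->; apply: sub0mx.
  by rewrite mxrank0 addn0 eq_row_base => /eqP ->.
have /row_freeP[P Q0P] := r0.
pose M := col_mx (X *m B) (0 : 'M_(1, n)) *m P.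
have QP t : Q t *m P = 1%:M + t *: M.
  have -> : Q t = col_mx (X *m A) (u *m B) + t *: col_mx (X *m B) 0.
    by rewrite scale_col_mx add_col_mx scaler0 addr0 /Q mulmxDr scalemxAr.
  by rewrite mulmxDl -scalemxAl Q0P.
(* Away from the roots of the characteristic polynomial of [M] the matrix
   [1 + t M] is invertible, so [A + t B] has rank at least [r + 1]. *)
have [t t0 ut] : exists2 t, t != 0 & 1%:M + t *: M \in unitmx.
  pose p := char_poly M.
  have pn0 : p != 0 by apply: monic_neq0; apply: char_poly_monic.
  pose rs := [seq (- (i.+1)%:R : F) | i <- iota 0 (size p)].
  have : ~~ all (root p) rs.
    apply/negP => /(max_poly_roots pn0); rewrite size_map size_iota ltnn.
    move=> /(_ _)/negP; case; rewrite ?negbK //.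
    rewrite map_inj_uniq ?iota_uniq // => i j /oppr_inj/eqP.
    by rewrite eqr_nat eqSS => /eqP.
  rewrite -has_predC => /hasP[x /mapP[i _ ->]] /=.
  rewrite -eigenvalue_root_char => ne.
  set c : F := i.+1%:R; have c0 : c != 0 by rewrite pnatr_eq0.
  exists c^-1; first by rewrite invr_eq0.
  have -> : 1%:M + c^-1 *: M = c^-1 *: (M - (- c)%:M).
    rewrite scalerBr scale_scalar_mx mulrN mulVf // addrC.
    by rewrite (raddfN (@scalar_mx F _)) opprK.
  rewrite unitmxZ ?unitfE ?invr_eq0 //.
  move: ne; rewrite /eigenvalue negbK /eigenspace => /eqP k0.
  by rewrite -row_free_unit -kermx_eq0 k0.
have : row_free (Q t).
  apply/row_freeP; exists (P *m invmx (1%:M + t *: M)).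
  by rewrite mulmxA QP mulmxV.
rewrite /row_free => /eqP rQ.
have : (Q t <= (A + t *: B)%R)%MS.
  rewrite col_mx_sub submxMl /=.
  have -> : u *m B = t^-1 *: (u *m (A + t *: B)).
    by rewrite mulmxDr uA0 add0r -scalemxAr scalerA mulVf // scale1r.
  by rewrite scalemx_sub // submxMl.
move/mxrankS; rewrite rQ => /leq_trans/(_ (rk t)).
by rewrite /r addn1 ltnn.
Qed.

Lemma mul_diag_mxE (R : pzSemiRingType) n (a b : 'rV[R]_n) j :
  (a *m diag_mx b) 0 j = a 0 j * b 0 j.
Proof. by rewrite mul_mx_diag mxE. Qed.

(** * Graded Lie algebras with a nondegenerate trace form *)

Section GradedLie.
Variables (F : archiRealFieldType) (N : nat).
(** Matrices act on row vectors from the right, so the Jacobi identity takes the form [adJ]: [ad]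
    preserves brackets. Degrees are eigenvalues of the right bracket with [v] and may be arbitrary
    scalars. *)
Variable ad : {linear 'rV[F]_N -> 'M[F]_N}.
Local Notation "[ 'lie' a , b ]" := (a *m ad b) (format "[ 'lie'  a ,  b ]").

Hypothesis adC : forall a b, [lie a, b] = - [lie b, a].
Hypothesis adJ : forall a b, ad [lie a, b] = ad a * ad b - ad b * ad a.

(** The Killing form; its nondegeneracy plays the part of semisimplicity. *)
Definition trace_form a b := \tr (ad a * ad b).
Local Notation kappa := trace_form.
Hypothesis kappa_nondeg : forall a, (forall b, kappa a b = 0) -> a = 0.

Variables (v d : 'rV[F]_N).
Hypothesis ad_v : ad v = diag_mx d.

Definition homog t (a : 'rV[F]_N) := [lie a, v] = t *: a.

Lemma kappaC a b : kappa a b = kappa b a.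
Proof. by rewrite /kappa -!mulmxE mxtrace_mulC. Qed.

Lemma kappa_assoc a b c : kappa [lie a, b] c = kappa a [lie b, c].
Proof.
rewrite /kappa !adJ mulrBl mulrBr !raddfB /= -!mulrA; congr (_ - _).
by rewrite -!mulmxE mxtrace_mulC mulmxA.
Qed.

Lemma kappaDl a b c : kappa (a + b) c = kappa a c + kappa b c.
Proof. by rewrite /kappa linearD mulrDl raddfD. Qed.

Lemma kappaZl t a c : kappa (t *: a) c = t * kappa a c.
Proof. by rewrite /kappa linearZ -mulmxE -scalemxAl mxtraceZ. Qed.

Lemma kappa_suml I (r : seq I) (P : pred I) (f : I -> 'rV[F]_N) c :
  kappa (\sum_(i <- r | P i) f i) c = \sum_(i <- r | P i) kappa (f i) c.
Proof.
elim/big_rec2: _ => [|i x y _ <-]; last by rewrite kappaDl.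
by rewrite -(scale0r (0 : 'rV_N)) kappaZl mul0r.
Qed.

Lemma homog_delta i : homog (d 0 i) (delta_mx 0 i).
Proof.
rewrite /homog ad_v; apply/rowP => j; rewrite mul_diag_mxE !mxE eqxx /= mulrC.
by case: eqVneq => [->|_]; rewrite // !mulr0.
Qed.

Lemma homog_br s t a b : homog s a -> homog t b -> homog (s + t) [lie a, b].
Proof.
rewrite /homog => ha hb.
have /(congr1 (mulmx a)) := adJ b v; rewrite hb mulmxBr !mulmxA ha.
rewrite linearZ /= -scalemxAr -scalemxAl => /eqP.
by rewrite eq_sym subr_eq scalerDl addrC => /eqP.
Qed.

Lemma kappa_homog s t a b :
  homog s a -> homog t b -> s + t != 0 -> kappa a b = 0.
Proof.
move=> ha hb st; have := kappa_assoc a v b.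
rewrite ha (adC v) hb -scaleNr kappaZl (kappaC a (_ *: _)) kappaZl (kappaC b).
move/eqP; rewrite -subr_eq0 -mulrBl opprK mulf_eq0 (negPf st) /=.
by move/eqP.
Qed.

Definition dproj t : 'M[F]_N := diag_mx (\row_i (d 0 i == t)%:R).

Lemma dprojE t (a : 'rV_N) j : (a *m dproj t) 0 j = a 0 j * (d 0 j == t)%:R.
Proof. by rewrite mul_diag_mxE mxE. Qed.

Lemma homog_dproj t (a : 'rV_N) : homog t (a *m dproj t).
Proof.
rewrite /homog ad_v; apply/rowP => j; rewrite mul_diag_mxE dprojE [RHS]mxE dprojE.
by case: eqVneq => [->|_]; rewrite ?mulr0 ?mul0r // mulrC.
Qed.

Lemma dproj_homog t a : homog t a -> a *m dproj t = a.
Proof.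
rewrite /homog ad_v => /rowP ha; apply/rowP => j; rewrite dprojE.
case: eqVneq (ha j) => [_ _|nt]; first by rewrite mulr1.
rewrite mul_diag_mxE mxE mulr0 mulrC => /eqP.
by rewrite -subr_eq0 -mulrBl mulf_eq0 subr_eq0 (negPf nt) => /eqP.
Qed.

Lemma kappa_dproj t a b : homog t a -> kappa a (b *m dproj (- t)) = kappa a b.
Proof.
move=> ha; rewrite !(kappaC a) [b]row_sum_delta mulmx_suml !kappa_suml.
apply: eq_bigr => j _; rewrite -scalemxAl !kappaZl.
case: (eqVneq (d 0 j) (- t)) => [e|ne].
  by rewrite dproj_homog // -e; apply: homog_delta.
rewrite (@kappa_homog (d 0 j) t _ _ (homog_delta j)) ?addr_eq0 //.
suff -> : delta_mx 0 j *m dproj (- t) = 0 :> 'rV_N.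
  by rewrite -(scale0r (0 : 'rV_N)) kappaZl mul0r.
apply/rowP => i; rewrite dprojE !mxE eqxx /=.
by case: (eqVneq i j) => [->|_]; rewrite ?(negPf ne) ?mulr0 ?mul0r.
Qed.

Lemma homog_nondeg t a :
  homog t a -> (forall b, homog (- t) b -> kappa a b = 0) -> a = 0.
Proof.
move=> ha ka; apply: kappa_nondeg => b.
by rewrite -(kappa_dproj _ ha) ka //; apply: homog_dproj.
Qed.

(** A column of the cokernel of [X] at which [y] does not vanish is a linear functional.
    Nondegeneracy represents it by an element, whose component of degree [- t] has the same pairing
    with everything of degree [t]. *)
Lemma separate t p (X : 'M_(p, N)) y :
  homog t y -> (forall x, homog t (x *m X)) -> ~~ (y <= X)%MS ->
  exists w, [/\ homog (- t) w, forall x, kappa (x *m X) w = 0 & kappa y w != 0].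
Proof.
move=> hy hX nyX.
pose G : 'M[F]_N := \matrix_(i, j) kappa (delta_mx 0 i) (delta_mx 0 j).
have GE a b : kappa a b = (a *m G *m b^T) 0 0.
  rewrite {1}[a]row_sum_delta kappa_suml -mulmxA mxE; apply: eq_bigr => i _.
  rewrite kappaZl; congr (_ * _).
  rewrite kappaC {1}[b]row_sum_delta kappa_suml mxE; apply: eq_bigr => j _.
  by rewrite kappaZl !mxE mulrC kappaC.
have uG : G \in unitmx.
  rewrite -row_free_unit -kermx_eq0; apply/eqP/row_matrixP => i; rewrite row0.
  apply: kappa_nondeg => b; rewrite GE.
  have -> : row i (kermx G) *m G = 0 by rewrite -row_mul mulmx_ker row0.
  by rewrite mul0mx mxE.
have : y *m cokermx X != 0 by rewrite -submxE.
case/rV0Pn => j nz.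
pose w := (invmx G *m col j (cokermx X))^T.
have kw a : kappa a w = (a *m cokermx X) 0 j.
  by rewrite GE trmxK -mulmxA mulKVmx // !mxE; apply: eq_bigr => i _; rewrite mxE.
exists (w *m dproj (- t)); split; first exact: homog_dproj.
  by move=> x; rewrite (kappa_dproj _ (hX x)) kw -mulmxA mulmx_coker mulmx0 mxE.
by rewrite kappa_dproj // kw.
Qed.

(** [ad e] raises degrees by 1, and only finitely many degrees occur. *)
Lemma ad_nilpotent e : homog 1 e -> exists s, ad e ^+ s = 0.
Proof.
move=> he.
have step k i j : (ad e ^+ k) i j != 0 -> d 0 j = d 0 i + k%:R.
  elim: k j => [|k IHk] j.
    by rewrite expr0 mxE; case: (eqVneq i j) => [->|]; rewrite ?addr0 // eqxx.
  rewrite exprSr -mulmxE mxE => nz.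
  have [l] : exists l, (ad e ^+ k) i l * ad e l j != 0.
    apply/existsP; apply: contraNT nz => /existsPn nz.
    by rewrite big1 // => l _; apply/eqP; move: (nz l); rewrite negbK.
  rewrite mulf_eq0 negb_or => /andP[/IHk dl ej].
  have := homog_br (homog_delta l) he.
  rewrite /homog ad_v => /rowP/(_ j).
  rewrite mul_mx_diag -rowE !mxE mulrC => /(mulIf ej) ->.
  by rewrite dl -addrA natr1.
(* A nonzero [(i, j)] entry of [ad e ^+ B] would make [d 0 j - d 0 i] equal to [B], whereas [B]
   strictly exceeds every nonnegative difference of degrees. *)
pose bnd i j := Num.bound (d 0 j - d 0 i).
pose B := (\sum_i \sum_j bnd i j)%N.
exists B; apply/matrixP => i j; rewrite mxE; apply/eqP/negPn/negP => /step dj.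
have le_B : (bnd i j <= B)%N.
  by rewrite /B (bigD1 i) //= (bigD1 j) //= -addnA leq_addr.
have dB : d 0 j - d 0 i = B%:R by rewrite dj addrC addKr.
have /archi_boundP : 0 <= d 0 j - d 0 i by rewrite dB ler0n.
by rewrite -/(bnd i j) {1}dB ltr_nat ltnNge le_B.
Qed.

(** If [e = [[y, e], e]] with [y] of degree -1, take [f = - 2 y]. Otherwise duality gives [u] of
    degree -1 orthogonal to all [[[y, e], e]] but not to [e]. Then [c = [e, u]] commutes with [e],
    so [ad c] is nilpotent; it commutes with [v] as well, so [ad v * ad c] is nilpotent and has
    trace 0. As [e = [e, v]], that trace is [- kappa e u], a contradiction. *)
Lemma jacobson_morozov e : homog 1 e ->
  exists f, homog (-1) f /\ [lie [lie e, f], e] = 2 *: e.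
Proof.
move=> he.
pose X := dproj (-1) *m ad e *m ad e.
case: (boolP (e <= X)%MS) => [/submxP[x ex]|nX].
  exists ((-2) *: (x *m dproj (-1))); split.
    by rewrite /homog -scalemxAl homog_dproj !scalerA mulrC.
  rewrite (adC e) mulNmx -!scalemxAl -scaleNr opprK; congr (_ *: _).
  by rewrite [RHS]ex /X !mulmxA.
have hX x : homog 1 (x *m X).
  rewrite /X !mulmxA; have := homog_br (homog_br (homog_dproj (-1) x) he) he.
  by rewrite addNr add0r.
have [u [hu uX ue] ] := separate he hX nX.
set c := [lie e, u].
have hc : homog 0 c by have := homog_br he hu; rewrite subrr.
have ec0 : [lie e, c] = 0.
  have hec : homog 1 [lie e, c] by have := homog_br he hc; rewrite addr0.
  apply: (homog_nondeg hec) => f hf.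
  rewrite kappaC -2!kappa_assoc.
  have <- := uX f; rewrite /X !mulmxA dproj_homog //.
have adc : ad c = ad e * ad u - ad u * ad e by rewrite adJ.
have comEC : GRing.comm (ad e) (ad c).
  by apply/eqP; rewrite -subr_eq0 -adJ ec0 linear0.
have comCD : GRing.comm (ad v) (ad c).
  by apply/eqP; rewrite eq_sym -subr_eq0 -adJ hc scale0r linear0.
have [s Es0] := ad_nilpotent he.
have [a Ca0] := commutator_nilpotent adc comEC Es0.
case/negP: ue; rewrite /kappa.
have -> : ad e = ad e * ad v - ad v * ad e by rewrite -adJ he scale1r.
rewrite mulrBl raddfB /= -mulrA -!mulmxE mxtrace_mulC !mulmxE -!mulrA -raddfB -mulrBr.
rewrite -opprB -adc mulrN raddfN oppr_eq0.
apply/eqP; apply: (@mxtrace_nilpotent _ _ _ a).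
by rewrite exprMn_comm // Ca0 mulr0.
Qed.

(** If [w = y *m ad e ^+ n], then [brX] applied to [y] puts [(n + 1) (n + 2) w] in the image of
    [ad e ^+ n.+1]. The factor never vanishes, so [w] lies in the image of every power of a
    nilpotent matrix. *)
Lemma sl2_no_lowest e f (w : 'rV_N) : homog 1 e ->
  [lie [lie e, f], e] = 2 *: e -> [lie w, e] = 0 ->
  [lie w, [lie e, f] ] = 2 *: w -> w = 0.
Proof.
move=> he hfe we wh; set H := ad [lie e, f].
have HE : H = ad e * ad f - ad f * ad e by rewrite /H adJ.
have HEE : H * ad e = ad e * H + 2 *: ad e.
  by rewrite -linearZ -hfe /= (adJ [lie e, f]) addrC subrK.
have brX n : ad e ^+ n.+1 * ad f - ad f * ad e ^+ n.+1
    = n.+1%:R *: (ad e ^+ n * (H + n%:R%:M)).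
  elim: n => [|n IHn].
    by rewrite !expr1 expr0 mul1r -HE scale1r (raddf0 (@scalar_mx _ _)) addr0.
  have -> : ad e ^+ n.+2 * ad f - ad f * ad e ^+ n.+2 =
      ad e ^+ n.+1 * H + (ad e ^+ n.+1 * ad f - ad f * ad e ^+ n.+1) * ad e.
    by rewrite HE mulrBr mulrBl (exprSr _ n.+1) !mulrA addrA subrK.
  have HnE : (H + n%:R%:M) * ad e = ad e * (H + n.+2%:R%:M).
    rewrite mulrDl HEE mulrDr -addrA; congr (_ + _).
    rewrite -!mulmxE mul_scalar_mx mul_mx_scalar -scalerDl.
    by congr (_ *: _); rewrite -natrD.
  rewrite IHn -mulmxE -scalemxAl mulmxE -mulrA HnE mulrA -exprSr.
  rewrite -!mulmxE scalemxAr scalemxAr -mulmxDr; congr (_ *m _).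
  rewrite !scalerDr addrA -{1}[H]scale1r -scalerDl nat1r; congr (_ + _).
  by rewrite !scale_scalar_mx -!natrM mulnC.
have im n : exists y, w = y *m ad e ^+ n.
  elim: n => [|n [y wy]]; first by exists w; rewrite expr0 mulmx1.
  have := congr1 (mulmx y) (brX n).
  rewrite mulmxBr (exprSr _ n) -!mulmxE !mulmxA -wy we mul0mx sub0r.
  rewrite -scalemxAr mulmxA -wy mulmxDr wh mul_mx_scalar -scalerDl scalerA => eq.
  exists (- ((n.+1%:R * (2 + n%:R))^-1 *: (y *m ad f))).
  rewrite mulNmx -scalemxAl -scalerN !mulmxA eq scalerA mulVf ?scale1r //.
  by rewrite -natrD -natrM pnatr_eq0.
have [s Es0] := ad_nilpotent he.
by have [y ->] := im s; rewrite Es0 mulmx0.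
Qed.

Lemma mxrank_dproj t : \rank (dproj t) = #|[pred i | d 0 i == t]|.
Proof.
set A := [pred i | _].
pose X : 'M[F]_(#|A|, N) := \matrix_(a, j) (enum_val a == j)%:R.
have XXT : X *m X^T = 1%:M.
  apply/matrixP => a b; rewrite !mxE (bigD1 (enum_val a)) //= big1 => [|j nj].
    by rewrite !mxE eqxx mul1r addr0 (inj_eq enum_val_inj) eq_sym.
  by rewrite !mxE eq_sym (negPf nj) mul0r.
have XTX : X^T *m X = dproj t.
  apply/matrixP => i j; rewrite !mxE.
  case: (boolP (i \in A)) => Ai.
    rewrite (bigD1 (enum_rank_in Ai i)) //= big1 => [|a na]; last first.
      rewrite !mxE; case: eqP => [e|_]; rewrite ?mul0r //.
      by case/eqP: na; apply: enum_val_inj; rewrite enum_rankK_in.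
    rewrite !mxE enum_rankK_in // eqxx mul1r addr0.
    by move: Ai; rewrite inE => ->.
  rewrite big1 => [|a _].
    by move: Ai; rewrite inE => /negPf->; rewrite mul0rn.
  rewrite !mxE; case: eqP => [e|_]; rewrite ?mul0r //.
  by move: Ai; rewrite -e enum_valP.
have rX : \rank X = #|A| by apply/eqP/row_freeP; exists X^T.
apply/eqP; rewrite eqn_leq; apply/andP; split.
  by rewrite -rX -XTX mxrankM_maxr.
rewrite -[leqLHS]rX.
have -> : X = X *m dproj t by rewrite -XTX mulmxA XXT mul1mx.
exact: mxrankM_maxr.
Qed.

(* [e] of degree 1 with [ad e : g_0 -> g_1] of maximal rank has [ad e] onto [g_1]:
   by [rank_perturb] an element [w] of [g_(-1)] orthogonal to the image commutes
   with [e] and with the centralizer of [e] in [g_0], which contains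
   [v + [e, f] / 2] for an sl2-triple through [e]. Thus [w] has weight 2 and is
   killed by [e], which is impossible for nilpotent [ad e] unless [w = 0]. *)
Lemma graded_dim_le : (#|[pred i | d 0%R i == 1%R]| <= #|[pred i | d 0%R i == 0%R]|)%N.
Proof.
pose T e := dproj 0 *m ad e.
have [e [he emax] ] : exists e, homog 1 e /\
    forall y, homog 1 y -> (\rank (T y) <= \rank (T e))%N.
  pose P r := `[< exists e, homog 1 e /\ \rank (T e) = r >].
  have exP : exists r, P r.
    exists (\rank (T 0)); apply/asboolP; exists 0; split=> //.
    by rewrite /homog mul0mx scaler0.
  have leP r : P r -> (r <= N)%N.
    by move=> /asboolP[e [_ <-] ]; apply: rank_leq_row.
  case: (ex_maxnP exP leP) => r /asboolP[e [he <-] ] rmax.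
  by exists e; split=> // y hy; apply: rmax; apply/asboolP; exists y.
rewrite -!mxrank_dproj; suff : (dproj 1 <= T e)%MS.
  move/mxrankS/leq_trans; apply; apply: mxrankM_maxl.
apply/row_subP => i; set y := row i _.
have hy : homog 1 y by rewrite /y rowE; apply: homog_dproj.
have zT z a : homog 0 z -> z *m T a = [lie z, a].
  by move=> hz; rewrite mulmxA dproj_homog.
have hT x : homog 1 (x *m T e).
  rewrite mulmxA; have := homog_br (homog_dproj 0 x) he.
  by rewrite add0r.
apply/negPn/negP => nyT.
have [w [hw wT /eqP[] ] ] := separate hy hT nyT.
suff -> : w = 0 by rewrite kappaC -(scale0r (0 : 'rV_N)) kappaZl mul0r.
have ew : [lie e, w] = 0.
  have hew := homog_br he hw; rewrite subrr in hew.
  apply: (homog_nondeg hew) => b; rewrite oppr0 => hb.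
  by rewrite kappaC -kappa_assoc -(zT _ _ hb) wT.
have we : [lie w, e] = 0 by rewrite adC ew oppr0.
have wz z : homog 0 z -> [lie z, e] = 0 -> [lie w, z] = 0.
  move=> hz ze; have hwz := homog_br hw hz; rewrite addr0 in hwz.
  apply: (homog_nondeg hwz) => b; rewrite opprK => hb.
  rewrite kappa_assoc kappaC -(zT _ _ hz).
  have : (z *m T b <= T e)%MS.
    apply: rank_perturb; last by rewrite zT.
    move=> t; have -> : T e + t *: T b = T (e + t *: b).
      by rewrite /T linearD linearZ /= mulmxDr -scalemxAr.
    by apply: emax; rewrite /homog mulmxDl -scalemxAl he hb scalerDr !scalerA mulrC.
  by case/submxP=> x ->.
have [f [hf hfe] ] := jacobson_morozov he.
have hh : homog 0 [lie e, f] by have := homog_br he hf; rewrite subrr.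
apply: (sl2_no_lowest he hfe we).
have hv : homog 0 v.
  rewrite /homog scale0r; have /eqP := adC v v.
  by rewrite -subr_eq0 opprK -mulr2n -scaler_nat scaler_eq0 pnatr_eq0 => /eqP.
have := wz (v + 2^-1 *: [lie e, f]).
rewrite mulmxDl -scalemxAl hfe scalerA mulVf ?pnatr_eq0 // scale1r.
rewrite (adC v) he scale1r addNr linearD linearZ /= mulmxDr hw -scalemxAr scaleN1r.
move=> /(_ _ erefl) wh.
have {}wh : - w + 2^-1 *: [lie w, [lie e, f] ] = 0.
  apply: wh; rewrite /homog mulmxDl hv -scalemxAl hh !scale0r scaler0 addr0 //.
move/eqP: wh; rewrite addrC subr_eq0 => /eqP wE; rewrite -[in RHS]wE.
by rewrite scalerA mulfV ?pnatr_eq0 // scale1r.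
Qed.
End GradedLie.

(* [f] has to descend to the quotient by the kernel of [C], so the upper
   triangular half of the form is taken in a basis adapted to that kernel, given by
   the Smith normal form. *)
Lemma even_form_cocycle m (C : 'M[int]_m) :
  C^T = C -> (forall i, C i i = 2) ->
  exists f : 'M[int]_m, [/\ f + f^T = C, forall i, f i i = 1,
    forall x : 'rV_m, x *m C = 0 -> x *m f = 0 &
    forall x : 'rV_m, x *m C = 0 -> f *m x^T = 0].
Proof.
move=> Csym Cdiag.
pose half (K : 'I_m -> int) (G : 'M[int]_m) : 'M[int]_m :=
  \matrix_(i, j) (if (i < j)%N then G i j else if i == j then K i else 0).
have halfD K (G : 'M[int]_m) : G^T = G -> (forall i, G i i = K i *+ 2) ->
    half K G + (half K G)^T = G.
  move=> Gsym GK; apply/matrixP => i j; rewrite !mxE [j == i]eq_sym.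
  case: ltngtP => [lt_ij|lt_ji|/ord_inj ->].
  - by rewrite (_ : (i == j) = false) ?addr0 // -val_eqE /=; apply/eqP; lia.
  - rewrite (_ : (i == j) = false) ?add0r; last by rewrite -val_eqE /=; apply/eqP; lia.
    by rewrite -{2}Gsym mxE.
  - by rewrite eqxx GK mulr2n.
have [L uL [Rm uR [d _ CE] ] ] := int_Smith_normal_form C.
pose D : 'M[int]_m := \matrix_(i, j) (d`_i *+ (i == j :> nat)).
rewrite -/D in CE.
pose U := invmx L.
pose G := U *m C *m U^T.
have LTU : U^T *m L^T = 1%:M by rewrite -trmx_mul mulmxV // trmx1.
have Gsym : G^T = G by rewrite /G !trmx_mul trmxK Csym mulmxA.
have CG : C = L *m G *m L^T.
  by rewrite /G !mulmxA mulmxV // mul1mx -mulmxA LTU mulmx1.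
(* From [C = F0 + F0^T] follows [G = K + K^T]: the diagonal of [K] is an integral half of that of
   [G], which the triangular half [F] of [G] needs. *)
pose F0 := half (fun=> 1) C.
pose K := U *m F0 *m U^T.
have GK : G = K + K^T.
  have C0 : F0 + F0^T = C by apply: halfD => // i; rewrite Cdiag.
  by rewrite /G -C0 mulmxDr mulmxDl /K !trmx_mul trmxK mulmxA.
pose F := half (fun i => K i i) G.
have FG : F + F^T = G.
  by apply: halfD => // i; rewrite GK !mxE mulr2n.
(* Zero invariants, including the default value past the end of [d], mark the vectors of the adapted
   basis that lie in the kernel of [C]. There [F] has zero rows and columns. *)
have G0 (t j : 'I_m) : d`_t = 0 -> G t j = 0.
  move=> dt; have -> : G = D *m (Rm *m U^T).
    by rewrite /G CE !mulmxA mulVmx // mul1mx.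
  by rewrite mxE big1 // => k _; rewrite mxE dt mul0rn mul0r.
have F0l (t j : 'I_m) : d`_t = 0 -> F t j = 0.
  move=> dt; rewrite mxE G0 //; case: ifP => // _; case: ifP => // _.
  have := congr1 (fun X : 'M_m => X t t) GK; rewrite (G0 _ _ dt) !mxE.
  rewrite -mulr2n => /esym/eqP; rewrite mulrn_eq0 /= => /eqP //.
have F0r (j t : 'I_m) : d`_t = 0 -> F j t = 0.
  move=> dt; have := congr1 (fun X : 'M_m => X j t) FG.
  rewrite mxE [F^T _ _]mxE F0l // addr0 => ->.
  by rewrite -Gsym mxE G0.
have ker (x : 'rV_m) (t : 'I_m) : x *m C = 0 -> d`_t = 0 \/ (x *m L) 0 t = 0.
  rewrite CE !mulmxA => xC.
  have : x *m L *m D = 0.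
    by rewrite -[LHS](mulmxK uR) xC mul0mx.
  move=> /rowP/(_ t); rewrite mxE (bigD1 t) //= big1 => [|k nk].
    have -> : D t t = d`_t by rewrite mxE eqxx.
    rewrite addr0 [RHS]mxE => /eqP.
    by rewrite mulf_eq0 => /orP[] /eqP; [right|left].
  have -> : D k t = 0 by rewrite mxE val_eqE (negPf nk).
  by rewrite mulr0.
exists (L *m F *m L^T); split.
- by rewrite !trmx_mul trmxK mulmxA -mulmxDl -mulmxDr FG CG.
- move=> i; pose f := L *m F *m L^T.
  have : f i i + f i i = 2.
    rewrite -(Cdiag i) CG -FG mulmxDr mulmxDl -/f [RHS]mxE; congr (_ + _).
    have -> : L *m F^T *m L^T = f^T by rewrite /f !trmx_mul trmxK mulmxA.
    by rewrite [RHS]mxE.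
  by rewrite -/f; move: (f i i) => x xx; lia.
- move=> x xC; rewrite !mulmxA; suff -> : x *m L *m F = 0 by rewrite mul0mx.
  apply/rowP => j; rewrite mxE big1 ?mxE // => t _.
  by case: (ker x t xC) => [/F0l->|->]; rewrite ?mulr0 ?mul0r.
- move=> x xC; rewrite -!mulmxA -trmx_mul.
  suff -> : F *m (x *m L)^T = 0 by rewrite mulmx0.
  apply/colP => j; rewrite mxE big1 ?mxE // => t _; rewrite [(x *m L)^T _ _]mxE.
  by case: (ker x t xC) => [/F0r->|->]; rewrite ?mulr0 ?mul0r.
Qed.

Record simply_laced_gram m (C : 'M[int]_m) : Prop := SimplyLacedGram {
  sl_sym : C^T = C;
  sl_diag : forall i, C i i = 2;
  sl_range : forall i j, `|C i j| <= 2;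
  sl_inj : forall i j, C i j = 2 -> i = j;
  sl_oppP : forall i j, C i j = -2 -> row j C = - row i C;
  sl_opp : forall i, exists j, C i j = -2;
  sl_add : forall i j, C i j = -1 -> exists l, row l C = row i C + row j C }.

(** * The Lie algebra of a simply laced root system *)

(* [C] is the Gram matrix of all the roots, not only of the simple ones: the
   roots are represented by the rows of [C], and [f] is the bilinear form that
   yields the signs [eps] of the structure constants. *)
Section RootLieAlgebra.
Variables (F : archiRealFieldType) (m : nat) (C : 'M[int]_m).
Hypothesis slC : simply_laced_gram C.
Variable f : 'M[int]_m.
Hypothesis fC : f + f^T = C.
Hypothesis f_diag : forall i, f i i = 1.
Hypothesis f_kerl : forall x : 'rV_m, x *m C = 0 -> x *m f = 0.
Hypothesis f_kerr : forall x : 'rV_m, x *m C = 0 -> f *m x^T = 0.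

Let eps i j : F := (-1) ^ (f i j).
Let CF : 'M[F]_m := map_mx intr C.
Let r := \rank CF.
Let cobase : 'M[F]_(m, r) := col_base CF.
Let base : 'M[F]_(r, m) := row_base CF.
Local Notation N := (m + r)%N.

Lemma cobaseK : cobase *m base = CF. Proof. exact: mulmx_base. Qed.

Lemma Csym i j : C i j = C j i.
Proof. by rewrite -{1}(sl_sym slC) mxE. Qed.

Lemma row_C_inj i j : row i C = row j C -> i = j.
Proof.
move=> /rowP/(_ j); rewrite !mxE (sl_diag slC).
exact: (sl_inj slC).
Qed.

(** A vector in the row space of [CF] lists the values of one linear functional at the roots, so it
    respects the linear relations between them. *)
Lemma row_additive (a b : F) i j l (x : 'rV[F]_m) :
  (x <= CF)%MS ->
  map_mx intr (row l C) =
    a *: map_mx intr (row i C) + b *: map_mx intr (row j C) :> 'rV[F]_m ->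
  x 0 l = a * x 0 i + b * x 0 j.
Proof.
move=> /submxP[y ->] /rowP e; rewrite !mxE !mulr_sumr -big_split /=.
apply: eq_bigr => k _; have := e k; rewrite !mxE !(Csym k) => ->.
by rewrite mulrDr !(mulrCA (y 0 k)).
Qed.

Lemma sub_base (h : 'rV[F]_r) : (h *m base <= CF)%MS.
Proof. by apply: (submx_trans (submxMl _ _)); rewrite eq_row_base. Qed.

Lemma baseD (h : 'rV[F]_r) i j l : row l C = row i C + row j C ->
  (h *m base) 0 l = (h *m base) 0 i + (h *m base) 0 j.
Proof.
move=> e; rewrite (@row_additive 1 1 i j l _ (sub_base h)) ?mul1r //.
by rewrite e map_mxD !scale1r.
Qed.

Lemma baseN (h : 'rV[F]_r) i j : row j C = - row i C ->
  (h *m base) 0 j = - (h *m base) 0 i.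
Proof.
move=> e; rewrite (@row_additive (-1) 0 i j j _ (sub_base h)) ?mul0r ?addr0 ?mulN1r //.
by rewrite e map_mxN scaleN1r scale0r addr0.
Qed.

Lemma row_cobase_inj (x : 'rV[F]_m) : x *m CF = 0 -> x *m cobase = 0.
Proof.
rewrite -cobaseK mulmxA => xb; apply: (row_free_inj (row_base_free CF)).
by rewrite mul0mx.
Qed.

Lemma cobaseD i j l : row l C = row i C + row j C ->
  row l cobase = row i cobase + row j cobase.
Proof.
move=> e; apply/eqP; rewrite -subr_eq0 !rowE -mulmxDl -mulmxBl.
apply/eqP/row_cobase_inj; rewrite mulmxBl mulmxDl -!rowE -!map_row.
by rewrite e map_mxD subrr.
Qed.

Lemma cobaseN i j : row j C = - row i C -> row j cobase = - row i cobase.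
Proof.
move=> e; apply/eqP; rewrite -addr_eq0 !rowE -mulmxDl.
apply/eqP/row_cobase_inj; rewrite mulmxDl -!rowE -!map_row.
by rewrite e map_mxN addNr.
Qed.

(** The signs are multiplicative in a sum of roots because [f] kills the relations between the
    roots. *)
Lemma epsDl i j l t : row t C = row i C + row j C -> eps t l = eps i l * eps j l.
Proof.
move=> e; rewrite /eps -expfzDr ?oppr_eq0 ?oner_eq0 //; congr (_ ^ _).
have /f_kerl : (delta_mx 0 t - (delta_mx 0 i + delta_mx 0 j)) *m C = 0 :> 'rV_m.
  by rewrite mulmxBl mulmxDl -!rowE e subrr.
rewrite mulmxBl mulmxDl -!rowE => /rowP/(_ l); rewrite !mxE => /eqP.
by rewrite subr_eq0 => /eqP.
Qed.

Lemma epsNr i j l : row j C = - row i C -> eps l j = eps l i.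
Proof.
move=> e; rewrite /eps.
have /f_kerr : (delta_mx 0 j + delta_mx 0 i) *m C = 0 :> 'rV_m.
  by rewrite mulmxDl -!rowE e addNr.
rewrite !linearD /= !trmx_delta -!colE => /colP/(_ l).
rewrite !mxE => /eqP; rewrite addr_eq0 => /eqP->.
by rewrite -exprz_inv invrN1.
Qed.

Lemma epsNl i j l : row j C = - row i C -> eps j l = eps i l.
Proof.
move=> e; rewrite /eps.
have /f_kerl : (delta_mx 0 j + delta_mx 0 i) *m C = 0 :> 'rV_m.
  by rewrite mulmxDl -!rowE e addNr.
rewrite mulmxDl -!rowE => /rowP/(_ l).
rewrite !mxE => /eqP; rewrite addr_eq0 => /eqP->.
by rewrite -exprz_inv invrN1.
Qed.

Lemma eps_diag i : eps i i = -1. Proof. by rewrite /eps f_diag. Qed.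

Lemma eps_sq i j : eps i j * eps i j = 1.
Proof. by rewrite /eps -expfzMl mulrNN mulr1 exp1rz. Qed.

Lemma epsC i j : eps j i = (-1) ^ (C i j) * eps i j.
Proof.
rewrite -fC mxE [f^T _ _]mxE expfzDr ?oppr_eq0 ?oner_eq0 //.
by rewrite mulrAC -/(eps i j) eps_sq mul1r.
Qed.

Definition eroot i : 'rV[F]_N := row_mx (delta_mx 0 i) 0.
Definition ecart (h : 'rV[F]_r) : 'rV[F]_N := row_mx 0 h.
(** Being 0 when [x] is not a root, it lets one formula describe the bracket of two root vectors.
    The coordinates of the algebra are the [m] root vectors followed by [r] coordinates of the
    Cartan subalgebra. *)
Definition elat (x : 'rV[int]_m) : 'rV[F]_N :=
  row_mx (\row_l (row l C == x)%:R) 0.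
Definition coroot i := ecart (row i cobase).

Lemma elat_row i : elat (row i C) = eroot i.
Proof.
congr row_mx; apply/rowP => l; rewrite !mxE eqxx /=.
by congr (_%:R); congr nat_of_bool; apply/eqP/eqP => [/row_C_inj|->].
Qed.

Lemma elat_notrow x : (forall l, row l C != x) -> elat x = 0.
Proof.
move=> nx; rewrite /elat -[RHS]row_mx0; congr row_mx; apply/rowP => l.
by rewrite !mxE (negPf (nx l)).
Qed.

(** The structure constants of the Frenkel-Kac construction: two root vectors give [eps i j] times
    the root vector of the sum, or times the coroot if the sum is 0. The factorization
    [CF = cobase *m base] makes root [l] take the value [C i l] at [coroot i]. *)
Let ad_root j : 'M[F]_N := col_mx
  (\matrix_i (eps i j *: (elat (row i C + row j C)
                          + (row i C + row j C == 0)%:R *: coroot i)))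
  (\matrix_(k < r) (base k j *: eroot j)).

Let ad_cart (h : 'rV[F]_r) : 'M[F]_N :=
  block_mx (- diag_mx (h *m base)) 0 0 0.

Fact lie_ad_key : unit. Proof. by []. Qed.
Definition lie_ad : 'rV[F]_N -> 'M[F]_N := locked_with lie_ad_key (fun u : 'rV[F]_N =>
  \sum_j u 0 (lshift r j) *: ad_root j + ad_cart (rsubmx u)).

Lemma lie_adE (u : 'rV[F]_N) :
  lie_ad u = \sum_j u 0 (lshift r j) *: ad_root j + ad_cart (rsubmx u).
Proof. by rewrite /lie_ad unlock. Qed.

Lemma lie_ad_is_linear : linear lie_ad.
Proof.
move=> a u v; rewrite !lie_adE scalerDr addrACA; congr (_ + _).
  rewrite scaler_sumr -big_split; apply: eq_bigr => j _ /=.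
  by rewrite !mxE scalerDl scalerA.
rewrite /ad_cart linearD linearZ /= mulmxDl -scalemxAl.
rewrite scale_block_mx add_block_mx !scaler0 !addr0; congr block_mx.
by rewrite linearD linearZ /= opprD scalerN.
Qed.
HB.instance Definition _ := GRing.isLinear.Build F 'rV[F]_N 'M[F]_N _ lie_ad
  lie_ad_is_linear.

Lemma row_decomp (u : 'rV[F]_N) :
  u = \sum_i lsubmx u 0 i *: eroot i + ecart (rsubmx u).
Proof.
rewrite -[LHS]hsubmxK /ecart /eroot -[in LHS](addr0 (lsubmx u)).
rewrite -[in LHS](add0r (rsubmx u)) -add_row_mx; congr (_ + _).
rewrite [lsubmx u in LHS]row_sum_delta.
apply: (big_rec2 (fun a b => row_mx a 0 = b)); first exact: row_mx0.
by move=> i a b _ <-; rewrite scale_row_mx scaler0 add_row_mx addr0.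
Qed.

Lemma row_ind (P : 'rV[F]_N -> Prop) :
  (forall u v, P u -> P v -> P (u + v)) -> (forall a u, P u -> P (a *: u)) ->
  (forall i, P (eroot i)) -> (forall h, P (ecart h)) -> forall u, P u.
Proof.
move=> PD PZ Pe Ph u; rewrite [u]row_decomp.
apply: (PD) => //; apply: (big_ind P); last by move=> i _; apply: PZ.
  by have := PZ 0 _ (Ph 0); rewrite scale0r.
exact: PD.
Qed.

Lemma ad_eroot j : lie_ad (eroot j) = ad_root j.
Proof.
rewrite lie_adE /eroot row_mxKr /ad_cart mul0mx linear0 oppr0 block_mx0 addr0.
rewrite (bigD1 j) //= big1 => [|i nij]; rewrite row_mxEl mxE eqxx ?eqxx ?scale1r ?addr0 //=.
by rewrite (negPf nij) scale0r.
Qed.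

Lemma ad_ecart h : lie_ad (ecart h) = ad_cart h.
Proof.
rewrite lie_adE /ecart row_mxKr big1 ?add0r // => i _.
by rewrite row_mxEl mxE scale0r.
Qed.

Lemma br_ee i j : eroot i *m lie_ad (eroot j) =
  eps i j *: (elat (row i C + row j C) + (row i C + row j C == 0)%:R *: coroot i).
Proof.
by rewrite ad_eroot /eroot mul_row_col mul0mx addr0 -rowE rowK.
Qed.

Lemma br_he h j : ecart h *m lie_ad (eroot j) = (h *m base) 0 j *: eroot j.
Proof.
rewrite ad_eroot /ecart mul_row_col mul0mx add0r.
rewrite {1}[h]row_sum_delta mulmx_suml mxE scaler_suml; apply: eq_bigr => k _.
by rewrite -scalemxAl -rowE rowK scalerA.
Qed.

Lemma br_eh i h : eroot i *m lie_ad (ecart h) = - (h *m base) 0 i *: eroot i.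
Proof.
rewrite ad_ecart /eroot mul_row_block !mul0mx !addr0 mulmx0 scale_row_mx scaler0.
by rewrite mulmxN -rowE row_diag_mx scaleNr.
Qed.

Lemma br_hh h h' : ecart h *m lie_ad (ecart h') = 0.
Proof.
by rewrite ad_ecart mul_row_block !mul0mx !mulmx0 !addr0 row_mx0.
Qed.

Lemma lie_brD (a u v : 'rV[F]_N) : a *m lie_ad (u + v) = a *m lie_ad u + a *m lie_ad v.
Proof. by rewrite (linearD lie_ad) mulmxDr. Qed.

Lemma lie_brZ (a : 'rV[F]_N) x u : a *m lie_ad (x *: u) = x *: (a *m lie_ad u).
Proof.
have -> : lie_ad (x *: u) = x *: lie_ad u by exact: linearZ.
by rewrite -scalemxAr.
Qed.

Lemma corootN i j : row j C = - row i C -> coroot j = - coroot i.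
Proof. by move=> /cobaseN e; rewrite /coroot e /ecart -{1}oppr0 -opp_row_mx. Qed.

Lemma corootD i j l : row l C = row i C + row j C ->
  coroot l = coroot i + coroot j.
Proof. by move=> /cobaseD e; rewrite /coroot e /ecart add_row_mx addr0. Qed.

Lemma row_add_entry i j l : row l C = row i C + row j C -> C i j = -1.
Proof.
move=> /rowP e; have := e l; have := e i; have := e j; rewrite !mxE.
rewrite !(sl_diag slC) (Csym j i) (Csym j l) (Csym i l).
by move: (C l i) (C l j) (C i j) => x y z; lia.
Qed.

Lemma row_opp_entry i j : row i C + row j C = 0 -> C i j = -2.
Proof.
move=> /rowP/(_ i); rewrite !mxE (sl_diag slC) (Csym j i).
by move: (C i j) => x; lia.
Qed.

Lemma row_opp i j : C i j = -2 -> row i C + row j C = 0.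
Proof. by move=> /(sl_oppP slC) ->; rewrite subrr. Qed.

Lemma row_neq0 i : row i C != 0.
Proof. by apply/eqP => /rowP/(_ i); rewrite !mxE (sl_diag slC). Qed.

Lemma elat0 : elat 0 = 0.
Proof. by apply: elat_notrow; apply: row_neq0. Qed.

Lemma br_ee_add i j l : row l C = row i C + row j C ->
  eroot i *m lie_ad (eroot j) = eps i j *: eroot l.
Proof.
move=> e; rewrite br_ee -e elat_row (negPf (row_neq0 l)) scale0r addr0 //.
Qed.

Lemma br_ee_opp i j : C i j = -2 -> eroot i *m lie_ad (eroot j) = - coroot i.
Proof.
move=> e; rewrite br_ee row_opp // eqxx scale1r elat0 add0r.
by rewrite (epsNr _ (sl_oppP slC e)) eps_diag scaleN1r.
Qed.

Lemma br_ee0 i j : C i j != -1 -> C i j != -2 ->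
  eroot i *m lie_ad (eroot j) = 0.
Proof.
move=> n1 n2; rewrite br_ee elat_notrow ?add0r.
  case: eqP => [/row_opp_entry/eqP|_]; first by rewrite (negPf n2).
  by rewrite scale0r scaler0.
by move=> l; apply: contra n1 => /eqP/row_add_entry ->.
Qed.

Lemma lie_adC a b : a *m lie_ad b = - (b *m lie_ad a).
Proof.
move: a b; apply: row_ind.
- by move=> u v hu hv b; rewrite mulmxDl hu hv lie_brD opprD.
- by move=> x u hu b; rewrite -scalemxAl hu lie_brZ scalerN.
- move=> i; apply: row_ind.
  + by move=> u v hu hv; rewrite mulmxDl lie_brD opprD hu hv.
  + by move=> x u hu; rewrite -scalemxAl lie_brZ hu scalerN.
  + move=> j; case: (eqVneq (C i j) (-1)) => [e1|n1].
      have [l el] := sl_add slC e1.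
      rewrite (br_ee_add el) (@br_ee_add j i l) 1?addrC //.
      by rewrite (epsC i j) e1 exprN1 invrN1 mulN1r scaleNr opprK.
    case: (eqVneq (C i j) (-2)) => [e2|n2].
      rewrite !br_ee_opp //; last by rewrite Csym.
      by rewrite (corootN (sl_oppP slC e2)) opprK.
    by rewrite !br_ee0 ?oppr0 // Csym.
  + by move=> h; rewrite br_eh br_he scaleNr.
- move=> h; apply: row_ind.
  + by move=> u v hu hv; rewrite mulmxDl lie_brD opprD hu hv.
  + by move=> x u hu; rewrite -scalemxAl lie_brZ hu scalerN.
  + by move=> i; rewrite br_eh br_he scaleNr opprK.
  + by move=> h'; rewrite !br_hh oppr0.
Qed.

Let jac a b c := a *m lie_ad b *m lie_ad c + b *m lie_ad c *m lie_ad a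
   + c *m lie_ad a *m lie_ad b.

Lemma jac_rot a b c : jac a b c = jac b c a.
Proof. by rewrite /jac -addrA addrC. Qed.

Lemma jac_hhe h h' i : jac (ecart h) (ecart h') (eroot i) = 0.
Proof.
rewrite /jac br_hh mul0mx add0r br_he br_eh -!scalemxAl !br_eh !scalerA.
by rewrite -scalerDl mulrNN mulrN mulrC addNr scale0r.
Qed.

Lemma jac_hee h i j : jac (ecart h) (eroot i) (eroot j) = 0.
Proof.
rewrite /jac br_he br_eh -!scalemxAl (lie_adC (eroot j)) scalerN scaleNr opprK.
set x := (h *m base) 0 i; set y := (h *m base) 0 j.
rewrite addrAC -scalerDl; case: (eqVneq (C i j) (-1)) => [e1|n1].
  have [l el] := sl_add slC e1.
  rewrite (br_ee_add el) -scalemxAl br_eh (baseD _ el) -/x -/y.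
  by rewrite !scalerA -scalerDl mulrN mulrC addrN scale0r.
case: (eqVneq (C i j) (-2)) => [e2|n2]; last first.
  by rewrite br_ee0 // scaler0 mul0mx addr0.
rewrite br_ee_opp // mulNmx br_hh oppr0 addr0 /y.
by rewrite (baseN _ (sl_oppP slC e2)) -/x addrN scale0r.
Qed.

Lemma base_coroot i l : (row i cobase *m base) 0 l = (C i l)%:~R.
Proof. by rewrite -row_mul cobaseK !mxE. Qed.

Lemma br_eee i j l :
  eroot i *m lie_ad (eroot j) *m lie_ad (eroot l) =
  if C i j == -1 then (eps i j * eps i l * eps j l) *:
     (elat (row i C + row j C + row l C)
      + (row i C + row j C + row l C == 0)%:R *: (coroot i + coroot j))
  else if C i j == -2 then - (C i l)%:~R *: eroot l else 0.
Proof.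
case: (eqVneq (C i j) (-1)) => [e1|n1].
  have [t et] := sl_add slC e1.
  rewrite (br_ee_add et) -scalemxAl br_ee scalerA -et (epsDl l et) mulrA.
  congr (_ *: (_ + _ *: _)); by rewrite (corootD et).
case: (eqVneq (C i j) (-2)) => [e2|n2]; last by rewrite br_ee0 ?mul0mx.
by rewrite br_ee_opp // mulNmx br_he base_coroot scaleNr.
Qed.

(** With [j] opposite to [i] all three double brackets are multiples of [eroot l], and the
    coefficients depend only on [C i l] and signs; the five values from -2 to 2 are checked in
    turn. *)
Lemma jac_eee_opp i j l : C i j = -2 -> jac (eroot i) (eroot j) (eroot l) = 0.
Proof.
move=> e2; have rij := sl_oppP slC e2.
have s1 : row j C + row l C + row i C = row l C by rewrite rij addrAC addNr add0r.
have s2 : row l C + row i C + row j C = row l C by rewrite rij addrK.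
have Cjl : C j l = - C i l by have /rowP/(_ l) := rij; rewrite !mxE.
have Clj : C l j = - C i l by rewrite Csym.
rewrite /jac !br_eee e2 s1 s2 (negPf (row_neq0 l)) elat_row scale0r addr0.
rewrite (_ : (-2 == -1 :> int) = false) // eqxx Cjl (Csym j i) e2 Clj (Csym l i).
rewrite (epsNl l rij) (epsNl i rij) (epsNr l rij) (epsNr i rij) !eps_diag.
rewrite (epsC i l); have ss := eps_sq i l; set s := eps i l in ss *.
case: (eqVneq (C i l) 1) => [->|n1].
  rewrite !expr1z /= mulN1r mulrN1 mulrNN ss addr0.
  by rewrite -scalerDl addNr scale0r.
case: (eqVneq (C i l) (-1)) => [->|nm1].
  rewrite /= exprN1 invrN1 mulN1r mulrNN ss !mul1r scale0r !addr0.
  by rewrite -scalerDl mulrN1z opprK subrr scale0r.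
case: (eqVneq (C i l) 2) => [/(sl_inj slC) el|n2].
  by rewrite -el (sl_diag slC) /= addr0 -scalerDl mulrNz opprK addNr scale0r.
case: (eqVneq (C i l) (-2)) => [el|nm2].
  have -> : j = l.
    by apply: row_C_inj; rewrite rij (sl_oppP slC el).
  have -> : C i l = -2 by [].
  by rewrite /= addr0 -scalerDl !mulrNz !opprK subrr scale0r.
rewrite !eqr_oppLR opprK (negPf n1) (negPf n2) !addr0.
have -> : C i l = 0.
  have := sl_range slC i l; move: (C i l) n1 n2 nm1 nm2 => q n1 n2 nm1 nm2 le2.
  by apply/eqP; move: n1 n2 nm1 nm2 le2; lia.
by rewrite oppr0 scale0r.
Qed.

(** Without an opposite pair all three terms belong to [s], the sum of the three roots. If [s] is a
    root, exactly two of the inner products are -1 and their terms have opposite signs. If [s = 0],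
    all three are -1 and the terms cancel by additivity of coroots. Otherwise every term is 0. *)
Lemma jac_eee i j l : jac (eroot i) (eroot j) (eroot l) = 0.
Proof.
case: (eqVneq (C i j) (-2)) => [|p2]; first exact: jac_eee_opp.
case: (eqVneq (C j l) (-2)) => [|r2]; first by rewrite jac_rot; apply: jac_eee_opp.
case: (eqVneq (C l i) (-2)) => [|q2].
  by rewrite -jac_rot; apply: jac_eee_opp.
set s := row i C + row j C + row l C.
have s1 : row j C + row l C + row i C = s by rewrite /s addrC addrA.
have s2 : row l C + row i C + row j C = s by rewrite /s -addrA addrC.
rewrite /jac !br_eee s1 s2 -/s (negPf p2) (negPf q2) (negPf r2).
rewrite (epsC i j) (epsC i l) (epsC j l) (Csym l i).
have ent k : s 0 k = C i k + C j k + C l k by rewrite !mxE.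
have := ent i; have := ent j; have := ent l.
rewrite !(sl_diag slC) (Csym j i) (Csym l i) (Csym l j).
case: (eqVneq s 0) => [s0|sn0].
  rewrite s0 !mxE => e1 e2 e3.
  have [pij rjl qil] : [/\ C i j = -1, C j l = -1 & C i l = -1].
    by move: e1 e2 e3; move: (C i j) (C j l) (C i l) => x y z *; split; lia.
  have [t et] := sl_add slC pij.
  have rl : row l C = - row t C.
    by apply/eqP; rewrite -addr_eq0 addrC et -/s s0.
  rewrite pij rjl qil !eqxx elat0 !add0r !scale1r exprN1 invrN1 !mulN1r.
  rewrite (corootN rl) (corootD et).
  set E := eps i j * eps i l * eps j l.
  have -> : eps j l * - eps i j * - eps i l = E by rewrite /E; ring.
  have -> : - eps i l * - eps j l * eps i j = E by rewrite /E; ring.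
  have -> : coroot j - (coroot i + coroot j) = - coroot i.
    by rewrite opprD addrCA subrr addr0.
  have -> : - (coroot i + coroot j) + coroot i = - coroot j.
    by rewrite opprD addrAC addNr add0r.
  by rewrite -!scalerDr -addrA -opprD subrr scaler0.
case: (boolP [exists u, row u C == s]) => [/existsP[u /eqP su]|/existsPn nu]; last first.
  by rewrite elat_notrow // !scale0r addr0 !scaler0 !if_same !addr0.
rewrite -su elat_row.
have := ent u; rewrite -su !mxE (sl_diag slC) => e0 e1 e2 e3.
rewrite !scale0r !addr0.
have [[-> -> ->] | [[-> -> ->] | [-> -> ->] ] ] :
    [/\ C i j = -1, C i l = -1 & C j l = 0] \/
    [/\ C i j = -1, C i l = 0 & C j l = -1] \/
    [/\ C i j = 0, C i l = -1 & C j l = -1].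
  have := sl_range slC i j; have := sl_range slC i l; have := sl_range slC j l.
  rewrite (Csym l i) in q2; move: e0 e1 e2 e3 p2 q2 r2.
  rewrite (Csym i u) (Csym j u) (Csym l u).
  move: (C i j) (C i l) (C j l) (C u i) (C u j) (C u l) => x y z a b c.
  move=> *.
  have [|[|] ] : (x = -1 /\ y = -1 /\ z = 0) \/ (x = -1 /\ y = 0 /\ z = -1) \/
      (x = 0 /\ y = -1 /\ z = -1) by lia.
  - by case=> -> [-> ->]; left.
  - by case=> -> [-> ->]; right; left.
  - by case=> -> [-> ->]; right; right.
- rewrite /= exprN1 invrN1 expr0z !mulN1r mul1r addr0 -scalerDl.
  by apply/eqP; rewrite scaler_eq0; apply/orP; left; apply/eqP; ring.
- rewrite /= exprN1 invrN1 expr0z !mulN1r mul1r addr0 -scalerDl.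
  by apply/eqP; rewrite scaler_eq0; apply/orP; left; apply/eqP; ring.
- rewrite /= exprN1 invrN1 expr0z !mulN1r mul1r add0r -scalerDl.
  by apply/eqP; rewrite scaler_eq0; apply/orP; left; apply/eqP; ring.
Qed.

Lemma jac_eq0 a b c : jac a b c = 0.
Proof.
have jacDl u v y z : jac (u + v) y z = jac u y z + jac v y z.
  by rewrite /jac !mulmxDl !lie_brD !mulmxDl [RHS]addrACA; congr (_ + _); rewrite addrACA.
have jacZl x u y z : jac (x *: u) y z = x *: jac u y z.
  by rewrite /jac !lie_brZ -!scalemxAl -!scalerDr.
have ext y z : (forall i, jac (eroot i) y z = 0) ->
    (forall h, jac (ecart h) y z = 0) -> forall u, jac u y z = 0.
  move=> He Hh; apply: row_ind => //.
  - by move=> u v hu hv; rewrite jacDl hu hv addr0.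
  - by move=> x u hu; rewrite jacZl hu scaler0.
have uee i j u : jac u (eroot i) (eroot j) = 0.
  by apply: ext u => [l|h]; [apply: jac_eee | apply: jac_hee].
have ueh i h u : jac u (eroot i) (ecart h) = 0.
  apply: ext u => [j|h']; first by rewrite -jac_rot jac_hee.
  by rewrite -jac_rot jac_hhe.
have uhe h i u : jac u (ecart h) (eroot i) = 0.
  by apply: ext u => [j|h']; [rewrite jac_rot jac_hee | apply: jac_hhe].
have uhh h h' u : jac u (ecart h) (ecart h') = 0.
  apply: ext u => [i|h'']; first by rewrite jac_rot jac_hhe.
  by rewrite /jac !br_hh !mul0mx !addr0.
have ueu i u v : jac v (eroot i) u = 0.
  by apply: ext v => [j|h]; rewrite -jac_rot.
have uhu h u v : jac v (ecart h) u = 0.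
  by apply: ext v => [j|h']; rewrite -jac_rot.
by apply: ext a => [j|h]; rewrite -jac_rot.
Qed.

Lemma lie_adJ a b : lie_ad (a *m lie_ad b) = lie_ad a * lie_ad b - lie_ad b * lie_ad a.
Proof.
apply/row_matrixP => i; rewrite !rowE -!mulmxE mulmxBr !mulmxA.
set c := delta_mx 0 i; rewrite lie_adC (lie_adC c b) mulNmx opprK.
have /eqP := jac_eq0 a b c; rewrite /jac -addrA addrC addr_eq0 => /eqP.
by rewrite addrC => ->.
Qed.

Local Notation kappa := (trace_form lie_ad).

Lemma kappa_hh h h' :
  kappa (ecart h) (ecart h') = \sum_i (h *m base) 0 i * (h' *m base) 0 i.
Proof.
transitivity (\tr (lie_ad (ecart h) *m lie_ad (ecart h'))) => //.
rewrite !ad_ecart mulmx_block !mulmx0 !mul0mx !addr0 mxtrace_block.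
rewrite mxtrace0 addr0 mulNmx mulmxN opprK mulmx_diag mxtrace_diag.
by apply: eq_bigr => i _; rewrite mxE.
Qed.

Let kappaA a b c : kappa (a *m lie_ad b) c = kappa a (b *m lie_ad c).
Proof. exact: (kappa_assoc lie_adJ). Qed.

Let kappaS a b : kappa a b = kappa b a. Proof. exact: kappaC. Qed.

Let kappaZ t a c : kappa (t *: a) c = t * kappa a c.
Proof. exact: kappaZl. Qed.

Let kappaD a b c : kappa (a + b) c = kappa a c + kappa b c.
Proof. exact: kappaDl. Qed.

Lemma kappa_eh i h : kappa (eroot i) (ecart h) = 0.
Proof.
have := kappaA (eroot i) (coroot i) (ecart h).
rewrite br_hh br_eh base_coroot (sl_diag slC) kappaZ (kappaS _ 0).
rewrite -(scale0r (0 : 'rV[F]_N)) kappaZ mul0r => /eqP.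
by rewrite mulf_eq0 oppr_eq0 intr_eq0 /= => /eqP.
Qed.

Lemma kappa_ee i j : C i j != -2 -> kappa (eroot i) (eroot j) = 0.
Proof.
move=> n2; have := kappaA (eroot i) (coroot i) (eroot j).
rewrite br_he br_eh !base_coroot (sl_diag slC) kappaZ (kappaS _ (_ *: _)) kappaZ.
rewrite (kappaS (eroot j)) => /eqP; rewrite -subr_eq0 -mulrBl mulf_eq0.
by rewrite -rmorphN -rmorphB intr_eq0 subr_eq0 eq_sym (negPf n2) => /eqP.
Qed.

Lemma kappa_opp i j : C i j = -2 -> kappa (eroot i) (eroot j) != 0.
Proof.
move=> e2; have := kappaA (eroot i) (eroot j) (coroot i).
rewrite br_ee_opp // br_eh base_coroot e2 -scaleN1r kappaZ (kappaS _ (_ *: _)) kappaZ.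
rewrite kappa_hh => e; apply/eqP => k0; move/eqP: e.
rewrite (kappaS (eroot j)) k0 mulr0 mulN1r oppr_eq0 psumr_eq0 => [|l _];
  last exact: sqr_ge0.
move=> /allP/(_ i); rewrite mem_index_enum => /(_ isT).
by rewrite /= base_coroot (sl_diag slC) mulf_eq0 intr_eq0.
Qed.

(** Root vectors pair nontrivially with those of the opposite root and with nothing else, and on the
    Cartan part the form is a sum of squares, hence definite. *)
Lemma lie_kappa_nondeg a : (forall b, kappa a b = 0) -> a = 0.
Proof.
move=> ka; pose x := lsubmx a; pose h := rsubmx a.
have aE : a = \sum_i x 0 i *: eroot i + ecart h.
  exact: row_decomp.
have ksum b : kappa a b = \sum_i x 0 i * kappa (eroot i) b + kappa (ecart h) b.
  rewrite aE kappaD; congr (_ + _).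
  elim/big_rec2: _ => [|i u v _ <-]; last by rewrite kappaD kappaZ.
  by rewrite -(scale0r (0 : 'rV[F]_N)) kappaZ mul0r.
have x0 i : x 0 i = 0.
  have [j ij] := sl_opp slC i.
  have := ka (eroot j); rewrite ksum (kappaS (ecart h)) kappa_eh addr0.
  rewrite (bigD1 i) //= big1 => [|k nk]; last first.
    rewrite kappa_ee ?mulr0 //; apply: contra nk => /eqP kj; apply/eqP/row_C_inj.
    by apply: oppr_inj; rewrite -(sl_oppP slC ij) -(sl_oppP slC kj).
  by rewrite addr0 => /eqP; rewrite mulf_eq0 (negPf (kappa_opp ij)) orbF => /eqP.
have h0 : h = 0.
  have := ka (ecart h); rewrite ksum big1 => [|i _]; last by rewrite x0 mul0r.
  rewrite add0r kappa_hh => /eqP; rewrite psumr_eq0 => [|l _]; last exact: sqr_ge0.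
  move=> /allP h0; apply: (row_free_inj (row_base_free CF)); rewrite mul0mx.
  apply/rowP => i; rewrite [RHS]mxE; apply/eqP.
  have := h0 i; rewrite mem_index_enum => /(_ isT).
  by rewrite /= mulf_eq0 orbb.
rewrite aE h0 big1 => [|i _]; last by rewrite x0 scale0r.
by rewrite add0r /ecart row_mx0.
Qed.

(** The Cartan part has degree 0 and contributes [r]. The right bracket with [ecart h] multiplies
    [eroot i] by minus the value of root [i] at [h], hence the sign in [- y]. *)
Lemma simply_laced_count_aux (y : 'rV[F]_m) : (y <= CF)%MS ->
  (#|[pred i | y 0%R i == 1%R]| <= #|[pred i | y 0%R i == 0%R]| + r)%N.
Proof.
move=> yC.
have /submxP[h yE] : (- y <= base)%MS by rewrite eqmx_opp eq_row_base.
have adv : lie_ad (ecart h) = diag_mx (row_mx y 0).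
  rewrite ad_ecart /ad_cart -yE diag_mx_row; congr block_mx.
    by rewrite linearN opprK.
  by rewrite linear0.
have := graded_dim_le lie_adC lie_adJ lie_kappa_nondeg adv.
have card t : #|[pred i | row_mx y (0 : 'rV[F]_r) 0 i == t]| =
    (#|[pred i | y 0%R i == t]| + (t == 0%R) * r)%N.
  rewrite -!sum1_card big_split_ord /=; congr (_ + _)%N.
    by apply: eq_bigl => i; rewrite !inE row_mxEl.
  under eq_bigl => i do rewrite inE row_mxEr mxE eq_sym.
  by case: (t == 0); rewrite ?big_pred0_eq // sum1_card card_ord mul1n.
by rewrite !card eqxx oner_eq0 mul0n addn0 mul1n.
Qed.

End RootLieAlgebra.

Lemma simply_laced_count (F : archiRealFieldType) m (C : 'M[int]_m) (y : 'rV[F]_m) :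
  simply_laced_gram C -> (y <= map_mx intr C)%MS ->
  (#|[pred i | y 0%R i == 1%R]| <=
   #|[pred i | y 0%R i == 0%R]| + \rank (map_mx (intr : int -> F) C))%N.
Proof.
move=> slC yC; have [f [fC fd fl fr] ] := even_form_cocycle (sl_sym slC) (sl_diag slC).
exact: (simply_laced_count_aux slC fC fd fl fr yC).
Qed.

(** * Root systems in a Euclidean space *)

Lemma small_int_product (n m : int) : n != 0 -> m != 0 -> 0 <= n * m ->
  n * m < 4 -> n = m \/ m = 2 * n \/ m = 3 * n \/ n = 2 * m \/ n = 3 * m.
Proof.
move=> n0 m0 nm0 nm4.
have : `|n| * `|m| < 4 by rewrite -normrM ger0_norm.
have : (-4 < n < 4) by nia.
have : (-4 < m < 4) by nia.
nia.
Qed.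

Section RootSystems.
Variables (R : realType) (V : vectType R) (dp : {dot V for idfun}).
Implicit Types (a b c u v w : V) (s : seq V).

Lemma dpC u v : dp u v = dp v u.
Proof. by rewrite (hermC dp) expr0 mul1r. Qed.

Lemma dpDl u v w : dp (u + v) w = dp u w + dp v w.
Proof. exact: linearDl. Qed.
Lemma dpNl u w : dp (- u) w = - dp u w.
Proof. exact: linearNl. Qed.
Lemma dpZl x u w : dp (x *: u) w = x * dp u w.
Proof. exact: linearZl_LR. Qed.
Lemma dpDr u v w : dp w (u + v) = dp w u + dp w v.
Proof. by rewrite dpC dpDl !(dpC w). Qed.
Lemma dpNr u w : dp w (- u) = - dp w u.
Proof. by rewrite dpC dpNl (dpC w). Qed.
Lemma dpZr x u w : dp w (x *: u) = x * dp w u.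
Proof. by rewrite dpC dpZl (dpC w). Qed.
Lemma dp0l w : dp 0 w = 0.
Proof. by rewrite -(scale0r w) dpZl mul0r. Qed.
Lemma dp0r w : dp w 0 = 0.
Proof. by rewrite dpC dp0l. Qed.
Lemma dp_gt0 u : u != 0 -> 0 < dp u u.
Proof. exact: neq0_dnorm_gt0. Qed.
Lemma dp_eq0 u : dp u u = 0 -> u = 0.
Proof. by have [//|/dp_gt0 h e] := eqVneq u 0; rewrite e ltxx in h. Qed.
Lemma dp_inj u v : (forall w, dp u w = dp v w) -> u = v.
Proof.
move=> e; apply/eqP; rewrite -subr_eq0; apply/eqP/dp_eq0.
by rewrite dpDl dpNl !e subrr.
Qed.
Definition dpE := (dpDl, dpDr, dpNl, dpNr, dpZl, dpZr, dp0l, dp0r).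

Definition srefl a b := b - (2 * dp b a / dp a a) *: a.

Record rootsys s : Prop := RootSys {
  rs_uniq : uniq s;
  rs_neq0 : forall a, a \in s -> a != 0;
  rs_refl : forall a b, a \in s -> b \in s -> srefl a b \in s;
  rs_int : forall a b, a \in s -> b \in s -> 2 * dp b a / dp a a \is a Num.int;
  rs_red : forall a (x : R), a \in s -> x *: a \in s -> x = 1 \/ x = -1 }.

Definition kinv s (k : V -> R) :=
  forall a b, a \in s -> b \in s -> k (srefl a b) = k b.

Definition pole_bound s (k : V -> R) v :=
  (count (fun a => dp a v == k a) s
   <= count (fun a => dp a v == 0%R) s + \dim <<s>>%VS)%N.

Definition irreducible s := forall p : pred V,
  (forall a b, a \in s -> b \in s -> p a -> ~~ p b -> dp a b = 0) ->
  (forall a, a \in s -> p a) \/ (forall a, a \in s -> ~~ p a).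

Lemma srefl_self a : a != 0 -> srefl a a = - a.
Proof.
move=> /dp_gt0 aa; rewrite /srefl mulfK ?gt_eqF //.
by rewrite scaler_nat mulr2n opprD addrA subrr add0r.
Qed.

Lemma srefl_norm a b : a != 0 -> dp (srefl a b) (srefl a b) = dp b b.
Proof.
move=> /dp_gt0 aa; have := gt_eqF aa; rewrite /srefl !dpE (dpC a b) => /negbT.
by move: (dp a a) (dp a b) (dp b a) (dp b b) => x y z t x0; field.
Qed.

Lemma rootN s a : rootsys s -> a \in s -> - a \in s.
Proof. by move=> rs as_; rewrite -srefl_self ?(rs_neq0 rs) // rs_refl. Qed.

Lemma kinvN s k a : rootsys s -> kinv s k -> a \in s -> k (- a) = k a.
Proof. by move=> rs kk as_; rewrite -srefl_self ?(rs_neq0 rs) // kk. Qed.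

(* [Q] need only be stable under reflections, so this says that some element
   of each Weyl orbit is not orthogonal to [b]. *)
Lemma linked s (Q : V -> bool) a b : rootsys s -> irreducible s ->
  (forall c d, c \in s -> d \in s -> Q d -> Q (srefl c d)) ->
  a \in s -> Q a -> b \in s -> exists c, [/\ c \in s, Q c & dp c b != 0].
Proof.
move=> rs irr Qs as_ Qa bs.
pose p c := has (fun d => Q d && (dp d c != 0)) s.
have [c d cs ds /hasP[g gs /andP[Qg gc] ] npd|pa|npa] := irr p.
- have orth h : h \in s -> Q h -> dp h d = 0.
    move=> hs Qh; apply/eqP; apply: contraNT npd => nz.
    by apply/hasP; exists h => //; rewrite Qh.
  have := orth _ (rs_refl rs cs gs) (Qs _ _ cs gs Qg).
  rewrite /srefl dpDl dpNl dpZl (orth g) // add0r => /eqP.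
  rewrite oppr_eq0 !mulf_eq0 invr_eq0 pnatr_eq0 (negPf gc) /= => /orP[|/eqP //].
  by rewrite gt_eqF ?dp_gt0 ?(rs_neq0 rs).
- by have /hasP[c cs /andP[Qc cb] ] := pa b bs; exists c.
- have /hasPn/(_ _ as_) := npa a as_; rewrite Qa /= negbK.
  by rewrite gt_eqF ?dp_gt0 ?(rs_neq0 rs).
Qed.

Lemma pairing s a b : rootsys s -> a \in s -> b \in s ->
  [\/ b = a, b = - a |
   exists n m : int, [/\ 2 * dp a b = n%:~R * dp a a, 2 * dp a b = m%:~R * dp b b,
     0 <= n * m & n * m < 4] ].
Proof.
move=> rs as_ bs.
have aa := dp_gt0 (rs_neq0 rs as_); have bb := dp_gt0 (rs_neq0 rs bs).
have /intrP[n nE] := rs_int rs as_ bs; have /intrP[m mE] := rs_int rs bs as_.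
have {}nE : 2 * dp a b = n%:~R * dp a a by rewrite -nE divfK ?gt_eqF // (dpC a).
have {}mE : 2 * dp a b = m%:~R * dp b b by rewrite -mE divfK ?gt_eqF.
(* [w] is [dp a a] times the component of [b] orthogonal to [a]. With [n] and [m] the Cartan
   integers, [dp w w > 0] is the strict Cauchy-Schwarz inequality [n * m < 4]. *)
set w := dp a a *: b - dp a b *: a.
have ww : dp w w = dp a a * (dp a a * dp b b - dp a b ^+ 2).
  by rewrite /w !dpE (dpC b a); ring.
have nm : (n * m)%:~R * (dp a a * dp b b) = 4 * dp a b ^+ 2 :> R.
  transitivity ((n%:~R * dp a a) * (m%:~R * dp b b)); first by rewrite intrM; ring.
  by rewrite -nE -mE; ring.
have [w0|wn0] := eqVneq w 0.
  have bE : b = (dp a b / dp a a) *: a.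
    move/eqP: w0; rewrite subr_eq0 => /eqP w0.
    by rewrite mulrC -scalerA -w0 scalerA mulVf ?gt_eqF // scale1r.
  have [x1|x1] : dp a b / dp a a = 1 \/ dp a b / dp a a = -1.
  - by apply: (rs_red rs as_); rewrite -bE.
  - by constructor 1; rewrite bE x1 scale1r.
  - by constructor 2; rewrite bE x1 scaleN1r.
constructor 3; exists n, m; split=> //.
  rewrite -(ler0z R) -(pmulr_lge0 _ (mulr_gt0 aa bb)) nm.
  by apply: mulr_ge0 => //; apply: sqr_ge0.
rewrite -(ltr_int R) -(ltr_pM2r (mulr_gt0 aa bb)) nm ltr_pM2l //.
by have := dp_gt0 wn0; rewrite ww pmulr_rgt0 // subr_gt0.
Qed.

Lemma pairing_lengths s a b : rootsys s -> a \in s -> b \in s -> dp a b != 0 ->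
  [\/ dp b b = dp a a, dp b b = 2 * dp a a \/ dp b b = 3 * dp a a
    | dp a a = 2 * dp b b \/ dp a a = 3 * dp b b].
Proof.
move=> rs as_ bs ab.
have [->|->|[n [m [nE mE nm0 nm4] ] ] ] := pairing rs as_ bs.
- by constructor 1.
- by constructor 1; rewrite !dpE opprK.
have n0 : n != 0.
  apply: contraNneq ab => n0; move/eqP: nE; rewrite n0 mul0r mulf_eq0 pnatr_eq0 /=.
  by [].
have m0 : m != 0.
  apply: contraNneq ab => m0; move/eqP: mE; rewrite m0 mul0r mulf_eq0 pnatr_eq0 /=.
  by [].
have nR : n%:~R != 0 :> R by rewrite intr_eq0.
have mR : m%:~R != 0 :> R by rewrite intr_eq0.
have nm : n%:~R * dp a a = m%:~R * dp b b by rewrite -nE -mE.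
have [e|[e|[e|[e|e] ] ] ] := small_int_product n0 m0 nm0 nm4.
- by constructor 1; apply: (mulfI nR); rewrite nm e.
- constructor 3; left; apply: (mulfI nR); rewrite nm e rmorphM /=; ring.
- constructor 3; right; apply: (mulfI nR); rewrite nm e rmorphM /=; ring.
- constructor 2; left; apply: (mulfI mR); rewrite -nm e rmorphM /=; ring.
- constructor 2; right; apply: (mulfI mR); rewrite -nm e rmorphM /=; ring.
Qed.

End RootSystems.

(** * Reduction to irreducible systems *)

Section Reduction.
Variables (R : realType) (V : vectType R) (dp : {dot V for idfun}).
Implicit Types (a b c u v w : V) (s : seq V).

(** By [linked] there is a root [c] with the length and the weight of [a], not orthogonal to [b]. If
    [b] is neither [c] nor [- c], equal lengths force the Cartan integers to be 1 or -1, and then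
    the reflection of [b] in [c] is, up to sign, that of [c] in [b]. *)
Lemma irreducible_kinv s k a b : rootsys dp s -> irreducible dp s -> kinv dp s k ->
  a \in s -> b \in s -> dp a a = dp b b -> k a = k b.
Proof.
move=> rs irr kk as_ bs ab.
pose Q c := (dp c c == dp a a) && (k c == k a).
have Qst c d : c \in s -> d \in s -> Q d -> Q (srefl dp c d).
  by move=> cs ds; rewrite /Q srefl_norm ?(rs_neq0 rs cs) // kk.
have [|c [cs /andP[/eqP cc /eqP <-] cb] ] := linked rs irr Qst as_ _ bs.
  by rewrite /Q !eqxx.
have [->|->|[n [m [nE mE nm0 nm4] ] ] ] // := pairing rs cs bs.
  by rewrite (kinvN rs).
have cn0 := dp_gt0 dp (rs_neq0 rs cs).
have nm : n = m.
  have : n%:~R * dp c c = m%:~R * dp c c by rewrite {2}cc ab -nE -mE.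
  by move/(mulIf (lt0r_neq0 cn0))/(intr_inj (R := R)).
have n0 : n != 0.
  by apply: contraNneq cb => n0; move/eqP: nE; rewrite n0 mul0r mulf_eq0 pnatr_eq0.
have rcb : srefl dp c b = b - n%:~R *: c.
  by rewrite /srefl (dpC dp b) nE mulfK ?gt_eqF.
have rbc : srefl dp b c = c - n%:~R *: b.
  rewrite /srefl mE -nm mulfK // gt_eqF //.
  by apply: dp_gt0; apply: (rs_neq0 rs).
have [n1|n1] : n = 1 \/ n = -1.
  by move: nm4 n0; rewrite -nm; move: (n) => x; nia.
  have bc : b - c \in s.
    by rewrite (_ : b - c = srefl dp c b) ?(rs_refl rs) // rcb n1 scale1r.
  by rewrite -(kk b c) // -(kk c b) // rcb rbc n1 !scale1r -opprB (kinvN rs kk).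
by rewrite -(kk b c) // -(kk c b) // rcb rbc n1 !scaleN1r !opprK addrC.
Qed.

Lemma rootsys_filter s (p : pred V) : rootsys dp s ->
  (forall a b, a \in s -> b \in s -> p a -> p b -> p (srefl dp a b)) ->
  rootsys dp (filter p s).
Proof.
move=> rs pst; split.
- by rewrite filter_uniq ?(rs_uniq rs).
- by move=> a; rewrite mem_filter => /andP[_ /(rs_neq0 rs)].
- move=> a b; rewrite !mem_filter => /andP[pa as_] /andP[pb bs].
  by rewrite pst ?(rs_refl rs).
- by move=> a b; rewrite !mem_filter => /andP[_ as_] /andP[_ bs]; apply: (rs_int rs).
- by move=> a x; rewrite !mem_filter => /andP[_ as_] /andP[_]; apply: (rs_red rs).
Qed.

(** A reflected root outside [p] would be orthogonal to [a] and [b], hence to itself. *)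
Lemma rootsys_component s (p : pred V) : rootsys dp s ->
  (forall a b, a \in s -> b \in s -> p a -> ~~ p b -> dp a b = 0) ->
  rootsys dp (filter p s).
Proof.
move=> rs orth; apply: rootsys_filter => // a b as_ bs pa pb.
have cs := rs_refl rs as_ bs; apply: contraT => npc.
have := rs_neq0 rs cs; case/eqP; apply: (dp_eq0 (dp := dp)).
set c := srefl dp a b in cs npc *; rewrite {1}/c /srefl dpDl dpNl dpZl.
by rewrite (orth b c) // (orth a c) // mulr0 subrr.
Qed.

Lemma orth_span_dim s1 s2 :
  (forall a b, a \in s1 -> b \in s2 -> dp a b = 0) ->
  (\dim <<s1 ++ s2>> = \dim <<s1>> + \dim <<s2>>)%N.
Proof.
move=> orth; rewrite span_cat dimv_disjoint_sum //.
apply/eqP; rewrite -subv0; apply/subvP => u; rewrite memv_cap memv0.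
move=> /andP[u1 u2].
have o2 a : a \in s1 -> dp a u = 0.
  move=> a1; rewrite (coord_span (X := in_tuple s2) u2) linear_sumr big1 // => i _.
  by rewrite linearZr_LR /= orth ?mulr0 // mem_nth.
apply/eqP/(dp_eq0 (dp := dp)); rewrite {1}(coord_span (X := in_tuple s1) u1).
rewrite linear_sumlz big1 // => i _.
by rewrite linearZl_LR /= o2 ?mulr0 // mem_nth.
Qed.

Lemma pole_bound_irreducible (k : V -> R) v :
  (forall s, rootsys dp s -> irreducible dp s -> kinv dp s k -> pole_bound dp s k v) ->
  forall s, rootsys dp s -> kinv dp s k -> pole_bound dp s k v.
Proof.
move=> Hirr s; have [n] := ubnP (size s); elim: n s => // n IHn s szs rs kk.
case: (pselect (irreducible dp s)) => [irr|nirr]; first exact: Hirr.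
have [p [orth [a as_ npa] [b bs pb] ] ] : exists p : pred V,
    [/\ forall a b, a \in s -> b \in s -> p a -> ~~ p b -> dp a b = 0,
        exists2 a, a \in s & ~~ p a & exists2 a, a \in s & p a].
  apply: contrapT => H; apply: nirr => p orth.
  case: (boolP (all p s)) => [/allP|/allPn Ha]; first by left.
  right => a as_; apply/negP => pa; apply: H; exists p; split=> //.
  by exists a.
have pN c d : c \in s -> d \in s -> predC p c -> ~~ predC p d -> dp c d = 0.
  by move=> cs ds /= pc; rewrite negbK dpC => pd; apply: orth.
have part (q : pred V) :
    (forall a b, a \in s -> b \in s -> q a -> ~~ q b -> dp a b = 0) ->
    (exists2 a, a \in s & ~~ q a) -> pole_bound dp (filter q s) k v.
  move=> qorth [c cs nqc]; apply: IHn.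
  - apply: (@leq_trans (size s)) => //; rewrite size_filter -(count_predC q s).
    by rewrite -addn1 leq_add2l -has_count; apply/hasP; exists c.
  - exact: rootsys_component.
  - by move=> x y; rewrite !mem_filter => /andP[_ xs] /andP[_ ys]; apply: kk.
have := leq_add (part p orth _) (part (predC p) pN _).
move=> /(_ (ex_intro2 _ _ a as_ npa)) Hp.
have {}Hp := Hp (ex_intro2 _ _ b bs (introN idP (fun h => negP h pb))).
have pe := permEl (perm_filterC p s).
have cnt q : count q s = (count q (filter p s) + count q (filter (predC p) s))%N.
  by rewrite -count_cat; apply/esym/permP.
rewrite /pole_bound (cnt (fun a => dp a v == k a)) (cnt (fun a => dp a v == 0)).
rewrite -(eq_span (perm_mem pe)) orth_span_dim.
  by rewrite addnACA.
move=> x y; rewrite !mem_filter => /andP[px xs] /andP[npy ys].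
exact: orth.
Qed.

End Reduction.

(** * Systems with one root length *)

Lemma count_nth_ord (T : Type) (x0 : T) (p : pred T) (s : seq T) :
  count p s = #|[pred i : 'I_(size s) | p (nth x0 s i)]|.
Proof. by rewrite -sum1_count (big_nth x0) big_mkord sum1_card. Qed.

Section SimplyLaced.
Variables (R : realType) (V : vectType R) (dp : {dot V for idfun}).
Implicit Types (a b c u v w : V) (s : seq V).

Lemma dp_eq a b : dp a b = dp a a -> dp b b = dp a a -> b = a.
Proof.
move=> ab bb; apply/eqP; rewrite -subr_eq0; apply/eqP/(dp_eq0 (dp := dp)).
by rewrite !dpE bb (dpC dp b) ab; ring.
Qed.

Lemma dp_eqN a b : dp a b = - dp a a -> dp b b = dp a a -> b = - a.
Proof.
move=> ab bb; rewrite -[b]opprK (@dp_eq a (- b)) //; first by rewrite dpNr ab opprK.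
by rewrite dpNl dpNr opprK.
Qed.

(* When [k] vanishes both counts agree; otherwise [v / k] grades the Lie algebra. *)
Lemma bound_simply_laced s k v N : rootsys dp s -> irreducible dp s ->
  kinv dp s k -> (forall a, a \in s -> dp a a = N) -> pole_bound dp s k v.
Proof.
move=> rs irr kk sN; rewrite /pole_bound.
case: (posnP (size s)) => [/eqP/nilP->//|sz].
pose a0 := head 0 s; have a0s : a0 \in s by rewrite /a0 -nth0 mem_nth.
have N0 : 0 < N by rewrite -(sN a0) // dp_gt0 ?(rs_neq0 rs).
have kE a : a \in s -> k a = k a0.
  by move=> as_; apply: (irreducible_kinv rs irr kk) => //; rewrite !sN.
have [k0|kn0] := eqVneq (k a0) 0.
  apply: leq_trans (leq_addr _ _); rewrite leq_eqVlt; apply/orP; left; apply/eqP.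
  by apply: eq_in_count => a as_ /=; rewrite kE // k0.
pose m := size s; pose r (i : 'I_m) := s`_i.
have rs_in i : r i \in s by rewrite mem_nth.
have idx a : a \in s -> exists i, r i = a.
  move=> as_; have lt : (index a s < m)%N by rewrite index_mem.
  by exists (Ordinal lt); rewrite /r nth_index.
have r_inj : injective r.
  by move=> i j /eqP; rewrite nth_uniq ?(rs_uniq rs) // => /eqP/ord_inj.
(* These reals are integers already; [Num.floor] merely casts them to [int]. *)
pose C : 'M[int]_m := \matrix_(i, j) Num.floor (2 * dp (r i) (r j) / N).
have CE i j : (C i j)%:~R = 2 * dp (r i) (r j) / N :> R.
  by rewrite mxE floorK // -(sN (r j)) // (rs_int rs).
have dpE' i j : dp (r i) (r j) = N * (C i j)%:~R / 2.
  by rewrite CE; field; rewrite gt_eqF.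
have Ceq i j (z : int) : (C i j == z) = (dp (r i) (r j) == N * z%:~R / 2).
  have nN : N != 0 by rewrite gt_eqF.
  by rewrite -(eqr_int R) CE; apply/eqP/eqP => [<-|->]; field.
have mapE i t : map_mx (intr : int -> R) C i t = (C i t)%:~R by rewrite [LHS]mxE.
have rowCE i t : row i C 0 t = C i t by rewrite [LHS]mxE.
have slC : simply_laced_gram C.
  split.
  - by apply/matrixP => i j; rewrite !mxE dpC.
  - by move=> i; apply/eqP; rewrite Ceq sN //; apply/eqP; field.
  - move=> i j; have [e|e|[n [p [nE pE np0 np4] ] ] ] := pairing rs (rs_in i) (rs_in j).
    + have /eqP -> // : C i j == 2.
      by rewrite Ceq e sN //; apply/eqP; field.
    + have /eqP -> // : C i j == -2.
      by rewrite Ceq e dpNr sN //; apply/eqP; field.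
    + rewrite !sN // in nE pE.
      have /eqP -> : C i j == n.
        by rewrite Ceq -[N * _]mulrC -nE; apply/eqP; field.
      have e : n = p.
        have /(mulIf (lt0r_neq0 N0))/(intr_inj (R := R)) // : n%:~R * N = p%:~R * N.
        by rewrite -nE.
      by move: np4; rewrite -e; move: (n) => x; nia.
  - move=> i j /eqP; rewrite Ceq => /eqP e; apply/r_inj/esym/dp_eq; rewrite ?sN //.
    by rewrite e; field.
  - move=> i j /eqP; rewrite Ceq => /eqP e.
    have rj : r j = - r i.
      by apply: dp_eqN; rewrite ?sN // e; field.
    apply/rowP => t; apply: (intr_inj (R := R)); rewrite rowCE [in RHS]mxE rowCE.
    by rewrite rmorphN /= !CE rj dpNl; ring.
  - move=> i; have [j rj] := idx _ (rootN rs (rs_in i)).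
    by exists j; apply/eqP; rewrite Ceq rj dpNr sN //; apply/eqP; field.
  - move=> i j /eqP; rewrite Ceq => /eqP e.
    have : r i + r j \in s.
      have := rs_refl rs (rs_in i) (rs_in j); rewrite /srefl sN // (dpC dp (r j)) e.
      have -> : 2 * (N * (-1)%:~R / 2) / N = -1 by field; rewrite gt_eqF.
      by rewrite scaleN1r opprK addrC.
    move=> /idx[l rl]; exists l; apply/rowP => t; apply: (intr_inj (R := R)).
    by rewrite rowCE [in RHS]mxE !rowCE rmorphD /= !CE rl dpDl; ring.
pose y : 'rV[R]_m := \row_i (dp (r i) v / k a0).
(* A column of the cokernel yields a combination [u] of roots orthogonal to all roots, hence to
   itself. So [u = 0], and the values of the roots at [v] satisfy the same relation. *)
have yC : (y <= map_mx intr C)%MS.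
  rewrite submxE; apply/eqP/rowP => t; rewrite [RHS]mxE mxE.
  set K := cokermx _; pose u := \sum_j K j t *: r j.
  have u0 : u = 0.
    apply: (dp_eq0 (dp := dp)); rewrite {1}/u linear_sumlz big1 // => i _.
    rewrite linearZl_LR /= linear_sumr.
    have /matrixP/(_ i t) := mulmx_coker (map_mx (intr : int -> R) C).
    rewrite mxE [RHS]mxE -/K => e.
    under eq_bigr => j _.
      rewrite linearZr_LR /= dpE'.
      rewrite (_ : K j t * (N * (C i j)%:~R / 2)
        = N / 2 * (map_mx (intr : int -> R) C i j * K j t)); last first.
        by rewrite mapE; field.
      over.
    by rewrite -mulr_sumr e !mulr0.
  have : dp u v / k a0 = 0 by rewrite u0 dp0l mul0r.
  move=> e; rewrite -[RHS]e /u linear_sumlz mulr_suml; apply: eq_bigr => j _.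
  by rewrite linearZl_LR mxE /=; ring.
have rk : (\rank (map_mx (intr : int -> R) C) <= \dim <<s>>)%N.
  pose b := vbasis <<s>>%VS.
  pose A : 'M[R]_(m, \dim <<s>>%VS) := \matrix_(i, t) coord b t (r i).
  pose B : 'M[R]_(\dim <<s>>%VS, m) := \matrix_(t, j) (2 * dp b`_t (r j) / N).
  have -> : map_mx intr C = A *m B.
    apply/matrixP => i j; rewrite mxE CE mxE.
    rewrite {1}(coord_vbasis (memv_span (rs_in i))) linear_sumlz mulr_sumr mulr_suml.
    by apply: eq_bigr => t _; rewrite linearZl_LR !mxE /=; ring.
  by apply: leq_trans (mxrankM_maxl _ _) _; apply: rank_leq_col.
have := simply_laced_count slC yC.
have cnt (z : R) p : (forall a, a \in s -> p a = (dp a v / k a0 == z)) ->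
    #|[pred i | y 0%R i == z]| = count p s.
  move=> pE; rewrite (count_nth_ord 0); apply: eq_card => i.
  by rewrite !inE mxE pE // mem_nth.
rewrite (cnt 1 (fun a => dp a v == k a)) => [|a as_]; last first.
  by rewrite kE //; apply/eqP/eqP => [->|e]; rewrite ?divff // -[LHS](divfK kn0) e mul1r.
rewrite (cnt 0 (fun a => dp a v == 0)) => [|a as_]; last first.
  by rewrite mulf_eq0 invr_eq0 (negPf kn0) orbF.
by move/leq_trans; apply; rewrite leq_add2l.
Qed.
End SimplyLaced.

(** * Two root lengths: the systems B and C *)

Section Chains.
Variable R : realType.
Implicit Types (X T : seq R) (a b t y : R).

Lemma big_count X T (g : R -> int) : uniq T -> {subset X <= T} ->
  \sum_(y <- X) g y = \sum_(t <- T) (count_mem t X)%:Z * g t.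
Proof.
move=> uT; elim: X => [|x X IHX] sXT.
  by rewrite big_nil big1 // => t _; rewrite mul0r.
rewrite big_cons IHX => [|y yX]; last by rewrite sXT // inE yX orbT.
under [RHS]eq_bigr => t _ do rewrite /= PoszD mulrDl.
rewrite big_split /=; congr (_ + _).
rewrite (bigD1_seq x) ?sXT ?inE ?eqxx //= mul1r big1 ?addr0 // => t nt.
by rewrite eq_sym (negPf nt) mul0r.
Qed.

(* Summation by parts, and [x w <= x ^ 2] for integers [x], [w] with [`|w| <= 1]. *)
Lemma shift_square_sum X a (sg : R -> int) : (forall t, `|sg t| <= 1) ->
  \sum_(y <- X) (sg y - sg (y + a)) <=
  2 * \sum_(y <- X) ((count_mem y X)%:Z - (count_mem (y - a) X)%:Z).
Proof.
move=> sg1; pose m t : int := (count_mem t X)%:Z.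
pose Xa := [seq y + a | y <- X]; pose T := undup (X ++ Xa).
have uT : uniq T by apply: undup_uniq.
have sXT : {subset X <= T} by move=> y yX; rewrite mem_undup mem_cat yX.
have sXaT : {subset Xa <= T} by move=> y yX; rewrite mem_undup mem_cat yX orbT.
have mXa t : (count_mem t Xa)%:Z = m (t - a).
  rewrite /m count_map; congr Posz; apply: eq_count => y /=.
  by rewrite eq_sym -subr_eq eq_sym.
have sumX g : \sum_(y <- X) g y = \sum_(t <- T) m t * g t.
  exact: big_count.
have sumXa g : \sum_(y <- X) g (y + a) = \sum_(t <- T) m (t - a) * g t.
  rewrite -(big_map (fun y => y + a) xpredT g) (big_count g uT sXaT).
  by apply: eq_bigr => t _; rewrite mXa.
have E1 : \sum_(y <- X) m y = \sum_(t <- T) m (t - a) * m (t - a).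
  rewrite -sumXa; apply: eq_bigr => y _; by rewrite addrK.
rewrite !sumrB (mulrBr 2) mulr_natl mulr2n {2}E1.
rewrite (sumX sg) (sumX (fun y => (count_mem y X)%:Z)).
rewrite (sumX (fun y => (count_mem (y - a) X)%:Z)) (sumXa sg).
rewrite -/m mulr_sumr -big_split -!sumrB; apply: ler_sum => t _ /=.
rewrite -/(m t) -/(m (t - a)).
have := sg1 t; move: (m t) (m (t - a)) (sg t) => x z w w1.
suff : (x - z) * w <= (x - z) * (x - z) by move=> H; nia.
have {}w1 : -1 <= w <= 1 by lia.
have : x - z = 0 \/ 1 <= x - z \/ x - z <= -1 by lia.
by move: (x - z) => e [->|[H|H] ]; nia.
Qed.

(* On a chain [c + aZ] the level sets [t <= b] cut at the end points [b], [-b]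
   make the difference [sg t - sg (t + a)] equal to [2] there; when both lie on
   the same chain, an opposite jump has to be inserted in the middle. *)
Lemma chain_sign a b : 0 < a -> 0 <= b -> exists sg : R -> int,
  (forall t, `|sg t| <= 1) /\
  forall t, 2 * (t == b)%:Z + 2 * (t == - b)%:Z - 2 * (t == 0)%:Z
     - 2 * (t == - (a / 2))%:Z <= sg t - sg (t + a).
Proof.
move=> a0 b0.
pose on c t := (t - c) / a \is a Num.int.
have onD c t : on c (t + a) = on c t.
  rewrite /on; have -> : (t + a - c) / a = (t - c) / a + 1.
    by field; rewrite gt_eqF.
  by rewrite rpredDr ?rpred1.
have on0 c : on c c by rewrite /on subrr mul0r.
have jump c t : on c t -> t <= c -> c < t + a -> t = c.
  rewrite /on => /intrP[n tn] t1 t2.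
  have tc : t - c = n%:~R * a by rewrite -tn divfK ?gt_eqF.
  have n0 : n <= 0.
    by rewrite -(ler_int R) -(ler_pM2r a0) -tc mul0r subr_le0.
  have n1 : -1 < n.
    rewrite -(ltr_int R) -(ltr_pM2r a0) -tc mulN1r; lra.
  have nn : n = 0 by lia.
  by apply/eqP; rewrite -subr_eq0 tc nn mul0r.
have jumpE c t : on c t -> (c < t + a)%R%:Z - (c < t)%R%:Z = (t == c)%:Z.
  move=> ot; have := jump _ _ ot.
  case: (eqVneq t c) => [e _|ne H].
    by rewrite e ltxx ltrDl a0.
  case: (ltP c t) => h1; case: (ltP c (t + a)) => h2 //.
    by exfalso; lra.
  by have e := H h1 h2; rewrite e eqxx in ne.
have [two|two] := boolP (on b (- b)).
  exists (fun t => if on b t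
    then 1 - 2 * (- b < t)%R%:Z + 2 * (0 < t)%R%:Z - 2 * (b < t)%R%:Z else 0).
  split=> t.
    case: ifP => // _; case: (ltP b t) => h1; case: (ltP 0 t) => h2;
      by case: (ltP (- b) t) => h3 //; exfalso; lra.
  rewrite onD; case: ifP => [ot|nt]; last first.
    have -> : (t == b) = false by apply/eqP => e; rewrite e on0 in nt.
    have -> : (t == - b) = false by apply/eqP => e; rewrite e two in nt.
    by case: (_ == _); case: (_ == _).
  have omb : on (- b) t.
    rewrite /on; have -> : (t - - b) / a = (t - b) / a - (- b - b) / a by ring.
    exact: rpredB.
  (* On a chain containing both [b] and [- b], twice any member is a multiple of [a]. So the upward
     jump at 0 takes place at [0] or at [- (a / 2)], the origin of the two negative terms. *)
  have mid : t <= 0 -> 0 < t + a -> t = 0 \/ t = - (a / 2).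
    move=> t1 t2; have := rpredD ot omb.
    have -> : (t - b) / a + (t - - b) / a = 2 * t / a by ring.
    move=> /intrP[n tn].
    have tc : 2 * t = n%:~R * a by rewrite -tn divfK ?gt_eqF.
    have n0 : n <= 0 by rewrite -(ler_int R) -(ler_pM2r a0) -tc; lra.
    have n1 : -2 < n by rewrite -(ltr_int R) -(ltr_pM2r a0) -tc; lra.
    have [nn|nn] : n = 0 \/ n = -1 by lia.
      by left; move: tc; rewrite nn; lra.
    by right; move: tc; rewrite nn; lra.
  have j1 := jumpE _ _ ot; have j2 := jumpE _ _ omb.
  have j0 : (0 < t + a)%R%:Z - (0 < t)%R%:Z <= (t == 0)%:Z + (t == - (a / 2))%:Z.
    case: (ltP 0 t) => h1; first by case: (_ < _); case: (_ == _); case: (_ == _).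
    case: (ltP 0 (t + a)) => h2; last by case: (_ == _); case: (_ == _).
    by case: (mid h1 h2) => /eqP ->; [case: (t == - _) | case: (t == 0)].
  move: j0 j1 j2; clear.
  move: (t == 0)%:Z (t == - (a / 2))%:Z (t == b)%:Z (t == - b)%:Z => x1 x2 x3 x4.
  move: (0 < t + a)%R%:Z (0 < t)%R%:Z (b < t + a)%R%:Z (b < t)%R%:Z => y1 y2 y3 y4.
  by move: (- b < t + a)%R%:Z (- b < t)%R%:Z => y5 y6; lia.
exists (fun t => (if on b t then 1 - 2 * (b < t)%R%:Z else 0)
              + (if on (- b) t then 1 - 2 * (- b < t)%R%:Z else 0)).
have disj t : on b t -> on (- b) t -> False.
  move=> o1 o2; case/negP: two; rewrite /on.
  have -> : (- b - b) / a = (t - b) / a - (t - - b) / a by ring.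
  exact: rpredB.
split=> t.
  have := disj t; case: (on b t); case: (on (- b) t) => // D; last first.
  - by case: (- b < t).
  - by case: (b < t).
  - by case: D.
have pos : 0 <= (t == 0)%:Z + (t == - (a / 2))%:Z by case: (_ == _); case: (_ == _).
have off c : ~~ on c t -> (t == c)%:Z = 0.
  by move=> nt; have -> : (t == c) = false by apply/eqP => e; rewrite e on0 in nt.
rewrite !onD; case: (boolP (on b t)) => [o1|/off ->];
  case: (boolP (on (- b) t)) => [o2|/off ->]; last first.
- move: pos; clear; move: (t == 0)%:Z (t == - (a / 2))%:Z => x1 x2; lia.
- rewrite -(jumpE _ _ o2); move: pos; clear.
  move: (t == 0)%:Z (t == - (a / 2))%:Z (- b < t + a)%R%:Z (- b < t)%R%:Z.
  by move=> x1 x2 x3 x4; lia.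
- rewrite -(jumpE _ _ o1); move: pos; clear.
  move: (t == 0)%:Z (t == - (a / 2))%:Z (b < t + a)%R%:Z (b < t)%R%:Z.
  by move=> x1 x2 x3 x4; lia.
- by case: (disj t).
Qed.

(* The two sums count the pairs in the symmetric multiset [X] with sum [a] and
   with sum [0]. The elements of [X] are the values of the short roots of a system
   of type B, whose long roots are the sums of two short ones. *)
Lemma chain_bound X a b : a != 0 ->
  (forall t, count_mem (- t) X = count_mem t X) ->
  (4 * count_mem b X + 2 * \sum_(y <- X) count_mem (a - y)%R X
   <= 2 * \sum_(y <- X) count_mem (- y)%R X
      + 2 * count_mem 0%R X + 2 * count_mem (a / 2)%R X)%N.
Proof.
move=> a0 symX.
have sumN t : (\sum_(y <- X) count_mem (- t - y)%R X =
    \sum_(y <- X) count_mem (t - y)%R X)%N.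
  have pX : perm_eq [seq - y | y <- X] X.
    apply/allP => z _ /=; rewrite count_map -(symX z); apply/eqP/eq_count => y /=.
    by rewrite eqr_oppLR.
  rewrite -[RHS](perm_big _ pX) big_map; apply: eq_bigr => y _.
  by rewrite -symX opprB !opprK addrC.
wlog a_gt0 : a a0 / 0 < a.
  move=> H; case: (ltgtP a 0) => [an|ap|e]; last 2 first.
  - exact: H.
  - by rewrite e eqxx in a0.
  by rewrite -sumN -(symX (a / 2)) -mulNr; apply: H; rewrite ?oppr_eq0 ?oppr_gt0.
wlog b_ge0 : b / 0 <= b.
  move=> H; case: (leP 0 b) => [|bn]; first exact: H.
  by rewrite -(symX b); apply: H; rewrite oppr_ge0 ltW.
have [sg [sg1 sgD] ] := chain_sign a_gt0 b_ge0.
have := shift_square_sum X a sg1.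
have : \sum_(y <- X) (2 * (y == b)%:Z + 2 * (y == - b)%:Z - 2 * (y == 0)%:Z
     - 2 * (y == - (a / 2))%:Z) <= \sum_(y <- X) (sg y - sg (y + a)).
  by apply: ler_sum => y _; apply: sgD.
have cm c : \sum_(y <- X) (y == c)%:Z = (count_mem c X)%:Z.
  by elim: (X) => [|y Y IHY]; rewrite ?big_nil ?big_cons //= IHY PoszD.
rewrite !sumrB big_split /= -!mulr_sumr !cm !symX.
move=> h1 h2; have := le_trans h1 h2.
have -> : \sum_(y <- X) ((count_mem y X)%:Z) = (\sum_(y <- X) count_mem (- y)%R X)%N.
  by rewrite (big_morph Posz PoszD erefl); apply: eq_bigr => y _; rewrite symX.
have -> : \sum_(y <- X) ((count_mem (y - a) X)%:Z) =
    (\sum_(y <- X) count_mem (a - y)%R X)%N.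
  rewrite (big_morph Posz PoszD erefl); apply: eq_bigr => y _.
  by rewrite -symX opprB.
set A := (\sum_(y <- X) count_mem (- y)%R X)%N.
set B := (\sum_(y <- X) count_mem (a - y)%R X)%N.
move: A B (count_mem b X) (count_mem 0%R X) (count_mem (a / 2)%R X); clear.
by move=> A B x y z; lia.
Qed.

End Chains.

(** * Type B: orthogonal short roots and their sums *)

Section TypeB.
Variables (R : realType) (V : vectType R) (dp : {dot V for idfun}).
Implicit Types (e t u v : V) (S T : seq V).

(** The vertices of a cross-polytope: an orthogonal family together with its negatives. *)
Record cross S : Prop := Cross {
  cross_uniq : uniq S;
  cross_neq0 : forall e, e \in S -> e != 0;
  cross_opp : forall e, e \in S -> - e \in S;
  cross_orth : forall e e', e \in S -> e' \in S ->
    [\/ e' = e, e' = - e | dp e e' = 0] }.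

Lemma neq_opp e : e != 0 -> e != - e.
Proof.
by rewrite -addr_eq0 -mulr2n -scaler_nat scaler_eq0 pnatr_eq0.
Qed.

Lemma orthogonal_dim S : uniq S -> (forall e, e \in S -> e != 0) ->
  (forall e e', e \in S -> e' \in S -> e != e' -> dp e e' = 0) ->
  \dim <<S>> = size S.
Proof.
elim: S => [|e S IHS] /=; first by rewrite span_nil dimv0.
move=> /andP[neS uS] n0 orth; rewrite -cat1s (orth_span_dim (dp := dp)).
  rewrite IHS // => [|f fS|f f' fS fS' ne].
  - by rewrite span_seq1 dim_vline n0 ?mem_head.
  - by rewrite n0 // inE fS orbT.
  - by rewrite orth // inE ?fS ?fS' orbT.
move=> f f'; rewrite inE => /eqP -> fS'; apply: orth; rewrite ?mem_head ?inE ?fS' ?orbT //.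
by apply: contraNneq neS => ->.
Qed.

Lemma cross_count_dim S (p : pred V) : cross S ->
  (forall e, e \in S -> p e -> ~~ p (- e)) -> (count p S <= \dim <<S>>)%N.
Proof.
move=> cS pN; rewrite -size_filter -orthogonal_dim.
- by apply/dimvS/sub_span => e; rewrite mem_filter => /andP[].
- by rewrite filter_uniq ?(cross_uniq cS).
- by move=> e; rewrite mem_filter => /andP[_ /(cross_neq0 cS)].
move=> e e'; rewrite !mem_filter => /andP[pe eS] /andP[pe' eS'] ne.
case: (cross_orth cS eS eS') => // ee; first by rewrite ee eqxx in ne.
by have := pN _ eS pe; rewrite -ee pe'.
Qed.

Lemma cross_perm S : cross S -> perm_eq [seq - e | e <- S] S.
Proof.
move=> cS; apply: uniq_perm; rewrite ?map_inj_uniq ?(cross_uniq cS) //.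
  exact: oppr_inj.
move=> e; apply/mapP/idP => [[f fS ->]|eS]; first exact: (cross_opp cS).
by exists (- e); rewrite ?opprK // (cross_opp cS).
Qed.

Lemma cross_size S : cross S -> (size S <= 2 * \dim <<S>>)%N.
Proof.
(* [p] selects from each pair [e], [- e] the member listed first. *)
move=> cS; pose p e := (index e S < index (- e) S)%N.
have pN e : e \in S -> p (- e) = ~~ p e.
  move=> eS; rewrite /p opprK; case: ltngtP => // ee.
  have := neq_opp (cross_neq0 cS eS); case/eqP.
  by rewrite -[LHS](nth_index 0 eS) -ee nth_index ?(cross_opp cS).
have cp : (count p S <= \dim <<S>>)%N.
  by apply: cross_count_dim => // e eS pe; rewrite pN // pe.
have e1 : count (predC p) S = count p S.
  rewrite -(permP (cross_perm cS) p) count_map; apply: eq_in_count => e eS /=.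
  by rewrite pN.
by rewrite -(count_predC p S) e1 addnn -mul2n leq_mul2l.
Qed.

(** Each [t = e1 + e2] comes from exactly two ordered pairs: a summand [e] of [t] satisfies
    [dp e t = dp e e > 0], which in a cross leaves only [e1] and [e2]. *)
Lemma typeB_pairs S T (F : V -> nat) : cross S -> uniq T ->
  (forall e e', e \in S -> e' \in S -> dp e e' = 0 -> e + e' \in T) ->
  (forall t, t \in T -> exists e e', [/\ e \in S, e' \in S, dp e e' = 0 & t = e + e']) ->
  (\sum_(e <- S) \sum_(e' <- S | dp e e' == 0%R) F (e + e')%R = 2 * \sum_(t <- T) F t)%N.
Proof.
move=> cS uT ST TS.
transitivity (\sum_(e <- S) \sum_(e' <- S | dp e e' == 0%R)
    \sum_(t <- T | t == (e + e')%R) F t)%N.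
  rewrite big_seq [RHS]big_seq; apply: eq_bigr => e eS.
  rewrite big_seq_cond [RHS]big_seq_cond; apply: eq_bigr => e' /andP[eS' /eqP ee].
  by rewrite -big_filter filter_pred1_uniq ?ST // big_seq1.
transitivity (\sum_(e <- S) \sum_(t <- T)
    \sum_(e' <- S | (dp e e' == 0%R) && (t == (e + e')%R)) F t)%N.
  apply: eq_bigr => e _; by rewrite (exchange_big_dep xpredT).
rewrite exchange_big /= big_distrr /= big_seq [RHS]big_seq; apply: eq_bigr => t tT.
have [e1 [e2 [e1S e2S e12 tE] ] ] := TS _ tT.
have e1n2 : e1 != e2.
  apply/eqP => e; move: e12; rewrite -e => /dp_eq0/eqP.
  by rewrite (negPf (cross_neq0 cS e1S)).
transitivity (\sum_(e <- S) (if (e == e1) || (e == e2) then F t else 0))%N.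
  rewrite big_seq [RHS]big_seq; apply: eq_bigr => e eS.
  case: ifP => [ee|ne].
    rewrite -big_filter.
    have -> : [seq e' <- S | (dp e e' == 0) && (t == e + e')] = [:: t - e].
      rewrite -(@filter_pred1_uniq _ S (t - e)) ?(cross_uniq cS) //; last first.
        by case/orP: ee => /eqP ->; rewrite tE ?addrK // addrC addKr.
      apply: eq_in_filter => e' _ /=; rewrite addrC -subr_eq [in RHS]eq_sym.
      apply/andb_idl => /eqP <-; case/orP: ee => /eqP ->.
        by rewrite tE addrC addKr e12.
      by rewrite tE addrK dpC e12.
    by rewrite big_seq1.
  rewrite big_seq_cond big1 // => e' /andP[e'S /andP[/eqP ee' /eqP te] ].
  move/negP: ne; case.
  have te2 : dp e t = dp e e by rewrite te dpDr ee' addr0.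
  have e0 := dp_gt0 dp (cross_neq0 cS eS); rewrite tE dpDr in te2.
  have [->|ne1|o1] := cross_orth cS eS e1S; rewrite ?eqxx //.
    have [->|ne2|o2] := cross_orth cS eS e2S; rewrite ?eqxx ?orbT //.
      by rewrite ne1 ne2 eqxx in e1n2.
    by move: te2; rewrite ne1 o2 dpNr; lra.
  have [->|ne2|o2] := cross_orth cS eS e2S; rewrite ?eqxx ?orbT //.
    by move: te2; rewrite ne2 o1 dpNr; lra.
  by move: te2; rewrite o1 o2; lra.
rewrite -big_mkcond /= -big_filter.
have pe : perm_eq [seq e <- S | (e == e1) || (e == e2)] [:: e1; e2].
  apply: uniq_perm; rewrite /= ?filter_uniq ?(cross_uniq cS) ?inE ?e1n2 //.
  move=> e; rewrite mem_filter !inE; case: eqP => [->|_] /=; first by rewrite e1S.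
  by case: eqP => [->|_] //=.
by rewrite (perm_big _ pe) /= big_cons big_seq1 mul2n -addnn.
Qed.

Lemma typeB_bound S T v a b : cross S -> uniq T ->
  (forall e e', e \in S -> e' \in S -> dp e e' = 0 -> e + e' \in T) ->
  (forall t, t \in T -> exists e e', [/\ e \in S, e' \in S, dp e e' = 0 & t = e + e']) ->
  (count (fun t => dp t v == a) T + count (fun e => dp e v == b) S <=
   count (fun t => dp t v == 0%R) T + count (fun e => dp e v == 0%R) S
     + \dim <<S>>)%N.
Proof.
move=> cS uT ST TS.
have [->|a0] := eqVneq a 0.
  rewrite -addnA leq_add2l; have [->|b0] := eqVneq b 0; first exact: leq_addr.
  apply: leq_trans (leq_addl _ _); apply: cross_count_dim => // e _ /eqP eb.
  by rewrite dpNl eb; apply: contra b0 => /eqP h; apply/eqP; lra.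
pose X := [seq dp e v | e <- S].
have mX c : count_mem c X = count (fun e => dp e v == c) S.
  by rewrite count_map; apply: eq_count.
have symX c : count_mem (- c) X = count_mem c X.
  rewrite !mX.
  rewrite -[RHS](permP (cross_perm cS)) count_map; apply: eq_count => e /=.
  by rewrite dpNl eqr_oppLR.
(* Pairs of short roots whose values add up to [c]: orthogonal pairs give each long root twice,
   [(e, e)] counts when [e] has value [c / 2], and [(e, - e)] when [c = 0]. In [chain_bound] the
   terms in [a / 2] then cancel, and [size S] is absorbed by [cross_size]. *)
have pairs c : (\sum_(y <- X) count_mem (c - y)%R X =
   2 * count (fun t => dp t v == c) T + count_mem (c / 2)%R X + (c == 0%R) * size S)%N.
  pose F t := nat_of_bool (dp t v == c).
  have -> : count (fun t => dp t v == c) T = (\sum_(t <- T) F t)%N.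
    by rewrite -sum1_count big_mkcond; apply: eq_bigr => t _; rewrite /F; case: eqP.
  rewrite -(typeB_pairs F cS uT ST TS) big_map mX -[X in (_ + X + _)%N]sum1_count.
  rewrite [X in (_ + X + _)%N]big_mkcond /= -big_split /=.
  have -> : ((c == 0%R) * size S = \sum_(e <- S) (c == 0%R))%N.
    by rewrite big_const_seq count_predT iter_addn_0.
  rewrite -big_split /= big_seq [RHS]big_seq; apply: eq_bigr => e eS.
  rewrite mX -sum1_count big_mkcond /= (bigID (fun f => dp e f == 0)) /= -addnA.
  congr (_ + _)%N.
    apply: eq_bigr => f _; rewrite /F dpDl.
    have -> : (dp f v == c - dp e v) = (dp e v + dp f v == c).
      by apply/eqP/eqP => h; lra.
    by case: eqP.
  have eN := neq_opp (cross_neq0 cS eS).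
  rewrite -big_filter.
  have pe : perm_eq [seq f <- S | dp e f != 0] [:: e; - e].
    apply: uniq_perm; rewrite /= ?filter_uniq ?(cross_uniq cS) ?inE ?eN //.
    have ee0 := dp_gt0 dp (cross_neq0 cS eS).
    move=> f; rewrite mem_filter !inE; apply/andP/orP => [[ef fS]|[] /eqP ->].
    - have [->|->|fe] := cross_orth cS eS fS; rewrite ?eqxx; [by left|by right|].
      by rewrite fe eqxx in ef.
    - by rewrite gt_eqF.
    - by rewrite dpNr oppr_eq0 gt_eqF // (cross_opp cS).
  rewrite (perm_big _ pe) big_cons big_seq1 /= dpNl.
  have -> : (dp e v == c - dp e v) = (dp e v == c / 2) by apply/eqP/eqP => h; lra.
  have -> : (- dp e v == c - dp e v) = (c == 0) by apply/eqP/eqP => h; lra.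
  by case: (c == 0).
have := chain_bound b a0 symX; rewrite !pairs.
under [X in (_ <= 2 * X + _ + _)%N]eq_bigr => y _ do rewrite -(sub0r y).
rewrite pairs eqxx mul0r !mX (negPf a0) mul1n.
have := cross_size cS; rewrite mul0n addn0.
move: (count (fun e => dp e v == b) S) (count (fun t => dp t v == a) T).
move: (count (fun t => dp t v == 0) T) (count (fun e => dp e v == 0) S).
move: (count (fun e => dp e v == a / 2) S) (size S) (\dim <<S>>); clear.
by move=> x1 x2 x3 x4 x5 x6 x7; lia.
Qed.

End TypeB.

(** * Irreducible systems with square lengths [N] and [2 * N] *)

Section TwoLengths.
Variables (R : realType) (V : vectType R) (dp : {dot V for idfun}).
Implicit Types (a b c d e t u v : V) (s : seq V).

Record two_lengths s (N : R) : Prop := TwoLengths {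
  tl_rs : rootsys dp s;
  tl_irr : irreducible dp s;
  tl_gt0 : 0 < N;
  tl_norm : forall a, a \in s -> dp a a = N \/ dp a a = 2 * N }.

Section Facts.
Variables (s : seq V) (N : R).
Hypothesis tl : two_lengths s N.
Let rs := tl_rs tl.
Let N0 := tl_gt0 tl.

Definition short a := (a \in s) && (dp a a == N).
Definition long a := (a \in s) && (dp a a == 2 * N).

Lemma short_mem a : short a -> a \in s. Proof. by case/andP. Qed.
Lemma long_mem a : long a -> a \in s. Proof. by case/andP. Qed.
Lemma short_norm a : short a -> dp a a = N. Proof. by case/andP=> _ /eqP. Qed.
Lemma long_norm a : long a -> dp a a = 2 * N. Proof. by case/andP=> _ /eqP. Qed.

Lemma short_or_long a : a \in s -> short a \/ long a.
Proof.
move=> as_; rewrite /short /long as_ /=.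
by case: (tl_norm tl as_) => /eqP; [left | right].
Qed.

Lemma shortN a : short a -> short (- a).
Proof. by case/andP=> as_ /eqP aN; rewrite /short (rootN rs) // dpNl dpNr opprK aN /=. Qed.
Lemma longN a : long a -> long (- a).
Proof. by case/andP=> as_ /eqP aN; rewrite /long (rootN rs) // dpNl dpNr opprK aN /=. Qed.

Lemma short_refl a b : a \in s -> short b -> short (srefl dp a b).
Proof.
move=> as_ /andP[bs bN]; rewrite /short (rs_refl rs) //=.
by rewrite srefl_norm ?(rs_neq0 rs).
Qed.
Lemma long_refl a b : a \in s -> long b -> long (srefl dp a b).
Proof.
move=> as_ /andP[bs bN]; rewrite /long (rs_refl rs) //=.
by rewrite srefl_norm ?(rs_neq0 rs).
Qed.

Lemma int_sq_lt4 (n : int) : n * n < 4 -> n = 0 \/ n = 1 \/ n = -1.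
Proof. by move=> h; nia. Qed.

Lemma short_short a b : short a -> short b ->
  b = a \/ b = - a \/ dp a b = 0 \/ dp a b = N / 2 \/ dp a b = - (N / 2).
Proof.
case/andP=> as_ /eqP aN /andP[bs /eqP bN].
have [->|->|[n [m [nE mE nm0 nm4] ] ] ] := pairing rs as_ bs; [by left|by right; left|].
right; right; rewrite aN in nE; rewrite bN in mE.
have e : n = m.
  have : n%:~R * N = m%:~R * N by rewrite -nE.
  by move/(mulIf (lt0r_neq0 N0))/(intr_inj (R := R)).
rewrite -e in nm4.
have [e0|[e1|e1] ] := int_sq_lt4 nm4.
- by left; rewrite e0 ?mulr0z ?mulr1z ?mulrN1z in nE; lra.
- by right; left; rewrite e1 ?mulr0z ?mulr1z ?mulrN1z in nE; lra.
- by right; right; rewrite e1 ?mulr0z ?mulr1z ?mulrN1z in nE; lra.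
Qed.

Lemma long_long a b : long a -> long b ->
  b = a \/ b = - a \/ dp a b = 0 \/ dp a b = N \/ dp a b = - N.
Proof.
case/andP=> as_ /eqP aN /andP[bs /eqP bN].
have [->|->|[n [m [nE mE nm0 nm4] ] ] ] := pairing rs as_ bs; [by left|by right; left|].
right; right; rewrite aN in nE; rewrite bN in mE.
have e : n = m.
  have : n%:~R * (2 * N) = m%:~R * (2 * N) by rewrite -nE.
  have N2 : 2 * N != 0 by rewrite mulf_neq0 ?pnatr_eq0 ?gt_eqF.
  by move/(mulIf N2)/(intr_inj (R := R)).
rewrite -e in nm4.
have [e0|[e1|e1] ] := int_sq_lt4 nm4.
- by left; rewrite e0 ?mulr0z ?mulr1z ?mulrN1z in nE; lra.
- by right; left; rewrite e1 ?mulr0z ?mulr1z ?mulrN1z in nE; lra.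
- by right; right; rewrite e1 ?mulr0z ?mulr1z ?mulrN1z in nE; lra.
Qed.

Lemma short_long a b : short a -> long b ->
  dp a b = 0 \/ dp a b = N \/ dp a b = - N.
Proof.
case/andP=> as_ /eqP aN /andP[bs /eqP bN].
have [e|e|[n [m [nE mE nm0 nm4] ] ] ] := pairing rs as_ bs.
- by exfalso; have := N0; move: bN; rewrite e aN; lra.
- by exfalso; have := N0; move: bN; rewrite e dpNl dpNr opprK aN; lra.
rewrite aN in nE; rewrite bN in mE.
have e : n = 2 * m.
  have : n%:~R * N = (2 * m)%:~R * N by rewrite -nE mE intrM; ring.
  by move/(mulIf (lt0r_neq0 N0))/(intr_inj (R := R)).
have [e0|[e1|e1] ] : m = 0 \/ m = 1 \/ m = -1 by move: nm4; rewrite e; nia.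
- by left; rewrite e0 ?mulr0z ?mulr1z ?mulrN1z in mE; lra.
- by right; left; rewrite e1 ?mulr0z ?mulr1z ?mulrN1z in mE; lra.
- by right; right; rewrite e1 ?mulr0z ?mulr1z ?mulrN1z in mE; lra.
Qed.

Lemma reflS a b : short a -> srefl dp a b = b - (2 * dp b a / N) *: a.
Proof. by case/andP=> _ /eqP aN; rewrite /srefl aN. Qed.
Lemma reflL a b : long a -> srefl dp a b = b - (dp b a / N) *: a.
Proof.
case/andP=> _ /eqP aN; rewrite /srefl aN; congr (_ - _ *: _).
by field; rewrite gt_eqF.
Qed.

Lemma linked_short a b : short a -> b \in s -> exists c, short c /\ dp c b != 0.
Proof.
move=> sa bs; have [||c [cs Qc cb] ] :=
  linked (Q := fun c => dp c c == N) rs (tl_irr tl) _ (short_mem sa) _ bs.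
- by move=> c d cs ds; rewrite srefl_norm ?(rs_neq0 rs).
- by rewrite (short_norm sa) eqxx.
by exists c; rewrite /short cs Qc.
Qed.

Lemma linked_long a b : long a -> b \in s -> exists c, long c /\ dp c b != 0.
Proof.
move=> sa bs; have [||c [cs Qc cb] ] :=
  linked (Q := fun c => dp c c == 2 * N) rs (tl_irr tl) _ (long_mem sa) _ bs.
- by move=> c d cs ds; rewrite srefl_norm ?(rs_neq0 rs).
- by rewrite (long_norm sa) eqxx.
by exists c; rewrite /long cs Qc.
Qed.

Lemma short_long_sub e t : short e -> long t -> dp e t = N ->
  short (t - e) /\ dp e (t - e) = 0.
Proof.
move=> se lt et; have := short_refl (long_mem lt) se.
rewrite reflL // et divff ?gt_eqF // scale1r => /shortN; rewrite opprB => ->.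
by rewrite dpDr dpNr et (short_norm se) subrr.
Qed.

Lemma long_opp_sum e f : short e -> short f -> dp e f = 0 -> long (e + f) -> long (e - f).
Proof.
move=> se sf ef lef; have := long_refl (short_mem sf) lef.
rewrite reflS // dpDl ef (short_norm sf) add0r mulfK ?gt_eqF //.
by rewrite scaler_nat mulr2n opprD addrA addrK.
Qed.

Definition shorts_cross := forall a b, short a -> short b ->
  [\/ b = a, b = - a | dp a b = 0].

(** The short roots [c] that are [e] or [- e], or for which [e + c] is long, form a set [Q] stable
    under all reflections. By [linked] it has a member not orthogonal to [f], and in a cross this is
    [f] or [- f]. *)
Lemma cross_sum_long e f : shorts_cross -> short e -> short f -> dp e f = 0 ->
  long (e + f).
Proof.
move=> cr se sf ef.
pose Q c := (dp c c == N) && [|| c == e, c == - e | long (e + c)].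
have orth d : short d -> long (e + d) -> dp e d = 0.
  move=> sd /long_norm; rewrite !dpE (dpC dp d e) (short_norm se) (short_norm sd).
  by move=> h; lra.
have Qst c d : c \in s -> d \in s -> Q d -> Q (srefl dp c d).
  move=> cs ds; rewrite /Q srefl_norm ?(rs_neq0 rs) // => /andP[dN Qd].
  rewrite dN /=; have sd : short d by rewrite /short ds.
  have QN : [|| - d == e, - d == - e | long (e - d)].
    case/or3P: Qd => [/eqP ->|/eqP ->|ld]; rewrite ?opprK ?eqxx ?orbT //.
    by rewrite long_opp_sum ?orbT // orth.
  have sd1 : short (srefl dp c d) by apply: short_refl.
  have [sc|lc] := short_or_long cs.
    have [dc|dc|dc] := cr _ _ sc sd.
    - by rewrite -dc srefl_self ?(rs_neq0 rs).
    - rewrite (_ : srefl dp c d = - d) // dc opprK /srefl dpNl mulrN mulNr.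
      rewrite mulfK ?gt_eqF ?dp_gt0 ?(rs_neq0 rs) // scaleNr opprK.
      by rewrite scaler_nat mulr2n addKr.
    - by rewrite /srefl dpC dc mulr0 mul0r scale0r subr0.
  (* Here [c] is long and [d1] is orthogonal to [e] unless it is [e] or [- e]. If [e + d] is long,
     then [e] is orthogonal to [c], a multiple of [d - d1], so the reflection in [c] takes [e + d]
     to [e + d1]. *)
  have key eps : eps = 1 \/ eps = -1 -> srefl dp c d = d - eps *: c ->
      [|| srefl dp c d == e, srefl dp c d == - e | long (e + srefl dp c d)].
    move=> eps1; set d1 := srefl dp c d => d1E.
    have lec : long (eps *: c).
      by case: eps1 => ->; rewrite ?scale1r ?scaleN1r //; apply: longN.
    have [->|->|ed1] := cr e d1 se sd1; rewrite ?eqxx ?orbT //.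
    suff -> : long (e + d1) by rewrite !orbT.
    case/or3P: Qd => [/eqP de|/eqP de|ld].
    - rewrite -[d1]opprK; apply: long_opp_sum; rewrite ?dpNr ?ed1 ?oppr0 //.
        exact: shortN.
      by rewrite d1E de opprB addrC subrK.
    - by rewrite d1E de addrA subrr add0r longN.
    have ec : dp e c = 0.
      have : dp e (eps *: c) = 0.
        have -> : eps *: c = d - d1 by rewrite d1E opprB addrC subrK.
        by rewrite dpDr dpNr ed1 (orth d) ?subr0.
      by rewrite dpZr => /eqP; case: eps1 => ->; rewrite ?mul1r ?mulN1r ?oppr_eq0 => /eqP.
    have := long_refl cs ld; rewrite {1}/srefl.
    have -> : 2 * dp (e + d) c = 2 * dp d c by rewrite dpDl ec add0r.
    by rewrite -addrA -/(srefl dp c d).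
  have [x0|[x1|x1] ] := short_long sd lc.
  - by rewrite reflL // x0 mul0r scale0r subr0.
  - by apply: (key 1); [left | rewrite reflL // x1 divff ?gt_eqF].
  - by apply: (key (-1)); [right | rewrite reflL // x1 mulNr divff ?gt_eqF].
have [|c [cs /andP[cN Qc] cf] ] :=
  linked rs (tl_irr tl) Qst (short_mem se) _ (short_mem sf).
  by rewrite /Q (short_norm se) !eqxx.
have sc : short c by rewrite /short cs.
have ee := gt_eqF (dp_gt0 dp (rs_neq0 rs (short_mem se))).
have [fc|fc|fc] := cr _ _ sc sf; last by rewrite fc eqxx in cf.
  case/or3P: Qc => [/eqP ce|/eqP ce|]; last by rewrite fc.
    by move: ef; rewrite fc ce => /eqP; rewrite ee.
  by move: ef; rewrite fc ce dpNr => /eqP; rewrite oppr_eq0 ee.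
case/or3P: Qc => [/eqP ce|/eqP ce|lc].
- by move: ef; rewrite fc ce dpNr => /eqP; rewrite oppr_eq0 ee.
- by move: ef; rewrite fc ce opprK => /eqP; rewrite ee.
by rewrite fc long_opp_sum // orth.
Qed.

Lemma long_sum_short t : (exists a, short a) -> long t ->
  exists e f, [/\ short e, short f, dp e f = 0 & t = e + f].
Proof.
move=> [a sa] lt; have [c [sc ct] ] := linked_short sa (long_mem lt).
have [e [se et] ] : exists e, short e /\ dp e t = N.
  have [x0|[x1|x1] ] := short_long sc lt.
  - by rewrite x0 eqxx in ct.
  - by exists c.
  - by exists (- c); rewrite dpNl x1 opprK; split=> //; apply: shortN.
have [sf ef] := short_long_sub se lt et.
by exists e, (t - e); split=> //; rewrite addrC subrK.
Qed.

Lemma shorts_cross_bound (k : V -> R) v : kinv dp s k -> (exists a, short a) ->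
  (exists a, long a) -> shorts_cross -> pole_bound dp s k v.
Proof.
move=> kk exS [b0 lb0] cr; have [a0 sa0] := exS.
pose S := [seq a <- s | dp a a == N]; pose T := [seq a <- s | dp a a == 2 * N].
have memS a : (a \in S) = short a by rewrite mem_filter andbC.
have memT a : (a \in T) = long a by rewrite mem_filter andbC.
have cS : cross dp S.
  split.
  - by rewrite filter_uniq ?(rs_uniq rs).
  - by move=> e; rewrite memS => /short_mem /(rs_neq0 rs).
  - by move=> e; rewrite !memS; apply: shortN.
  - by move=> e e'; rewrite !memS; apply: cr.
have := @typeB_bound _ _ dp S T v (k b0) (k a0) cS.
move=> /(_ (filter_uniq _ (rs_uniq rs))) H.
have {}H := H _ _.
have cnt (p : pred V) : count p s = (count p T + count p S)%N.
  have -> : S = filter (predC (fun a => dp a a == 2 * N)) s.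
    apply: eq_in_filter => a /short_or_long[/short_norm|/long_norm] e /=.
      by rewrite !e eqxx; apply/esym/eqP => h; have := N0; lra.
    by rewrite !e eqxx; apply/eqP => h; have := N0; lra.
  by rewrite -count_cat; apply/esym/permP; rewrite perm_filterC.
rewrite /pole_bound !cnt.
rewrite (eq_in_count (a1 := fun a => dp a v == k a)
  (a2 := fun a => dp a v == k b0) (s := T)); last first.
  move=> a; rewrite memT => la.
  rewrite (irreducible_kinv rs (tl_irr tl) kk (long_mem la) (long_mem lb0)) //.
  by rewrite !long_norm.
rewrite (eq_in_count (a1 := fun a => dp a v == k a)
  (a2 := fun a => dp a v == k a0) (s := S)); last first.
  move=> a; rewrite memS => la.
  rewrite (irreducible_kinv rs (tl_irr tl) kk (short_mem la) (short_mem sa0)) //.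
  by rewrite !short_norm.
apply: leq_trans (H _ _) _.
- by move=> e f; rewrite !memS memT; apply: cross_sum_long.
- move=> t; rewrite memT => /(long_sum_short exS)[e [f [se sf ef tE] ] ].
  by exists e, f; rewrite !memS.
rewrite leq_add2l; apply/dimvS/sub_span => a; rewrite memS; exact: short_mem.
Qed.

End Facts.
End TwoLengths.

(** * Coroots and type C *)

Section Dual.
Variables (R : realType) (V : vectType R) (dp : {dot V for idfun}).
Implicit Types (a b c d e t u v : V) (s : seq V).

Definition dual a := (2 / dp a a) *: a.

Lemma dual_norm a : a != 0 -> dp (dual a) (dual a) = 4 / dp a a.
Proof.
move=> /(dp_gt0 dp) aa; rewrite /dual dpZl dpZr; field; exact: lt0r_neq0.
Qed.

Lemma dual_coef a : a != 0 -> 2 / dp a a != 0.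
Proof.
by move=> a0; rewrite mulf_neq0 ?invr_eq0 ?pnatr_eq0 // lt0r_neq0 ?dp_gt0.
Qed.

Lemma dual_neq0 a : a != 0 -> dual a != 0.
Proof. by move=> a0; rewrite /dual scaler_eq0 negb_or a0 andbT dual_coef. Qed.

Lemma dualK a : a != 0 -> dual (dual a) = a.
Proof.
move=> a0; have aa := lt0r_neq0 (dp_gt0 dp a0).
rewrite {1}/dual dual_norm // /dual scalerA -[RHS]scale1r; congr (_ *: _).
by field.
Qed.

Lemma dual_refl a b : a != 0 -> srefl dp (dual a) (dual b) = dual (srefl dp a b).
Proof.
move=> a0; have aa := lt0r_neq0 (dp_gt0 dp a0).
rewrite [dual (srefl dp a b)]/dual srefl_norm // {1}/srefl dual_norm //.
rewrite /dual /srefl scalerBr !scalerA; congr (_ - _ *: _).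
by rewrite dpZl dpZr; move: (2 / dp b b) => x; field.
Qed.

Lemma dual_rootsys s : rootsys dp s -> rootsys dp (map dual s).
Proof.
move=> rs; split.
- rewrite map_inj_in_uniq ?(rs_uniq rs) // => a b /(rs_neq0 rs) a0 /(rs_neq0 rs) b0 e.
  by rewrite -(dualK a0) e dualK.
- by move=> _ /mapP[a /(rs_neq0 rs) a0 ->]; apply: dual_neq0.
- move=> _ _ /mapP[a as_ ->] /mapP[b bs ->].
  by rewrite dual_refl ?(rs_neq0 rs) // map_f ?(rs_refl rs).
- move=> _ _ /mapP[a as_ ->] /mapP[b bs ->].
  have aa := lt0r_neq0 (dp_gt0 dp (rs_neq0 rs as_)).
  have bb := lt0r_neq0 (dp_gt0 dp (rs_neq0 rs bs)).
  rewrite dual_norm ?(rs_neq0 rs) // /dual dpZl dpZr.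
  have -> : 2 * (2 / dp b b * (2 / dp a a * dp b a)) / (4 / dp a a)
      = 2 * dp a b / dp b b by rewrite (dpC dp a b); field; rewrite aa bb.
  exact: (rs_int rs).
- move=> _ x /mapP[a as_ ->] /mapP[c cs e].
  have a0 := rs_neq0 rs as_.
  have aa := lt0r_neq0 (dp_gt0 dp a0).
  have cc := lt0r_neq0 (dp_gt0 dp (rs_neq0 rs cs)).
  have ce : c = (dp c c / 2 * x * (2 / dp a a)) *: a.
    transitivity ((dp c c / 2) *: (x *: dual a)); last by rewrite /dual !scalerA.
    by rewrite e /dual scalerA -[LHS]scale1r; congr (_ *: _); field.
  have ny : dp (x *: dual a) (x *: dual a) = 4 / dp c c.
    by rewrite e dual_norm ?(rs_neq0 rs).
  have [] := rs_red rs as_ (_ : (dp c c / 2 * x * (2 / dp a a)) *: a \in s).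
  - by rewrite -ce.
  - move=> y1; rewrite y1 scale1r in ce; left.
    by move: y1; rewrite ce => y1; rewrite -[RHS]y1; field.
  - move=> y1; rewrite y1 scaleN1r in ce; right.
    by move: y1; rewrite ce dpNl dpNr opprK => y1; rewrite -[RHS]y1; field.
Qed.

Lemma dual_irreducible s : rootsys dp s -> irreducible dp s ->
  irreducible dp (map dual s).
Proof.
move=> rs irr p orth; have [a b as_ bs pa pb|pa|pa] := irr (p \o dual).
- have := orth _ _ (map_f _ as_) (map_f _ bs) pa pb; rewrite /dual dpZl dpZr.
  move/eqP; rewrite mulf_eq0 (negPf (dual_coef (rs_neq0 rs as_))) /=.
  by rewrite mulf_eq0 (negPf (dual_coef (rs_neq0 rs bs))) /= => /eqP.
- by left => _ /mapP[a as_ ->]; apply: pa.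
- by right => _ /mapP[a as_ ->]; apply: pa.
Qed.

(** Since [dual] is an involution, [dual b] is the root whose coroot is [b]. The factor rescales [k]
    exactly as the root, so the condition [dp a v = k a] is preserved. *)
Definition kdual (k : V -> R) b := 2 / dp (dual b) (dual b) * k (dual b).

Lemma kdualE k a : a != 0 -> kdual k (dual a) = 2 / dp a a * k a.
Proof. by move=> a0; rewrite /kdual dualK. Qed.

Lemma dual_kinv s k : rootsys dp s -> kinv dp s k -> kinv dp (map dual s) (kdual k).
Proof.
move=> rs kk _ _ /mapP[a as_ ->] /mapP[b bs ->].
rewrite dual_refl ?(rs_neq0 rs) // !kdualE ?(rs_neq0 rs) ?(rs_refl rs) //.
by rewrite srefl_norm ?(rs_neq0 rs) // kk.
Qed.

Lemma dual_bound s k v : rootsys dp s -> pole_bound dp (map dual s) (kdual k) v ->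
  pole_bound dp s k v.
Proof.
move=> rs; rewrite /pole_bound !count_map => H.
have n0 a : a \in s -> 2 / dp a a != 0.
  by move=> as_; rewrite dual_coef ?(rs_neq0 rs).
have -> : count (fun a => dp a v == k a) s =
    count (preim dual (fun a => dp a v == kdual k a)) s.
  apply: eq_in_count => a as_ /=; rewrite kdualE ?(rs_neq0 rs) // /dual dpZl.
  by rewrite (inj_eq (mulfI (n0 a as_))).
have -> : count (fun a => dp a v == 0) s = count (preim dual (fun a => dp a v == 0)) s.
  by apply: eq_in_count => a as_ /=; rewrite /dual dpZl mulf_eq0 (negPf (n0 a as_)).
apply: leq_trans H _; rewrite leq_add2l; apply/dimvS/span_subvP.
by move=> _ /mapP[a as_ ->]; apply/rpredZ/memv_span.
Qed.

Definition longs_cross s N := forall a b, long dp s N a -> long dp s N b ->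
  [\/ b = a, b = - a | dp a b = 0].

Lemma longs_cross_bound s N k v : two_lengths dp s N -> kinv dp s k ->
  (exists a, short dp s N a) -> (exists a, long dp s N a) -> longs_cross s N ->
  pole_bound dp s k v.
Proof.
move=> tl kk [a0 sa0] [b0 lb0] cr.
have rs := tl_rs tl; have N0 := tl_gt0 tl.
(* A root of square length [x] has a coroot of square length [4 / x]; so [2 / N] is the new short
   square length, and it belongs to the long roots. *)
have N2 : 4 / (2 * N) = 2 / N by field; rewrite gt_eqF.
have N4 : 4 / N = 2 * (2 / N) by field; rewrite gt_eqF.
have tld : two_lengths dp (map dual s) (2 / N).
  split; [exact: dual_rootsys|exact: (dual_irreducible rs (tl_irr tl))|exact: divr_gt0|].
  move=> _ /mapP[a as_ ->]; rewrite dual_norm ?(rs_neq0 rs) //.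
  by case: (tl_norm tl as_) => ->; [right|left].
have sd b : short dp (map dual s) (2 / N) b -> exists2 a, long dp s N a & b = dual a.
  case/andP => /mapP[a as_ ->]; rewrite dual_norm ?(rs_neq0 rs) // => /eqP e.
  exists a => //; case: (short_or_long tl as_) => // /short_norm aN.
  by move: e; rewrite aN N4 => e; have := divr_gt0 (ltr0Sn R 1) N0; lra.
apply: (dual_bound rs); apply: (shorts_cross_bound tld v (dual_kinv rs kk)).
- exists (dual b0); rewrite /short map_f ?(long_mem lb0) //=.
  by rewrite dual_norm ?(rs_neq0 rs) ?(long_mem lb0) // (long_norm lb0) N2.
- exists (dual a0); rewrite /long map_f ?(short_mem sa0) //=.
  by rewrite dual_norm ?(rs_neq0 rs) ?(short_mem sa0) // (short_norm sa0) N4.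
move=> _ _ /sd[a la ->] /sd[b lb ->].
have [->|->|ab] := cr a b la lb; first by constructor 1.
  by constructor 2; rewrite /dual !dpE opprK scalerN.
by constructor 3; rewrite /dual dpZl dpZr ab !mulr0.
Qed.
End Dual.

(** * The systems F4 and G2 *)

Definition zdot n (t z : seq int) : int :=
  foldr (fun i x => t`_i * z`_i + x) 0 (iota 0 n).

(* [nth true J i] records that the [i]-th simple root vanishes at [v]. Roots
   related by [zdom] then take different values at a dominant [v], so that the
   roots with a given nonzero value form an antichain, whose size [zmax] bounds. *)
Definition znull n (J : seq bool) (z : seq int) :=
  all (fun i => nth true J i || (z`_i == 0)) (iota 0 n).

Definition zdom n (J : seq bool) (z w : seq int) :=
  all (fun i => w`_i <= z`_i) (iota 0 n) &&
  has (fun i => ~~ nth true J i && (w`_i < z`_i)) (iota 0 n).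

Fixpoint zmax n (J : seq bool) (L acc : seq (seq int)) : nat :=
  if L is z :: L' then
    maxn (zmax n J L' acc)
      (if ~~ znull n J z && all (fun w => ~~ zdom n J z w && ~~ zdom n J w z) acc
       then zmax n J L' (z :: acc) else 0%N)
  else size acc.

Fixpoint words (T : Type) (A : seq T) n : seq (seq T) :=
  if n is m.+1 then flatten [seq [seq x :: w | w <- words A m] | x <- A]
  else [:: [::]].

Lemma words_mem (T : eqType) (A : seq T) n (f : nat -> T) :
  (forall i, f i \in A) -> mkseq f n \in words A n.
Proof.
elim: n f => [|n IHn] f fA //=; rewrite /mkseq /= -[1%N]addn0 iotaDl -map_comp.
apply/flattenP; exists [seq f 0%N :: w | w <- words A n].
  by apply/mapP; exists (f 0%N).
by rewrite map_f // (IHn (fun i => f (1 + i)%N)).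
Qed.

(** [J] runs over all patterns of vanishing simple roots. Only positive roots are listed: a null
    root counts twice, but of two opposite roots at most one has a given nonzero value. The last two
    inequalities serve the case where one of the two weights is 0 and its roots cancel on both
    sides. *)
Definition antichain_check n (PS PL : seq (seq int)) :=
  all (fun J => let zs := count (znull n J) PS in let zl := count (znull n J) PL in
    let ms := zmax n J PS [::] in let ml := zmax n J PL [::] in
    [&& (ms + ml <= 2 * (zs + zl) + n)%N, (ms <= 2 * zs + n)%N & (ml <= 2 * zl + n)%N])
  (words [:: true; false] n).

(** * Antichains of positive roots *)

Section Antichains.
Variables (R : realType) (n : nat) (c : nat -> R).
Hypothesis c_ge0 : forall i, (i < n)%N -> 0 <= c i.

Definition zval (z : seq int) : R := \sum_(i < n) (z`_i)%:~R * c i.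
Let J := mkseq (fun i => c i == 0) n.

Lemma nthJ i : (i < n)%N -> nth true J i = (c i == 0).
Proof. by move=> lt; rewrite nth_mkseq. Qed.

Lemma zval_null z : znull n J z -> zval z = 0.
Proof.
move=> /allP zn; rewrite /zval big1 // => i _.
have := zn i; rewrite mem_iota ltn_ord nthJ // => /(_ isT).
by case/orP => /eqP ->; rewrite ?mulr0 ?mul0r.
Qed.

Lemma zval_dom z w : zdom n J z w -> zval w < zval z.
Proof.
case/andP => /allP le /hasP[i]; rewrite mem_iota /= => lt_in /andP[nJ lt_i].
rewrite nthJ // in nJ.
have ci : 0 < c i by rewrite lt_def nJ c_ge0.
rewrite -subr_gt0 /zval -sumrB (bigD1 (Ordinal lt_in)) //=.
apply: ltr_wpDr.
  apply: sumr_ge0 => j _; rewrite -mulrBl mulr_ge0 ?c_ge0 // subr_ge0 ler_int.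
  by apply: le; rewrite mem_iota /=.
by rewrite -mulrBl mulr_gt0 // subr_gt0 ltr_int.
Qed.

Lemma zmax_bound a L acc : a != 0 -> (forall w, w \in acc -> zval w = a) ->
  (count (fun z => zval z == a) L + size acc <= zmax n J L acc)%N.
Proof.
move=> a0; elim: L acc => [|z L IHL] acc Hacc //=.
rewrite leq_max; case: eqP => [za|_]; last by rewrite IHL.
apply/orP; right; rewrite ifT; last first.
  apply/andP; split; first by apply: contra a0 => /zval_null; rewrite za => ->.
  apply/allP => w wacc; apply/andP; split; apply/negP => /zval_dom.
    by rewrite za Hacc // ltxx.
  by rewrite za Hacc // ltxx.
rewrite add1n addSn -addnS; apply: IHL => w; rewrite inE => /orP[/eqP -> //|].
exact: Hacc.
Qed.

Definition signed_count a L :=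
  (count (fun z => zval z == a) L + count (fun z => - zval z == a) L)%N.

Definition zpos (z : seq int) := all (fun i => 0 <= z`_i) (iota 0 n).

Lemma zval_ge0 z : zpos z -> 0 <= zval z.
Proof.
move=> /allP zp; apply: sumr_ge0 => i _; rewrite mulr_ge0 ?c_ge0 ?ler0z //.
by apply: zp; rewrite mem_iota /=.
Qed.

Lemma signed_count_bound a L : a != 0 -> all zpos L ->
  (signed_count a L <= zmax n J L [::])%N.
Proof.
move=> a0 /allP Lp; rewrite /signed_count.
have := @zmax_bound _ L [::] a0; have := @zmax_bound (- a) L [::].
rewrite oppr_eq0 /= !addn0 => /(_ a0) Hn Hp.
have eN : count (fun z => - zval z == a) L = count (fun z => zval z == - a) L.
  by apply: eq_count => z /=; rewrite eqr_oppLR.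
case: (ltgtP a 0) => [an|ap|e]; last by rewrite e eqxx in a0.
  rewrite (eq_in_count (a2 := pred0)) ?count_pred0 ?add0n ?eN ?Hn // => z zL /=.
  by apply/eqP => za; have := zval_ge0 (Lp z zL); rewrite za leNgt an.
rewrite addnC (eq_in_count (a2 := pred0)) ?count_pred0 ?add0n ?Hp // => z zL /=.
apply/eqP => za; have := zval_ge0 (Lp z zL).
by rewrite -oppr_le0 za leNgt ap.
Qed.

Lemma signed_count0 L : signed_count 0 L = (2 * count (fun z => zval z == 0%R) L)%N.
Proof.
rewrite /signed_count mul2n -addnn; congr (_ + _)%N.
by apply: eq_count => z /=; rewrite oppr_eq0.
Qed.

Lemma antichain_bound PS PL a b : antichain_check n PS PL ->
  all zpos PS -> all zpos PL ->
  (signed_count a PS + signed_count b PL <=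
   signed_count 0%R PS + signed_count 0%R PL + n)%N.
Proof.
move=> /allP ck pS pL.
have JJ : J \in words [:: true; false] n.
  by apply: words_mem => i; case: eqP.
have := ck _ JJ; rewrite /= !signed_count0.
have nl L : (count (znull n J) L <= count (fun z => zval z == 0%R) L)%N.
  by apply: sub_count => z /zval_null /= ->.
case/and3P; have := nl PS; have := nl PL.
have [->|a0] := eqVneq a 0; have [->|b0] := eqVneq b 0; rewrite ?signed_count0.
- by move=> *; rewrite leq_addr.
- have := signed_count_bound b0 pL; lia.
- have := signed_count_bound a0 pS; lia.
have := signed_count_bound b0 pL; have := signed_count_bound a0 pS; lia.
Qed.

End Antichains.

Definition zopp : seq int -> seq int := map -%R.
Definition zsimple n i : seq int := mkseq (fun j => (j == i)%:Z) n.
Definition zrow (g : seq (seq int)) i := nth [::] g i.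
Definition zapp n (g : seq (seq int)) z : seq int := mkseq (fun i => zdot n (zrow g i) z) n.
Definition zrefl n (A : seq (seq int)) i z : seq int :=
  mkseq (fun j => z`_j - (j == i)%:Z * zdot n (zrow A i) z) n.
Definition zgen n A m := iter m (fun L => undup (L ++
    flatten [seq [seq zrefl n A i z | z <- L] | i <- iota 0 n]))
  [seq zsimple n i | i <- iota 0 n].
Definition zfull (PS PL : seq (seq int)) := (PS ++ map zopp PS) ++ (PL ++ map zopp PL).
(** The values of [2 * dp r t / N] possible for roots that are neither equal nor opposite, with
    square lengths [N] and [rho * N]. *)
Definition allowed (rho : int) (both_short : bool) : seq int :=
  if both_short then [:: -1; 0; 1] else [:: - rho; 0; rho].

(* [A] is the Cartan matrix of the Gram matrix [N/2 * g]; [PS] and [PL] are the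
   short and the long positive roots in the basis of simple roots, and the last
   condition says that no vector outside the system can extend it. *)
Definition system_check n (rho : int) (g A PS PL : seq (seq int)) m :=
  [&& all (fun i =>
          all (fun j => (zrow A i)`_j * (zrow g i)`_i == 2 * (zrow g i)`_j) (iota 0 n)
          && ((zrow g i)`_i != 0)) (iota 0 n),
      all (mem (zgen n A m)) (zfull PS PL),
      all (mem (zfull PS PL)) [seq zsimple n i | i <- iota 0 n],
      uniq (map (zapp n g) (zfull PS PL)),
      all (fun z => zdot n z (zapp n g z) == 2) PS,
      all (fun z => zdot n z (zapp n g z) == 2 * rho) PL &
      all (fun b => all (fun t =>
          all (fun z => zdot n t z \in allowed rho b) PS &&
          all (fun z => zdot n t z \in allowed rho false) PL
          ==> (t == nseq n 0)) (words [:: - rho; -1; 0; 1; rho] n)) [:: true; false]].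

(** * Recognizing a system from an explicit list of roots *)

Section ListSystem.
Variables (R : realType) (V : vectType R) (dp : {dot V for idfun}).
Variables (n : nat) (rho : int) (g A PS PL : seq (seq int)) (m : nat).
Hypothesis chk : system_check n rho g A PS PL m.
Variables (s : seq V) (N : R) (a : nat -> V).
Hypothesis rs : rootsys dp s.
Hypothesis irr : irreducible dp s.
Hypothesis N0 : 0 < N.
Hypothesis n0 : (0 < n)%N.
Hypothesis rho1 : rho != 1.
Hypothesis pairs : forall r t, r \in s -> t \in s -> r != t -> r != - t ->
  exists2 x, x \in allowed rho ((dp r r == N) && (dp t t == N))
    & dp r t = x%:~R * (N / 2).
Hypothesis a_in : forall i, (i < n)%N -> a i \in s.
Hypothesis gram : forall i j, (i < n)%N -> (j < n)%N ->
  dp (a i) (a j) = ((zrow g i)`_j)%:~R * (N / 2).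

Definition zvec (z : seq int) : V := \sum_(i < n) (z`_i)%:~R *: a i.

Lemma zdotE (t z : seq int) :
  (zdot n t z)%:~R = \sum_(i < n) (t`_i)%:~R * (z`_i)%:~R :> R.
Proof.
rewrite -(big_mkord xpredT (fun i => (t`_i)%:~R * (z`_i)%:~R)) /index_iota subn0.
rewrite /zdot; elim: (iota 0 n) => [|i l IHl]; rewrite ?big_nil ?big_cons //=.
by rewrite intrD intrM IHl.
Qed.

Lemma dp_zvec z v : dp (zvec z) v = zval n (fun i => dp (a i) v) z.
Proof.
rewrite /zvec linear_sumlz; apply: eq_bigr => i _.
by rewrite linearZl_LR.
Qed.

Lemma dp_zvec_dot z (t : seq int) v :
  (forall i, (i < n)%N -> dp (a i) v = (t`_i)%:~R * (N / 2)) ->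
  dp (zvec z) v = (zdot n t z)%:~R * (N / 2).
Proof.
move=> tE; rewrite dp_zvec zdotE mulr_suml; apply: eq_bigr => i _.
by rewrite tE // mulrA [(z`_i)%:~R * _]mulrC.
Qed.

Lemma dp_simple i z : (i < n)%N -> dp (zvec z) (a i) = (zdot n (zrow g i) z)%:~R * (N / 2).
Proof.
by move=> lt_i; apply: dp_zvec_dot => j lt_j; rewrite dpC gram.
Qed.

Lemma zvec_norm z : dp (zvec z) (zvec z) = (zdot n z (zapp n g z))%:~R * (N / 2).
Proof.
rewrite dp_zvec /zval zdotE mulr_suml; apply: eq_bigr => i _.
by rewrite dpC dp_simple // nth_mkseq // mulrA.
Qed.

Lemma zvecN z : zvec (zopp z) = - zvec z.
Proof.
rewrite /zvec -sumrN; apply: eq_bigr => i _; rewrite -scaleNr -intrN; congr (_%:~R *: _).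
rewrite /zopp; case: (ltnP i (size z)) => [lt|le]; first by rewrite (nth_map 0).
by rewrite !nth_default ?size_map // oppr0.
Qed.

Lemma zvec_simple i : (i < n)%N -> zvec (zsimple n i) = a i.
Proof.
move=> lt_i; rewrite /zvec (bigD1 (Ordinal lt_i)) //= nth_mkseq // eqxx scale1r.
rewrite big1 ?addr0 // => j nj; rewrite nth_mkseq //.
have -> : (val j == i) = false by apply/eqP => e; case/eqP: nj; apply: val_inj.
by rewrite scale0r.
Qed.

Lemma zvec_refl i z : (i < n)%N -> zvec (zrefl n A i z) = srefl dp (a i) (zvec z).
Proof.
case/and5P: chk => /allP cart _ _ _ /and3P[_ _ _] lt_i.
have := cart i; rewrite mem_iota lt_i => /(_ isT)/andP[/allP cA gi].
have gR : ((zrow g i)`_i)%:~R != 0 :> R by rewrite intr_eq0.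
have -> : srefl dp (a i) (zvec z) = zvec z - (zdot n (zrow A i) z)%:~R *: a i.
  rewrite /srefl dp_simple // gram //; congr (_ - _ *: _).
  have e : (zdot n (zrow A i) z)%:~R * ((zrow g i)`_i)%:~R
      = 2 * (zdot n (zrow g i) z)%:~R :> R.
    rewrite !zdotE mulr_sumr mulr_suml; apply: eq_bigr => j _.
    have := cA j; rewrite mem_iota /= ltn_ord => /(_ isT)/eqP.
    move=> /(congr1 (fun x : int => x%:~R : R)); rewrite !intrM mulrAC => ->.
    by rewrite mulrA.
  have -> : (zdot n (zrow g i) z)%:~R
      = (zdot n (zrow A i) z)%:~R * ((zrow g i)`_i)%:~R / 2 :> R by rewrite e; field.
  by field; rewrite gR gt_eqF.
rewrite /zvec -[in RHS](@zvec_simple i) // /zvec scaler_sumr -sumrB.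
apply: eq_bigr => j _; rewrite !nth_mkseq // scalerA -scalerBl; congr (_ *: _).
by rewrite intrB intrM [X in _ - X = _]mulrC.
Qed.

Lemma zgen_mem l z : z \in zgen n A l -> zvec z \in s.
Proof.
elim: l z => [|l IHl] z /=.
  by case/mapP => i; rewrite mem_iota /= => lt_i ->; rewrite zvec_simple // a_in.
rewrite mem_undup mem_cat => /orP[/IHl //|/flattenP[W /mapP[i iP ->] /mapP[w wl ->] ] ].
have lt_i : (i < n)%N by move: iP; rewrite mem_iota.
by rewrite zvec_refl // (rs_refl rs) ?a_in // IHl.
Qed.

Let Phi := zfull PS PL.

Lemma Phi_mem z : z \in Phi -> zvec z \in s.
Proof. by case/and5P: chk => _ /allP gen _ _ /and3P[_ _ _] /gen; apply: zgen_mem. Qed.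

Lemma Phi_uniq : uniq (map zvec Phi).
Proof.
case/and5P: chk => _ _ _ u /and3P[_ _ _].
apply: (@map_uniq _ _ (fun v => mkseq (fun i => dp v (a i)) n)); rewrite -map_comp.
have -> : map ((fun v => mkseq (fun i => dp v (a i)) n) \o zvec) Phi
    = map (map (fun x : int => x%:~R * (N / 2))) (map (zapp n g) Phi).
  rewrite -map_comp; apply: eq_map => z /=; rewrite /zapp /mkseq -map_comp.
  apply/eq_in_map => i; rewrite mem_iota /= => lt_i; exact: dp_simple.
rewrite map_inj_uniq //; apply: inj_map => x y /mulIf h.
by apply: (@intr_inj R); apply: h; rewrite mulf_neq0 ?invr_eq0 ?pnatr_eq0 // gt_eqF.
Qed.

Lemma PS_norm z : z \in PS -> dp (zvec z) (zvec z) = N.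
Proof.
case/and5P: chk => _ _ _ _ /and3P[/allP sn _ _] /sn /eqP e.
by rewrite zvec_norm e; field.
Qed.

Lemma PL_norm z : z \in PL -> dp (zvec z) (zvec z) = rho%:~R * N.
Proof.
case/and5P: chk => _ _ _ _ /and3P[_ /allP ln _] /ln /eqP e.
by rewrite zvec_norm e intrM; field.
Qed.

Lemma Phi_opp z : z \in Phi -> - zvec z \in map zvec Phi.
Proof.
have opp L : z \in L -> - zvec z \in map zvec (map zopp L).
  by move=> zL; rewrite -zvecN -map_comp; apply/mapP; exists z.
rewrite /Phi /zfull !mem_cat !map_cat !mem_cat -!orbA.
have oppK w L : w \in map zopp L -> - zvec w \in map zvec L.
  by case/mapP => x xL ->; rewrite zvecN opprK map_f.
by case/or4P => [/opp ->|/oppK ->|/opp ->|/oppK ->]; rewrite ?orbT.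
Qed.

(** The products of [r] with the simple roots form one of finitely many words [T]. They determine
    its products with all listed roots, which must be allowed values, and the check leaves only
    [T = 0]. *)
Lemma outside_orth r i : r \in s -> r \notin map zvec Phi -> (i < n)%N ->
  dp (a i) r = 0.
Proof.
move=> rs_ nr; case/and5P: chk => _ _ /allP simp _ /and3P[_ _ cls].
have pr z : z \in Phi -> exists2 x,
    x \in allowed rho ((dp r r == N) && (dp (zvec z) (zvec z) == N))
    & dp r (zvec z) = x%:~R * (N / 2).
  move=> zP; apply: pairs => //; first exact: Phi_mem.
    by apply: contraNneq nr => ->; apply: map_f.
  by apply: contraNneq nr => ->; apply: Phi_opp.
pose t i := Num.floor (dp r (a i) * 2 / N).
have tA j : (j < n)%N -> dp r (a j) = (t j)%:~R * (N / 2)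
    /\ t j \in [:: - rho; -1; 0; 1; rho].
  move=> lt_j; have := pr (zsimple n j).
  have -> : zsimple n j \in Phi by apply: simp; apply: map_f; rewrite mem_iota.
  move=> /(_ isT)[x xal]; rewrite zvec_simple // => e.
  have -> : t j = x.
    rewrite /t e (_ : x%:~R * (N / 2) * 2 / N = x%:~R) ?intrKfloor //.
    by field; rewrite gt_eqF.
  split=> //; move: xal; rewrite /allowed; case: ifP => _; rewrite !inE.
    by case/or3P => ->; rewrite ?orbT.
  by case/or3P => ->; rewrite ?orbT.
pose T := mkseq (fun j => if (j < n)%N then t j else 0) n.
have TE j : (j < n)%N -> dp (a j) r = (T`_j)%:~R * (N / 2).
  by move=> lt_j; rewrite nth_mkseq // lt_j dpC; case: (tA j lt_j).
have dT z : z \in Phi -> zdot n T z \in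
    allowed rho ((dp r r == N) && (dp (zvec z) (zvec z) == N)).
  move=> /pr[x xal]; rewrite dpC (dp_zvec_dot _ TE) => /mulIf e.
  rewrite (_ : zdot n T z = x) //; apply: (@intr_inj R); apply: e.
  by rewrite mulf_neq0 ?invr_eq0 ?pnatr_eq0 // gt_eqF.
have rhoN : rho%:~R * N == N = false :> bool.
  apply/negP => /eqP; rewrite -[RHS]mul1r => /mulIf; rewrite gt_eqF // => /(_ isT) e.
  by case/eqP: rho1; apply: (@intr_inj R).
have TS z : z \in PS -> zdot n T z \in allowed rho (dp r r == N).
  move=> zS; have := dT z; rewrite /Phi /zfull !mem_cat zS PS_norm // eqxx andbT.
  exact.
have TL z : z \in PL -> zdot n T z \in allowed rho false.
  move=> zL; have := dT z; rewrite /Phi /zfull !mem_cat zL !orbT PL_norm // rhoN andbF.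
  exact.
have TW : T \in words [:: - rho; -1; 0; 1; rho] n.
  apply: words_mem => j; case: ltnP => lt_j; last by rewrite !inE eqxx !orbT.
  by case: (tA j lt_j).
have /eqP T0 : T == nseq n 0.
  have : (dp r r == N) \in [:: true; false] by case: (_ == _).
  move/allP: cls => cls /cls /allP/(_ _ TW)/implyP; apply.
  by apply/andP; split; apply/allP => z; [apply: TS | apply: TL].
by move=> lt_i; rewrite TE // T0 nth_nseq if_same mul0r.
Qed.

(** Unlisted roots are orthogonal to listed ones, and the simple roots are listed; irreducibility
    leaves no unlisted root. *)
Lemma list_system_eq : s =i map zvec Phi.
Proof.
move=> r; apply/idP/idP => [rs_|/mapP[z zP ->]]; last exact: Phi_mem.
have inPhi b : b \in map zvec Phi -> b \in s by case/mapP => z zP ->; apply: Phi_mem.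
case: (irr (p := fun b => b \in map zvec Phi)) => [b c bs cs|all_in|none_in].
- case/mapP => z zP -> nc; rewrite dp_zvec /zval big1 // => i _.
  by rewrite outside_orth ?mulr0.
- exact: all_in.
have := none_in (a 0%N) (a_in n0); rewrite -(zvec_simple n0) map_f //.
case/and5P: chk => _ _ /allP simp _ _; apply: simp; apply: map_f.
by rewrite mem_iota.
Qed.

Lemma list_system_bound (k : V -> R) v : kinv dp s k ->
  antichain_check n PS PL -> all (zpos n) PS -> all (zpos n) PL ->
  (forall i, (i < n)%N -> 0 <= dp (a i) v) -> (n <= \dim <<s>>)%N ->
  pole_bound dp s k v.
Proof.
move=> kk ack pS pL c0 nd; rewrite /pole_bound.
have pe : perm_eq s (map zvec Phi).
  by apply: uniq_perm; [apply: (rs_uniq rs)|apply: Phi_uniq|apply: list_system_eq].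
rewrite !(permP pe) !count_map /Phi /zfull !count_cat !count_map.
pose kS := k (zvec (head [::] PS)); pose kL := k (zvec (head [::] PL)).
have inP z L : z \in L -> head [::] L \in L :> bool.
  by case: L => // y L _; rewrite mem_head.
have sub L : (L = PS \/ L = PL) -> forall z, z \in L -> zvec z \in s.
  by case=> -> z zL; apply: Phi_mem; rewrite !mem_cat zL ?orbT.
have kSE z : z \in PS -> k (zvec z) = kS.
  move=> zS; apply: (irreducible_kinv rs irr kk).
  - by apply: (sub PS) => //; left.
  - by apply: (sub PS); [left | apply: inP zS].
  - by rewrite !PS_norm //; apply: inP zS.
have kLE z : z \in PL -> k (zvec z) = kL.
  move=> zL; apply: (irreducible_kinv rs irr kk).
  - by apply: (sub PL) => //; right.
  - by apply: (sub PL); [right | apply: inP zL].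
  - by rewrite !PL_norm //; apply: inP zL.
have cnt L (x : R) : (L = PS \/ L = PL) -> (forall z, z \in L -> k (zvec z) = x) ->
    (count (preim zvec (fun b => dp b v == k b)) L
     + count (preim zopp (preim zvec (fun b => dp b v == k b))) L)%N
    = signed_count n (fun i => dp (a i) v) x L.
  move=> LP kE; congr (_ + _)%N; apply: eq_in_count => z zL /=.
    by rewrite kE // dp_zvec.
  by rewrite zvecN (kinvN rs kk) ?(sub L) // kE // dpNl dp_zvec.
have cnt0 L : (count (preim zvec (fun b => dp b v == 0%R)) L
     + count (preim zopp (preim zvec (fun b => dp b v == 0%R))) L)%N
    = signed_count n (fun i => dp (a i) v) 0 L.
  congr (_ + _)%N; apply: eq_count => z /=; rewrite ?zvecN ?dpNl dp_zvec //.
rewrite (cnt PS kS) ?(cnt PL kL) ?cnt0; [|by right|by []|by left|by []].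
apply: leq_trans (antichain_bound c0 kS kL ack pS pL) _.
by rewrite leq_add2l.
Qed.

End ListSystem.

(** In units of half the short square length: diagonal 2 for short simple roots, 4 for long ones in
    F4 and 6 in G2. *)
Definition F4_gram : seq (seq int) :=
  [:: [:: 4; -2; 0; 0]; [:: -2; 4; -2; 0]; [:: 0; -2; 2; -1]; [:: 0; 0; -1; 2]].
Definition F4_cartan : seq (seq int) :=
  [:: [:: 2; -1; 0; 0]; [:: -1; 2; -1; 0]; [:: 0; -2; 2; -1]; [:: 0; 0; -1; 2]].
Definition F4_short : seq (seq int) :=
  [:: [:: 1; 2; 3; 2]; [:: 1; 1; 1; 0]; [:: 0; 1; 1; 0]; [:: 0; 0; 1; 0];
      [:: 1; 2; 3; 1]; [:: 1; 2; 2; 1]; [:: 1; 1; 2; 1]; [:: 1; 1; 1; 1];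
      [:: 0; 1; 2; 1]; [:: 0; 1; 1; 1]; [:: 0; 0; 1; 1]; [:: 0; 0; 0; 1] ].
Definition F4_long : seq (seq int) :=
  [:: [:: 2; 3; 4; 2]; [:: 0; 1; 2; 2]; [:: 1; 3; 4; 2]; [:: 1; 1; 2; 2];
      [:: 1; 2; 2; 0]; [:: 1; 0; 0; 0]; [:: 1; 2; 4; 2]; [:: 1; 2; 2; 2];
      [:: 1; 1; 2; 0]; [:: 1; 1; 0; 0]; [:: 0; 1; 2; 0]; [:: 0; 1; 0; 0] ].

Definition G2_gram : seq (seq int) := [:: [:: 2; -3]; [:: -3; 6] ].
Definition G2_cartan : seq (seq int) := [:: [:: 2; -3]; [:: -1; 2] ].
Definition G2_short : seq (seq int) := [:: [:: 1; 0]; [:: 1; 1]; [:: 2; 1] ].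
Definition G2_long : seq (seq int) := [:: [:: 0; 1]; [:: 3; 1]; [:: 3; 2] ].

(** The last argument is a number of rounds of simple reflections that suffices to reach every root
    from the simple ones. *)
Lemma G2_system : system_check 2 3 G2_gram G2_cartan G2_short G2_long 6.
Proof. by vm_compute. Qed.
Lemma G2_antichain : antichain_check 2 G2_short G2_long.
Proof. by vm_compute. Qed.
Lemma G2_pos : all (zpos 2) G2_short && all (zpos 2) G2_long.
Proof. by vm_compute. Qed.
Lemma F4_pos : all (zpos 4) F4_short && all (zpos 4) F4_long.
Proof. by vm_compute. Qed.
Lemma F4_antichain : antichain_check 4 F4_short F4_long.
Proof. by vm_compute. Qed.
Lemma F4_system : system_check 4 2 F4_gram F4_cartan F4_short F4_long 10.
Proof. by vm_compute. Qed.

(** * Inner products for two root lengths, and the system G2 *)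

Section SmallSystems.
Variables (R : realType) (V : vectType R) (dp : {dot V for idfun}).
Implicit Types (a b c d e f r t u v w : V) (s : seq V).

Lemma seq_max (T : eqType) (f : T -> R) (l : seq T) x : x \in l ->
  exists2 y, y \in l & forall z, z \in l -> f z <= f y.
Proof.
elim: l x => // y l IHl x _; case: l IHl => [_|z l IHl].
  by exists y; rewrite ?mem_head // => z; rewrite inE => /eqP ->.
have [w wl wmax] := IHl z (mem_head _ _).
have [le|/ltW le] := lerP (f w) (f y).
  exists y; rewrite ?mem_head // => t; rewrite inE => /orP[/eqP -> //|/wmax tw].
  exact: le_trans tw le.
exists w; first by rewrite in_cons wl orbT.
by move=> t; rewrite in_cons => /orP[/eqP ->|/wmax].
Qed.

Lemma irreducible_lengths s a b : rootsys dp s -> irreducible dp s ->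
  a \in s -> b \in s ->
  [\/ dp b b = dp a a, dp b b = 2 * dp a a \/ dp b b = 3 * dp a a
    | dp a a = 2 * dp b b \/ dp a a = 3 * dp b b].
Proof.
move=> rs irr as_ bs.
have [||c [cs /eqP <- cb] ] := linked (Q := fun c => dp c c == dp a a) rs irr _ as_ _ bs.
- by move=> c d cs ds; rewrite srefl_norm ?(rs_neq0 rs).
- exact: eqxx.
exact: (pairing_lengths rs cs bs cb).
Qed.

Lemma two_norm_pairs s N (rho : int) : rootsys dp s -> 0 < N ->
  rho = 2 \/ rho = 3 ->
  (forall r, r \in s -> dp r r = N \/ dp r r = rho%:~R * N) ->
  forall r t, r \in s -> t \in s -> r != t -> r != - t ->
  exists2 x, x \in allowed rho ((dp r r == N) && (dp t t == N))
    & dp r t = x%:~R * (N / 2).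
Proof.
move=> rs N0 rhoE nrm r t rs_ ts rt rnt.
have [e|e|[n [m [nE mE nm0 nm4] ] ] ] := pairing rs rs_ ts.
- by rewrite e eqxx in rt.
- by rewrite e opprK eqxx in rnt.
have NN := lt0r_neq0 N0.
have rhoN : (rho%:~R * N == N) = false.
  by apply/eqP; case: rhoE => -> h; lra.
have three (x : int) : x = 0 \/ x = 1 \/ x = -1 ->
    (x \in allowed rho true) /\ (rho * x \in allowed rho false).
  rewrite /allowed !inE => -[|[|] ] ->; rewrite ?mulr0 ?mulr1 ?mulrN1 ?eqxx ?orbT //.
have inj (x y : int) : x%:~R * N = y%:~R * N -> x = y.
  by move/(mulIf NN)/(intr_inj (R := R)).
case: (nrm r rs_) (nrm t ts) => rN [tN|tN]; rewrite rN tN ?rhoN ?eqxx ?andbF ?andbT;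
  rewrite rN in nE; rewrite tN in mE.
- have e : n = m by apply: inj; rewrite -nE.
  exists n; last by move: nE; lra.
  apply: (three n _).1; move: nm4; rewrite -e; nia.
- have e : n = m * rho by apply: inj; rewrite -nE mE intrM mulrA.
  have m1 : m = 0 \/ m = 1 \/ m = -1 by move: nm4; rewrite e; case: rhoE => ->; nia.
  exists (rho * m); first exact: (three m m1).2.
  by rewrite (mulrC rho) -e; move: nE; lra.
- have e : m = n * rho by apply: inj; rewrite -mE nE intrM mulrA.
  have n1 : n = 0 \/ n = 1 \/ n = -1 by move: nm4; rewrite e; case: rhoE => ->; nia.
  exists (rho * n); first exact: (three n n1).2.
  by rewrite (mulrC rho) -e; move: mE; lra.
have e : n = m.
  have : (n * rho)%:~R * N = (m * rho)%:~R * N by rewrite !intrM -!mulrA -nE.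
  by move/inj; case: rhoE => ->; lia.
have n1 : n = 0 \/ n = 1 \/ n = -1 by move: nm4; rewrite -e; nia.
exists (rho * n); first exact: (three n n1).2.
by rewrite intrM; move: nE; lra.
Qed.

(* If the short root [th] is the highest on [v], one of the two bases having [th]
   as dominant short root is nonnegative on [v]. *)
Lemma G2_bound s k v a b : rootsys dp s -> irreducible dp s -> kinv dp s k ->
  a \in s -> b \in s -> dp a a = 3 * dp b b -> pole_bound dp s k v.
Proof.
move=> rs irr kk as_ bs ab; pose N := dp b b.
have N0 : 0 < N by rewrite dp_gt0 ?(rs_neq0 rs).
have NN : N != 0 := lt0r_neq0 N0.
have nrm r : r \in s -> dp r r = N \/ dp r r = 3%:~R * N.
  move=> rs_; have := irreducible_lengths rs irr as_ rs_.
  have := irreducible_lengths rs irr bs rs_; rewrite ab -/N.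
  by move=> [h|[h|h]|[h|h] ] [h'|[h'|h']|[h'|h'] ]; (left; lra) || (right; lra).
have prs := two_norm_pairs rs N0 (or_intror (erefl 3)) nrm.
pose S := [seq r <- s | dp r r == N].
have bS : b \in S by rewrite mem_filter eqxx.
have [th thS thmax] := seq_max (fun r => dp r v) bS.
move: thS; rewrite mem_filter => /andP[/eqP thN ths].
have {}thmax r : r \in s -> dp r r = N -> dp r v <= dp th v.
  by move=> rs_ rN; apply: thmax; rewrite mem_filter rN eqxx.
have [l [ls lN lth] ] : exists l, [/\ l \in s, dp l l = 3 * N & dp l th = 3 / 2 * N].
  have [||c [cs /eqP cN cth] ] := linked (Q := fun c => dp c c == 3 * N) rs irr _ as_ _ ths.
  - by move=> c d cs ds; rewrite srefl_norm ?(rs_neq0 rs).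
  - by rewrite ab eqxx.
  have cthn : c != th by apply/eqP => e; move: cN; rewrite e thN; lra.
  have cthn' : c != - th.
    by apply/eqP => e; move: cN; rewrite e dpNl dpNr opprK thN; lra.
  have [x] := prs _ _ cs ths cthn cthn'.
  have -> : (dp c c == N) = false by apply/eqP; rewrite cN; lra.
  rewrite !inE => /or3P[] /eqP -> e.
  - exists (- c); split; first exact: (rootN rs).
      by rewrite dpNl dpNr opprK.
    by rewrite dpNl e; lra.
  - by rewrite e mul0r eqxx in cth.
  - by exists c; split=> //; rewrite e; lra.
(* [z] is the long root orthogonal to [th]. Its sign at [v] decides between the bases [2 *: th - l],
   [z] and [l - th], [- z]; maximality of [th] makes the short simple root nonnegative at [v]. *)
pose w := l - 3 *: th; pose z := 2 *: l - 3 *: th.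
have ws : w \in s.
  have -> : w = srefl dp th l.
    by rewrite /w /srefl lth thN; congr (_ - _ *: _); field.
  exact: (rs_refl rs).
have zs : z \in s.
  have -> : z = srefl dp w l; last exact: (rs_refl rs).
  rewrite /z /srefl.
  have wN : dp w w = 3 * N by rewrite /w !dpE (dpC dp th) lth lN thN; field.
  have lw : dp l w = - (3 / 2 * N) by rewrite /w !dpE lth lN; field.
  have -> : 2 * dp l w / dp w w = -1 by rewrite wN lw; field.
  by rewrite scaleN1r opprK /w addrA -mulr2n scaler_nat.
have ls1 : l - th \in s.
  have -> : l - th = - srefl dp l th.
    rewrite /srefl (dpC dp th) lth lN opprB.
    by rewrite (_ : 2 * (3 / 2 * N) / (3 * N) = 1) ?scale1r //; field.
  by apply: (rootN rs); apply: (rs_refl rs).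
have ls2 : 2 *: th - l \in s.
  have -> : 2 *: th - l = - srefl dp th (l - th).
    apply: (dp_inj (dp := dp)) => u; rewrite /srefl !dpE lth thN.
    by field.
  by apply: (rootN rs); apply: (rs_refl rs).
have l1N : dp (l - th) (l - th) = N.
  by rewrite !dpE (dpC dp th) lth lN thN; field.
have l2N : dp (2 *: th - l) (2 *: th - l) = N.
  by rewrite !dpE (dpC dp th) lth lN thN; field.
have l1v := thmax _ ls1 l1N; have l2v := thmax _ ls2 l2N.
have dimS : (2 <= \dim <<s>>)%N.
  have -> : 2%N = \dim <<[:: th; z]>>.
    have thz : dp th z = 0 by rewrite /z !dpE (dpC dp th) lth thN; field.
    rewrite (@orthogonal_dim _ _ dp) //=.
    - rewrite andbT inE; apply/eqP => e; move: thz; rewrite -e thN.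
      by move/eqP: NN.
    - by move=> e; rewrite !inE => /orP[] /eqP ->; apply: (rs_neq0 rs).
    - move=> e f; rewrite !inE => /orP[] /eqP -> /orP[] /eqP ->; rewrite ?eqxx //.
      by rewrite dpC thz.
  by apply/dimvS/sub_span => e; rewrite !inE => /orP[] /eqP ->.
have fin (a1 a2 : V) : a1 \in s -> a2 \in s -> dp a1 a1 = N -> dp a2 a2 = 3 * N ->
    dp a1 a2 = - (3 / 2 * N) -> 0 <= dp a1 v -> 0 <= dp a2 v -> pole_bound dp s k v.
  move=> a1s a2s a11 a22 a12 v1 v2.
  pose A i := if i is 0%N then a1 else a2.
  have /andP[pS pL] := G2_pos.
  have As i : (i < 2)%N -> A i \in s by case: i => [|[|i] ].
  have Av i : (i < 2)%N -> 0 <= dp (A i) v by case: i => [|[|i] ].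
  have Ag i j : (i < 2)%N -> (j < 2)%N ->
      dp (A i) (A j) = ((zrow G2_gram i)`_j)%:~R * (N / 2).
    case: i j => [|[|i] ] [|[|j] ] //= _ _; rewrite /zrow /=.
    - by rewrite a11; field.
    - by rewrite a12; field.
    - by rewrite dpC a12; field.
    - by rewrite a22; field.
  exact: (list_system_bound G2_system rs irr N0 isT isT prs As Ag kk G2_antichain
    pS pL Av dimS).
have zN : dp z z = 3 * N by rewrite /z !dpE (dpC dp th) lth lN thN; field.
have [zv|/ltW zv] := lerP 0 (dp z v).
  apply: (fin (2 *: th - l) z) => //.
    by rewrite /z !dpE (dpC dp th) lth lN thN; field.
  by move: l1v; rewrite !dpE; lra.
apply: (fin (l - th) (- z)) => //.
- exact: (rootN rs).
- by rewrite dpNl dpNr opprK.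
- by rewrite /z !dpE (dpC dp th) lth lN thN; field.
- by move: l2v; rewrite !dpE; lra.
- by rewrite dpNl oppr_ge0.
Qed.

End SmallSystems.

(** * Frames of short roots, and the system F4 *)

Section F4.
Variables (R : realType) (V : vectType R) (dp : {dot V for idfun}).
Implicit Types (a b c d e f r t u v w : V) (s : seq V).

Lemma srefl_dp a b c : a != 0 -> dp (srefl dp a b) (srefl dp a c) = dp b c.
Proof.
move=> /(dp_gt0 dp)/lt0r_neq0 aa; rewrite /srefl !dpE (dpC dp a c).
by field.
Qed.

(** Having a partner of the same length with inner product [x] is stable under reflections, so
    [linked] applies to it. *)
Lemma linked_partner s (n x : R) p q b : rootsys dp s -> irreducible dp s ->
  p \in s -> q \in s -> dp p p = n -> dp q q = n -> dp p q = x -> b \in s ->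
  exists c d, [/\ c \in s, d \in s, dp c c = n, dp d d = n & dp c d = x /\ dp c b != 0].
Proof.
move=> rs irr ps qs pn qn pq bs.
pose Q c := (dp c c == n) && has (fun d => (dp d d == n) && (dp c d == x)) s.
have [||c [cs /andP[/eqP cn /hasP[d ds /andP[/eqP dn /eqP cd] ] ] cb] ] :=
    linked (Q := Q) rs irr _ ps _ bs.
- move=> g h gs hs /andP[hn /hasP[d ds /andP[dn hd] ] ].
  have g0 := rs_neq0 rs gs; rewrite /Q srefl_norm // hn /=.
  apply/hasP; exists (srefl dp g d); first exact: (rs_refl rs).
  by rewrite srefl_norm // dn srefl_dp.
- by rewrite /Q pn eqxx; apply/hasP; exists q; rewrite // qn pq !eqxx.
by exists c, d.
Qed.

Section Frames.
Variables (s : seq V) (N : R).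
Hypothesis tl : two_lengths dp s N.
Let rs := tl_rs tl.
Let irr := tl_irr tl.
Let N0 := tl_gt0 tl.
Let NN : N != 0 := lt0r_neq0 N0.

Definition orthopair e f :=
  [/\ short dp s N e, short dp s N f, dp e f = 0 & long dp s N (e + f)].

Lemma orthopairC e f : orthopair e f -> orthopair f e.
Proof. by case=> se sf ef lef; split=> //; [rewrite dpC | rewrite addrC]. Qed.

Lemma orthopairN e f : orthopair e f -> orthopair e (- f).
Proof.
case=> se sf ef lef; split=> //; first exact: (shortN tl).
  by rewrite dpNr ef oppr0.
exact: (long_opp_sum tl).
Qed.

Lemma orthopairNl e f : orthopair e f -> orthopair (- e) f.
Proof. by move=> /orthopairC/orthopairN/orthopairC. Qed.

(* An orthogonal frame of short roots, as in the coordinates [R^4] of F4. *)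
Definition frame e1 e2 e3 e4 := [/\ orthopair e1 e2, orthopair e1 e3, orthopair e1 e4 &
  [/\ orthopair e2 e3, orthopair e2 e4, orthopair e3 e4 &
    (2^-1) *: (e1 + e2 + e3 + e4) \in s] ].

Lemma frame_swap12 e1 e2 e3 e4 : frame e1 e2 e3 e4 -> frame e1 e3 e2 e4.
Proof.
case=> o12 o13 o14 [o23 o24 o34 h]; split=> //; split=> //; first exact: orthopairC.
by rewrite (addrAC e1).
Qed.

Lemma frame_swap23 e1 e2 e3 e4 : frame e1 e2 e3 e4 -> frame e1 e2 e4 e3.
Proof.
case=> o12 o13 o14 [o23 o24 o34 h]; split=> //; split=> //; first exact: orthopairC.
by rewrite (addrAC (e1 + e2)).
Qed.

Lemma frame_opp e1 e2 e3 e4 : frame e1 e2 e3 e4 -> frame e1 (- e2) e3 e4.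
Proof.
case=> o12 o13 o14 [o23 o24 o34 h]; split=> //; first exact: orthopairN.
split=> //; try exact: orthopairNl.
have [s1 s2 d12 _] := o12; have [_ s3 d23 _] := o23; have [_ s4 d24 _] := o24.
have := rs_refl rs (short_mem s2) h; rewrite (reflS _ s2).
congr (is_true (_ \in s)); apply: (dp_inj (dp := dp)) => u.
rewrite !dpE d12 (short_norm s2) (dpC dp e3 e2) d23 (dpC dp e4 e2) d24.
by field.
Qed.

Lemma frame_nonneg e1 e2 e3 e4 v : frame e1 e2 e3 e4 ->
  exists f2 f3 f4, frame e1 f2 f3 f4 /\ [/\ 0 <= dp f2 v, 0 <= dp f3 v & 0 <= dp f4 v].
Proof.
have flip a b c : frame e1 a b c -> exists2 a', frame e1 a' b c & 0 <= dp a' v.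
  move=> fr; have [|/ltW le] := lerP 0 (dp a v); first by exists a.
  by exists (- a); [apply: frame_opp | rewrite dpNl oppr_ge0].
move=> /flip[f2 /frame_swap12/flip[f3 fr p3] p2].
have [f4 fr4 p4] := flip _ _ _ (frame_swap12 (frame_swap23 fr)).
exists f4, f3, f2; split=> //.
Qed.

Lemma frame_sorted e1 e2 e3 e4 v : frame e1 e2 e3 e4 ->
  exists f2 f3 f4, frame e1 f2 f3 f4 /\
    [/\ 0 <= dp f4 v, dp f4 v <= dp f3 v & dp f3 v <= dp f2 v].
Proof.
move=> /(frame_nonneg v)[a [b [c [fr [a0 b0 c0] ] ] ] ].
wlog ab : a b c fr a0 b0 c0 / dp b v <= dp a v.
  move=> H; have [|/ltW le] := lerP (dp b v) (dp a v); first exact: (H a b c fr).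
  exact: (H b a c (frame_swap12 fr)).
have [cb|/ltW bc] := lerP (dp c v) (dp b v); first by exists a, b, c.
have [ca|/ltW ac] := lerP (dp c v) (dp a v).
  by exists a, c, b; split=> //; apply: frame_swap23.
by exists c, a, b; split=> //; apply: frame_swap12; apply: frame_swap23.
Qed.

(** A short root [t] at 60 degrees to [e1] becomes the half sum. A long root not orthogonal to [e1]
    becomes [e1 + e2] up to sign, and a long root at 60 degrees to it is [e1 + e3] or [e2 + e3].
    After sign changes [t] has inner product [N / 2] with all three, and [2 *: t] determines the
    fourth vector. *)
Lemma frame_exists p q l m e1 : short dp s N p -> short dp s N q ->
  dp p q = N / 2 -> long dp s N l -> long dp s N m -> dp l m = N ->
  short dp s N e1 -> exists e2 e3 e4, frame e1 e2 e3 e4.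
Proof.
move=> sp sq pq ll lm lmN s1.
have e1s := short_mem s1; have n1 := short_norm s1.
have [t [st t1] ] : exists t, short dp s N t /\ dp t e1 = N / 2.
  have [c [d [cs ds cn dn [cd cb] ] ] ] := linked_partner rs irr (short_mem sp)
    (short_mem sq) (short_norm sp) (short_norm sq) pq e1s.
  have sc : short dp s N c by rewrite /short cs cn eqxx.
  have sd : short dp s N d by rewrite /short ds dn eqxx.
  have [->|[->|[h|[h|h] ] ] ] := short_short tl sc s1.
  - by exists d; rewrite dpC.
  - by exists (- d); rewrite dpNl dpNr opprK dpC; split=> //; apply: (shortN tl).
  - by rewrite h eqxx in cb.
  - by exists c.
  - by exists (- c); rewrite dpNl h opprK; split=> //; apply: (shortN tl).
have [l' [ll' l1] ] : exists l', long dp s N l' /\ dp e1 l' = N.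
  have [c [lc c1] ] := linked_long tl ll e1s.
  have [h|[h|h] ] := short_long tl s1 lc.
  - by rewrite dpC h eqxx in c1.
  - by exists c.
  - by exists (- c); rewrite dpNr h opprK; split=> //; apply: (longN tl).
have [s2 o12] := short_long_sub tl s1 ll' l1.
set e2 := l' - e1 in s2 o12.
have l12 : long dp s N (e1 + e2) by rewrite /e2 addrC subrK.
have O12 : orthopair e1 e2 by split.
have [m' [lm' m'N] ] : exists m', long dp s N m' /\ dp m' (e1 + e2) = N.
  have [c [d [cs ds cn dn [cd cb] ] ] ] := linked_partner rs irr (long_mem ll)
    (long_mem lm) (long_norm ll) (long_norm lm) lmN (long_mem l12).
  have lc : long dp s N c by rewrite /long cs cn eqxx.
  have ld : long dp s N d by rewrite /long ds dn eqxx.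
  have [->|[->|[h|[h|h] ] ] ] := long_long tl lc l12.
  - by exists d; rewrite dpC.
  - by exists (- d); rewrite dpNl dpNr opprK dpC; split=> //; apply: (longN tl).
  - by rewrite h eqxx in cb.
  - by exists c.
  - by exists (- c); rewrite dpNl h opprK; split=> //; apply: (longN tl).
have lm12 := long_opp_sum tl s1 s2 o12 l12.
have n2 := short_norm s2.
have [e3 [O13 O23] ] : exists e3, orthopair e1 e3 /\ orthopair e2 e3.
  have [h1|h1] : (dp e1 m' = N /\ dp e2 m' = 0) \/ (dp e1 m' = 0 /\ dp e2 m' = N).
    move: m'N; rewrite dpDr !(dpC dp m').
    have := short_long tl s1 lm'; have := short_long tl s2 lm'.
    move=> [->|[->|->] ] [->|[->|->] ] h;
      by [left; lra | right; lra | exfalso; lra].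
  - case: h1 => h1 h2; have [s3 o13] := short_long_sub tl s1 lm' h1.
    exists (m' - e1); split; first by split=> //; rewrite addrC subrK.
    split=> //; first by rewrite dpDr dpNr h2 (dpC dp e2) o12 subr0.
    have := long_refl tl (long_mem lm12) lm'; rewrite (reflL tl _ lm12).
    rewrite dpDr dpNr !(dpC dp m') h1 h2 subr0 divff // scale1r.
    by congr (is_true (long dp s N _)); apply: (dp_inj (dp := dp)) => u; rewrite !dpE; ring.
  - case: h1 => h1 h2; have [s3 o23] := short_long_sub tl s2 lm' h2.
    exists (m' - e2); split; last by split=> //; rewrite addrC subrK.
    split=> //; first by rewrite dpDr dpNr h1 o12 subr0.
    have := long_refl tl (long_mem lm12) lm'; rewrite (reflL tl _ lm12).
    rewrite dpDr dpNr !(dpC dp m') h1 h2 sub0r mulNr divff // scaleN1r opprK.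
    by congr (is_true (long dp s N _)); apply: (dp_inj (dp := dp)) => u; rewrite !dpE; ring.
(* As [e1 + e] is long, [dp t (e1 + e)] is [0], [N] or [- N]; with [dp t e1 = N / 2] this prevents
   [t] from being orthogonal to [e]. *)
have half e : orthopair e1 e -> dp t e = N / 2 \/ dp t e = - (N / 2).
  case=> _ se e1e le; have := short_long tl st le; rewrite dpDr t1.
  have := short_short tl st se; have nt := short_norm st.
  move=> [->|[->|[->|[->|->] ] ] ] [h|[h|h] ]; rewrite ?dpNr ?nt;
    rewrite ?dpNr ?nt in h; have := N0; move=> ?;
    by [left; lra | right; lra | exfalso; lra].
have [f2 [P12 P23 t2] ] :
    exists f2, [/\ orthopair e1 f2, orthopair f2 e3 & dp t f2 = N / 2].
  have [h|h] := half _ O12; first by exists e2.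
  exists (- e2); split; [exact: orthopairN | exact: orthopairNl | by rewrite dpNr h opprK].
have [f3 [P13 {}P23 t3] ] :
    exists f3, [/\ orthopair e1 f3, orthopair f2 f3 & dp t f3 = N / 2].
  have [h|h] := half _ O13; first by exists e3.
  exists (- e3); split; [exact: orthopairN | exact: orthopairN | by rewrite dpNr h opprK].
have nt := short_norm st; have ts := short_mem st.
have [_ sf2 d12 L12] := P12; have [_ sf3 d13 L13] := P13; have [_ _ d23 L23] := P23.
have nf2 := short_norm sf2; have nf3 := short_norm sf3.
pose f4 := 2 *: t - e1 - f2 - f3.
have step e w : short dp s N e -> short dp s N w -> dp w e = N / 2 -> short dp s N (w - e).
  move=> se sw we; have := short_refl tl (short_mem se) sw.
  rewrite (reflS _ se) we (_ : 2 * (N / 2) / N = 1) ?scale1r //; first by field.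
have sf4 : short dp s N f4.
  have -> : f4 = t - e1 - f2 - f3 - (- t).
    by apply: (dp_inj (dp := dp)) => u; rewrite !dpE; ring.
  apply: (step); [exact: (shortN tl)| |].
    apply: (step) => //; last by rewrite !dpE t3 d13 d23 !subr0.
    apply: (step) => //; last by rewrite !dpE t2 d12 subr0.
    exact: step.
  by rewrite !dpE !(dpC dp _ t) nt t1 t2 t3; field.
have d4 e : dp f4 e = 2 * dp t e - dp e1 e - dp f2 e - dp f3 e.
  by rewrite /f4 !dpE.
(* [a + f4 = 2 *: t - b - c] is minus the reflection of the long root [b + c] in [t]. *)
have P4 a b c : orthopair b c -> dp a b = 0 -> dp a c = 0 -> short dp s N a ->
    f4 = 2 *: t - a - b - c -> dp t a = N / 2 -> dp t b = N / 2 -> dp t c = N / 2 ->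
    orthopair a f4.
  move=> [sb sc bc lbc] ab ac sa fE ta tb tc; split=> //.
    by rewrite fE !dpE (dpC dp a t) ta (short_norm sa) ab ac; field.
  have := longN tl (long_refl tl ts lbc); rewrite (reflS _ st) dpDl !(dpC dp _ t) tb tc.
  rewrite (_ : 2 * (N / 2 + N / 2) / N = 2); last by field.
  congr (is_true (long dp s N _)); rewrite fE.
  by apply: (dp_inj (dp := dp)) => u; rewrite !dpE; ring.
exists f2, f3, f4; split=> //; first exact: (P4 e1 f2 f3).
split=> //.
- apply: (P4 f2 e1 f3) => //; first by rewrite dpC.
  by rewrite /f4; congr (_ - _); rewrite addrAC.
- apply: (P4 f3 e1 f2) => //; rewrite 1?dpC //.
  by rewrite /f4 (addrAC _ (- f2)) (addrAC _ (- e1)).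
rewrite (_ : _ *: _ = t) //; apply: (dp_inj (dp := dp)) => u.
by rewrite /f4 !dpE; field.
Qed.
End Frames.

(* Once [e1] is highest on [v] among the short roots and [e2, e3, e4] are ordered,
   the base [e2 - e3], [e3 - e4], [e4], [(e1 - e2 - e3 - e4) / 2] is nonnegative
   on [v]. *)
Lemma F4_bound s N k v p q l m : two_lengths dp s N -> kinv dp s k ->
  short dp s N p -> short dp s N q -> dp p q = N / 2 ->
  long dp s N l -> long dp s N m -> dp l m = N -> pole_bound dp s k v.
Proof.
move=> tl kk sp sq pq ll lm lmN.
have rs := tl_rs tl; have irr := tl_irr tl; have N0 := tl_gt0 tl.
have NN := lt0r_neq0 N0.
pose S := [seq r <- s | dp r r == N].
have pS : p \in S by rewrite mem_filter andbC.
have [e1 e1S emax] := seq_max (fun r => dp r v) pS.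
have s1 : short dp s N e1 by move: e1S; rewrite mem_filter andbC.
have {}emax r : short dp s N r -> dp r v <= dp e1 v.
  by move=> sr; apply: emax; rewrite mem_filter andbC.
have [x2 [x3 [x4 fr0] ] ] := frame_exists tl sp sq pq ll lm lmN s1.
have [e2 [e3 [e4 [fr [v4 v34 v23] ] ] ] ] := frame_sorted tl v fr0.
have [o12 o13 o14 [o23 o24 o34 h] ] := fr.
have [_ s2 d12 _] := o12; have [_ s3 d13 _] := o13; have [_ s4 d14 _] := o14.
have [_ _ d23 _] := o23; have [_ _ d24 _] := o24; have [_ _ d34 _] := o34.
have n1 := short_norm s1; have n2 := short_norm s2.
have n3 := short_norm s3; have n4 := short_norm s4.
have orthE := (d12, d13, d14, d23, d24, d34, n1, n2, n3, n4).
have symE := (dpC dp e2 e1, dpC dp e3 e1, dpC dp e4 e1, dpC dp e3 e2, dpC dp e4 e2,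
  dpC dp e4 e3).
pose A i := nth 0 [:: e2 - e3; e3 - e4; e4; 2^-1 *: (e1 - e2 - e3 - e4)] i.
have As i : (i < 4)%N -> A i \in s.
  case: i => [|[|[|[|i] ] ] ] //= _.
  - by have [_ _ _ /long_mem] := orthopairN tl o23.
  - by have [_ _ _ /long_mem] := orthopairN tl o34.
  - exact: short_mem s4.
  (* [fl] rotates three vectors of the frame and negates one; applied three times it negates all of
     them. *)
  have fl a b c : frame s N e1 a b c -> frame s N e1 b c (- a).
    by move=> /(frame_opp tl)/(frame_swap12)/(frame_swap23).
  by have [_ _ _ [_ _ _] ] := fl _ _ _ (fl _ _ _ (fl _ _ _ fr)).
have Av i : (i < 4)%N -> 0 <= dp (A i) v.
  (* Maximality of [e1] against this short root says that [e1 - e2 - e3 - e4] is nonnegative at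
     [v]. *)
  have sh : short dp s N (2^-1 *: (e1 + e2 + e3 + e4)).
    by rewrite /short h !dpE !symE !orthE; apply/eqP; field.
  have := emax _ sh; rewrite !dpE => hm.
  by case: i => [|[|[|[|i] ] ] ] //= _; rewrite /A /= ?dpE; lra.
have Ag i j : (i < 4)%N -> (j < 4)%N ->
    dp (A i) (A j) = ((zrow F4_gram i)`_j)%:~R * (N / 2).
  case: i => [|[|[|[|i] ] ] ] //; case: j => [|[|[|[|j] ] ] ] // _ _;
  by rewrite /A /= ?dpE ?symE ?orthE /zrow /=; field.
have dimS : (4 <= \dim <<s>>)%N.
  have n0 e : short dp s N e -> e != 0 by move=> /short_mem; apply: (rs_neq0 rs).
  have ne e f : short dp s N e -> dp e f = 0 -> e != f.
    move=> se ef; apply/eqP => E; move: ef; rewrite -E (short_norm se) => /eqP.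
    by rewrite (negPf NN).
  have -> : 4%N = \dim <<[:: e1; e2; e3; e4]>>.
    rewrite (@orthogonal_dim _ _ dp) //=.
    - by rewrite !inE !negb_or !ne.
    - by move=> e; rewrite !inE => /or4P[] /eqP ->; apply: n0.
    - move=> e f; rewrite !inE => /or4P[] /eqP -> /or4P[] /eqP ->; rewrite ?eqxx //;
      by rewrite ?symE ?orthE.
  apply/dimvS/sub_span => e; rewrite !inE => /or4P[] /eqP ->;
    [exact: short_mem s1|exact: short_mem s2|exact: short_mem s3|exact: short_mem s4].
have nrm r : r \in s -> dp r r = N \/ dp r r = 2%:~R * N by apply: (tl_norm tl).
have prs := two_norm_pairs rs N0 (or_introl (erefl 2)) nrm.
have /andP[pS' pL'] := F4_pos.
exact: (list_system_bound F4_system rs irr N0 isT isT prs As Ag kk F4_antichain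
  pS' pL' Av dimS).
Qed.

End F4.

(** * The bound for an arbitrary root system, with the rank of the incident roots *)

Section PoleBound.
Variables (R : realType) (V : vectType R) (dp : {dot V for idfun}).
Implicit Types (a b c d e f r t u v w : V) (s : seq V).

Lemma two_lengths_bound s N k v a b : two_lengths dp s N -> kinv dp s k ->
  short dp s N a -> long dp s N b -> pole_bound dp s k v.
Proof.
move=> tl kk sa lb.
have exS : exists c, short dp s N c by exists a.
have exL : exists c, long dp s N c by exists b.
have [crS|ncrS] := EM (shorts_cross dp s N); first exact: (shorts_cross_bound tl).
have [crL|ncrL] := EM (longs_cross dp s N); first exact: (longs_cross_bound v tl kk).
have [p [q [sp sq pq] ] ] :
    exists p q, [/\ short dp s N p, short dp s N q & dp p q = N / 2].
  apply: contrapT => no; apply: ncrS => p q sp sq.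
  have [->|[->|[->|[h|h] ] ] ] := short_short tl sp sq;
    try by [constructor 1|constructor 2|constructor 3].
    by exfalso; apply: no; exists p, q.
  by exfalso; apply: no; exists p, (- q); rewrite dpNr h opprK; split=> //; exact: (shortN tl).
have [l [m [ll lm lmN] ] ] :
    exists l m, [/\ long dp s N l, long dp s N m & dp l m = N].
  apply: contrapT => no; apply: ncrL => l m ll lm.
  have [->|[->|[->|[h|h] ] ] ] := long_long tl ll lm;
    try by [constructor 1|constructor 2|constructor 3].
    by exfalso; apply: no; exists l, m.
  by exfalso; apply: no; exists l, (- m); rewrite dpNr h opprK; split=> //; exact: (longN tl).
exact: (F4_bound v tl kk sp sq pq ll lm lmN).
Qed.

Lemma irreducible_pole_bound s k v : rootsys dp s -> irreducible dp s ->
  kinv dp s k -> pole_bound dp s k v.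
Proof.
move=> rs irr kk.
have [g2|ng2] := EM (exists a b, [/\ a \in s, b \in s & dp a a = 3 * dp b b]).
  by have [a [b [as_ bs ab] ] ] := g2; apply: (G2_bound v rs irr kk as_ bs ab).
have [tw|ntw] := EM (exists a b, [/\ a \in s, b \in s & dp b b = 2 * dp a a]).
  have [a [b [as_ bs ab] ] ] := tw.
  have a0 : 0 < dp a a by rewrite dp_gt0 ?(rs_neq0 rs).
  have tl : two_lengths dp s (dp a a).
    split=> // c cs; have c0 : 0 < dp c c by rewrite dp_gt0 ?(rs_neq0 rs).
    have [h|[h|h]|[h|h] ] := irreducible_lengths rs irr as_ cs; [by left|by right| | |].
    - by case: ng2; exists c, a.
    - have [h'|[h'|h']|[h'|h'] ] := irreducible_lengths rs irr bs cs;
      by exfalso; lra.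
    - by case: ng2; exists a, c.
  apply: (two_lengths_bound v tl kk (a := a) (b := b)).
    by rewrite /short as_ eqxx.
  by rewrite /long bs ab eqxx.
case: s rs irr kk ng2 ntw => [|a s] rs irr kk ng2 ntw; first by rewrite /pole_bound.
apply: (@bound_simply_laced _ _ _ _ _ _ (dp a a)) => // c cs.
have as_ := mem_head a s.
have [|[h|h]|[h|h] ] := irreducible_lengths rs irr as_ cs => //.
- by case: ntw; exists a, c.
- by case: ng2; exists c, a.
- by case: ntw; exists c, a.
- by case: ng2; exists a, c.
Qed.

Lemma rootsys_pole_bound s k v : rootsys dp s -> kinv dp s k -> pole_bound dp s k v.
Proof.
move=> rs kk; apply: pole_bound_irreducible rs kk => {}s rs irr kk.
exact: irreducible_pole_bound.
Qed.

(** Membership in [W] is stable under reflections, and every root counted on either side lies in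
    [W]. *)
Lemma pole_bound_span s k v : rootsys dp s -> kinv dp s k ->
  (count (fun a => dp a v == k a) s <= count (fun a => dp a v == 0%R) s
    + \dim <<[seq a <- s | (dp a v == k a) || (dp a v == 0%R)]>>)%N.
Proof.
move=> rs kk; set W := <<_>>%VS.
pose s' := [seq a <- s | a \in W].
have rs' : rootsys dp s'.
  by apply: rootsys_filter => // a b _ _ aW bW; rewrite memvB ?memvZ.
have kk' : kinv dp s' k.
  by move=> a b; rewrite !mem_filter => /andP[_ as_] /andP[_ bs]; apply: kk.
have := rootsys_pole_bound v rs' kk'; rewrite /pole_bound !count_filter.
have eW (P : pred V) : {in s, forall a, P a -> (dp a v == k a) || (dp a v == 0)} ->
    count (predI P (mem W)) s = count P s.
  move=> h; apply: eq_in_count => a as_ /=; case: (boolP (P a)) => //= Pa.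
  by apply: memv_span; rewrite mem_filter as_ (h a as_ Pa).
rewrite (eW (fun a => dp a v == k a)); last by move=> a _ ->.
rewrite (eW (fun a => dp a v == 0)); last by move=> a _ ->; rewrite orbT.
move=> h; apply: leq_trans h _; rewrite leq_add2l; apply: dimvS.
by apply/span_subvP => a; rewrite mem_filter => /andP[].
Qed.

End PoleBound.

(** * From vectors to functionals *)

Section Transfer.
Variables (R : realType) (V : vectType R) (dp : {dot V for idfun}).
Variables (R0 : {fset 'Hom(V, R^o)}) (k : R0 -> R).

Lemma flatK : cancel (sharp dp) (flat dp).
Proof. by move=> a; apply/lfunP => v; rewrite flatE sharpE. Qed.

Lemma sharp_reflection a b :
  sharp dp (reflection dp a b) = srefl dp (sharp dp a) (sharp dp b).
Proof. by rewrite /sharp /reflection linearB linearZ. Qed.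

Definition root_vectors := [seq sharp dp (val a) | a <- enum {: R0}].

(* The value [0] off [root_vectors] is never used. *)
Definition root_weight (u : V) : R := if insub (flat dp u) is Some a then k a else 0.

Lemma root_weightE (a : R0) : root_weight (sharp dp (val a)) = k a.
Proof. by rewrite /root_weight flatK valK. Qed.

Lemma root_vectorsP u :
  reflect (exists2 a, a \in R0 & u = sharp dp a) (u \in root_vectors).
Proof.
apply: (iffP mapP) => [[a _ ->]|[a aR ->] ]; first by exists (val a); rewrite ?(fsvalP a).
by exists [` aR]%fset; rewrite ?mem_enum.
Qed.

Lemma count_root_vectors (p : pred V) :
  count p root_vectors = #|[pred a : R0 | p (sharp dp (val a))]|.
Proof. by rewrite count_map cardE enumT /enum_mem size_filter. Qed.

Lemma root_vectors_rootsys : root_system dp R0 -> reduced_roots R0 ->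
  integral_roots dp R0 -> rootsys dp root_vectors.
Proof.
move=> [n0 refl] red int; split.
- rewrite map_inj_uniq ?enum_uniq // => a b /(can_inj flatK); exact: val_inj.
- move=> _ /root_vectorsP[a aR ->]; apply/eqP => e; have /eqP[] := n0 a aR.
  by apply: (can_inj flatK); rewrite e /sharp linear0.
- move=> _ _ /root_vectorsP[a aR ->] /root_vectorsP[b bR ->].
  by rewrite -sharp_reflection; apply/root_vectorsP;
    exists (reflection dp a b); rewrite ?refl.
- by move=> _ _ /root_vectorsP[a aR ->] /root_vectorsP[b bR ->]; apply: int.
move=> _ x /root_vectorsP[a aR ->] /root_vectorsP[b bR].
rewrite /sharp -linearZ => /(can_inj flatK) e; apply: (red a x aR).
by rewrite e.
Qed.

Lemma root_weight_kinv : root_system dp R0 -> weyl_invariant dp k ->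
  kinv dp root_vectors root_weight.
Proof.
move=> rs inv _ _ /root_vectorsP[a aR ->] /root_vectorsP[b bR ->].
rewrite -sharp_reflection; have rR := root_refl rs aR bR.
rewrite (root_weightE [` rR]%fset) (root_weightE [` bR]%fset).
exact: (inv _ (weyl_refl aR (weyl_id _ _)) [` bR]%fset [` rR]%fset).
Qed.

Hypotheses (rs : root_system dp R0) (red : reduced_roots R0)
  (int : integral_roots dp R0) (inv : weyl_invariant dp k).

Let incident v := [seq u <- root_vectors | (dp u v == root_weight u) || (dp u v == 0)].

Lemma pole_order_span v : pole_order k v <= (\dim <<incident v>>)%:Z - (\dim {:V})%:Z.
Proof.
have := pole_bound_span v (root_vectors_rootsys rs red int) (root_weight_kinv rs inv).
rewrite !count_root_vectors /= -/(incident v).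
have -> : #|[pred a : R0 | dp (sharp dp (val a)) v == root_weight (sharp dp (val a))]| =
    #|[pred a : R0 | val a v == k a]|.
  by apply: eq_card => a; rewrite !inE root_weightE sharpE.
have -> : #|[pred a : R0 | dp (sharp dp (val a)) v == 0]| = #|[pred a : R0 | val a v == 0]|.
  by apply: eq_card => a; rewrite !inE sharpE.
rewrite /pole_order; lia.
Qed.

Lemma pole_order_le0 v : pole_order k v <= 0.
Proof. by apply: le_trans (pole_order_span v) _; rewrite subr_le0 lez_nat dimvS ?subvf. Qed.

Lemma incident_span v : pole_order k v = 0 -> <<incident v>>%VS = fullv.
Proof.
move=> o0; apply/eqP; rewrite eqEdim subvf /=.
by have := pole_order_span v; rewrite o0 subr_ge0 lez_nat.
Qed.

Lemma pole_order_finite : finite_set [set v : V | pole_order k v = 0]%classic.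
Proof.
pose f v := ([set a : R0 | val a v == k a], [set a : R0 | val a v == 0]).
have oE v : pole_order k v = #|(f v).1|%:Z - #|(f v).2|%:Z - (\dim {:V})%:Z.
  by rewrite /pole_order !cardsE.
pose S := [set v : V | pole_order k v = 0]%classic.
apply: (@sub_finite_set _ _ (f @^-1` (f @` S))%classic) => [v Sv|]; first by exists v.
apply: finite_preimage; last exact: finite_finset.
(* [v] is only known to share its value of [f] with a point of [S]; as [pole_order] depends on [f]
   alone, [v] has order 0 too. The roots incident to [v] then agree at [v] and [w], and they span
   everything. *)
move=> v w /set_mem[v' Sv' fv] _ fvw.
have Sv : pole_order k v = 0 by rewrite oE -fv -oE.
suff sub : (<<incident v>> <= lker (flat dp (v - w)))%VS.
  apply/subr0_eq/(dp_eq0 (dp := dp)).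
  have /subvP/(_ (v - w)) := sub.
  by rewrite (incident_span Sv) memvf memv_ker flatE => /(_ isT)/eqP.
apply/span_subvP => u; rewrite mem_filter => /andP[+ /root_vectorsP[a aR ue] ].
rewrite ue memv_ker flatE (dpC dp (v - w)) dpDr dpNr subr_eq0 !sharpE.
rewrite (root_weightE [` aR]%fset : root_weight (sharp dp a) = _) /=.
have [e1 e2] : f v = f w := fvw.
have := (finset.setP _ _).2 e1 [` aR]%fset.
have := (finset.setP _ _).2 e2 [` aR]%fset.
rewrite !inE /= => z p /orP[] h; move: (h); rewrite ?z ?p => /eqP h';
  by rewrite (eqP h) h'.
Qed.

End Transfer.

Local Open Scope classical_set_scope.

Theorem theorem1p1 (R : realType) (V : vectType R) (dp : {dot V for idfun})
    (R0 : {fset 'Hom(V, R^o)}) (k : R0 -> R) :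
  root_system dp R0 -> reduced_roots R0 -> integral_roots dp R0 ->
  weyl_invariant dp k ->
  (forall v : V, pole_order k v <= 0) /\
  finite_set [set v : V | pole_order k v = 0].
Proof.
move=> rs red int inv; split; first exact: (pole_order_le0 rs red int inv).
exact: (pole_order_finite rs red int inv).
Qed.
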